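(* Let $L/k$ be a Galois (not necessarily abelian) extension of number fields. Let $K$ be an intermediate field such that $K/k$ and $L/K$ are abelian, $K$ is totally real, and $L/K$ is tame of odd prime degree $\ell$. Suppose there exists a prime $\mathfrak{p}$ of $k$ that is ramified in $L/K$ (so $e_{\mathfrak{p},L/K}=\ell$) such that $e_{\mathfrak{p},K/k}$ has a nontrivial odd factor. Assume moreover: (a) $K$ is linearly disjoint from $\mathbb{Q}(\zeta_\ell)$ over $\mathbb{Q}$ (equivalently $[K(\zeta_\ell):K]=\ell-1$); and (b) if $\ell=3$, then $e_{\mathfrak{p},K/k}$ has an odd prime divisor $q$ such that $\zeta_q\notin L(\zeta_{3^\infty})$. Then $L/K$ has no weak normal integral basis.
   Context: ''Tame'' means at most tamely ramified. A prime $\mathfrak{p}$ of $k$ is said to ramify in $L/K$ if some prime of $K$ above $\mathfrak{p}$ ramifies in $L$. $e_{\mathfrak{p},K/k}$ is the ramification index of $\mathfrak{p}$ in $K/k$; $e_{\mathfrak{p},L/K}$ is the ramification index in $L/K$ of any prime of $K$ above $\mathfrak{p}$. $\zeta_n$ is a primitive $n$-th root of unity and $L(\zeta_{3^\infty})=\bigcup_n L(\zeta_{3^n})$. A tame abelian extension $L/K$ with group $G$ has a weak normal integral basis if $\mathfrak{M}\mathcal{O}_L$ is free over $\mathfrak{M}$, the unique maximal $\mathcal{O}_K$-order in $K[G]$. *)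

(* Defs.v *)
From HB Require Import structures.
From mathcomp Require Import all_boot all_order all_algebra all_fingroup all_field.
From mathcomp Require Import boolp classical_sets.

Set Implicit Arguments.
Unset Strict Implicit.
Unset Printing Implicit Defensive.

Import Order.TTheory GRing.Theory Num.Theory.
Local Open Scope classical_set_scope.
Local Open Scope ring_scope.

(* All number fields are subfields E of one finite extension L of a number
   field F0; the ideals of their rings of integers are sets of elements of L. *)
Section NumberFields.

Variables (F0 : fieldType) (L : fieldExtType F0).
Implicit Types (E F : {subfield L}) (I J P Q : set L).

Definition int_ring E : set L :=
  [set x | x \in E /\ integralOver (intr : int -> L) x].

Definition is_ideal E I : Prop :=
  [/\ I `<=` int_ring E, I 0,
      forall x y, I x -> I y -> I (x + y)
    & forall a x, int_ring E a -> I x -> I (a * x)].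

(* The primes of a number field are the finite ones. *)
Definition is_prime_of E P : Prop :=
  [/\ is_ideal E P, exists2 x, P x & x != 0, ~ P 1
    & forall x y, int_ring E x -> int_ring E y -> P (x * y) -> P x \/ P y].

Definition ideal_mul I J : set L :=
  [set x | exists n (a b : 'I_n -> L),
     [/\ forall i, I (a i), forall i, J (b i) & x = \sum_(i < n) a i * b i]].

Definition ideal_exp E I (n : nat) : set L :=
  iter n (ideal_mul I) (int_ring E).

Definition lies_above E P Q : Prop := Q `&` [set x | x \in E] = P.

(* e is the exponent of the prime Q of F in the factorization of P O_F. *)
Definition has_ram_index F P Q (e : nat) : Prop :=
  exists J, [/\ is_ideal F J, ~ (J `<=` Q)
              & ideal_mul P (int_ring F) = ideal_mul (ideal_exp F Q e) J].

(* For F / E Galois, e is the common ramification index over P of the primes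
   of F above P. *)
Definition galois_ram_index E F P (e : nat) : Prop :=
  forall Q, is_prime_of F Q -> lies_above E P Q -> has_ram_index F P Q e.

Definition ramifies E F P : Prop :=
  exists Q e, [/\ is_prime_of F Q, lies_above E P Q, has_ram_index F P Q e
                & (1 < e)%N].

Definition ramifies_above k E F P : Prop :=
  exists P', [/\ is_prime_of E P', lies_above k P P' & ramifies E F P'].

(* The residue fields are finite, hence perfect, so tameness only bears on the
   ramification indices; r is the residue characteristic of Q. *)
Definition tame E F : Prop :=
  forall P Q e r, is_prime_of E P -> is_prime_of F Q -> lies_above E P Q ->
    has_ram_index F P Q e -> prime r -> Q r%:R -> ~~ (r %| e)%N.

(* Every embedding of a number field in the complex numbers has its image in
   the algebraic numbers. *)
Definition totally_real E : Prop :=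
  forall (f : {rmorphism subvs_of E -> algC}) x, f x \is Num.real.

End NumberFields.

Section SubfieldsOfAlgC.

Implicit Types E F : set algC.

Definition rat_in_algC : set algC := range (ratr : rat -> algC).

Definition adjoin E (z : algC) : set algC :=
  [set y | exists p q : {poly algC},
     [/\ forall i, E p`_i, forall i, E q`_i, q.[z] != 0 & y = p.[z] / q.[z]]].

(* Linear disjointness over the rational numbers. *)
Definition linearly_disjoint E F : Prop :=
  forall n (x : 'I_n -> algC), (forall i, E (x i)) ->
    (forall c : 'I_n -> algC, (forall i, rat_in_algC (c i)) ->
       \sum_(i < n) c i * x i = 0 -> forall i, c i = 0) ->
    (forall c : 'I_n -> algC, (forall i, F (c i)) ->
       \sum_(i < n) c i * x i = 0 -> forall i, c i = 0).

End SubfieldsOfAlgC.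

Section GroupAlgebra.

Variables (gT : finGroupType) (F : fieldType).

Definition galg := {ffun gT -> F}.

Implicit Types (a b : galg) (O : set F) (Lam : set galg).

Definition galg_one : galg := [ffun g => (g == 1%g)%:R].

Definition galg_mul a b : galg :=
  [ffun g => \sum_(h : gT) a h * b (h^-1 * g)%g].

Definition galg_scale (c : F) a : galg := [ffun g => c * a g].

Definition is_order O Lam : Prop :=
  [/\ Lam galg_one,
      forall a b, Lam a -> Lam b -> Lam (a - b) /\ Lam (galg_mul a b),
      exists n (e : 'I_n -> galg), forall a, Lam a <->
        exists2 c : 'I_n -> F, forall i, O (c i)
          & a = \sum_(i < n) galg_scale (c i) (e i)
    & forall a, exists n (c : 'I_n -> F) (e : 'I_n -> galg),
        (forall i, Lam (e i)) /\ a = \sum_(i < n) galg_scale (c i) (e i)].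

Definition is_maximal_order O Lam : Prop :=
  is_order O Lam /\
  forall Lam', is_order O Lam' -> Lam `<=` Lam' -> Lam' = Lam.

End GroupAlgebra.

Section WeakNormalIntegralBasis.

Variables (F0 : fieldType) (L : splittingFieldType F0) (K : {subfield L}).

Definition galgK := galg (subg_of 'Gal({:L} / K)) (subvs_of K).

(* Products in gal_of are composed from left to right, so that this is a
   module structure over the group algebra only because it is used for
   abelian groups. *)
Definition galg_act (a : galgK) (x : L) : L :=
  \sum_(g : subg_of 'Gal({:L} / K)) vsval (a g) * sgval g x.

Definition module_generated (M : set galgK) (N : set L) : set L :=
  [set x | exists n (a : 'I_n -> galgK) (y : 'I_n -> L),
     [/\ forall i, M (a i), forall i, N (y i)
       & x = \sum_(i < n) galg_act (a i) (y i)]].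

Definition is_free_over (M : set galgK) (N : set L) : Prop :=
  exists n (b : 'I_n -> L),
    [/\ forall i, N (b i),
        forall x, N x -> exists2 a : 'I_n -> galgK, forall i, M (a i)
          & x = \sum_(i < n) galg_act (a i) (b i)
      & forall a : 'I_n -> galgK, (forall i, M (a i)) ->
          \sum_(i < n) galg_act (a i) (b i) = 0 -> forall i, a i = 0].

Definition has_weak_NIB : Prop :=
  exists M : set galgK,
    is_maximal_order (vsval @^-1` int_ring K) M /\
    is_free_over M (module_generated M (int_ring {:L}%AS)).

End WeakNormalIntegralBasis.

(* Main.v *)
Require Import Defs.
From HB Require Import structures.
From mathcomp Require Import all_boot all_order all_algebra all_fingroup all_field.
From mathcomp Require Import all_solvable.
From mathcomp Require Import boolp classical_sets.
From mathcomp Require Import zify ring.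

Set Implicit Arguments.
Unset Strict Implicit.
Unset Printing Implicit Defensive.

Import Order.TTheory GRing.Theory Num.Theory.
Local Open Scope classical_set_scope.
Local Open Scope ring_scope.

(* Suppose that M O_L = M b. The resolvents theta_t = sum_j zeta^(-tj) g^j b of b, for
   a generator g of Gal(L/K), then divide those of all the integers of L over the
   integers of K(zeta), so that at a prime above p, where g acts on uniformizers
   through zeta modulo the prime, theta_t has valuation t for 0 < t < l. An
   automorphism tau in the inertia group of L(zeta)/k that is nontrivial on K commutes
   with g, since tau g tau^-1 acts on uniformizers through tau(zeta) = zeta, and thus
   multiplies theta_t by a unit u_t of K(zeta). As K is totally real, complex
   conjugation exchanges u_t and u_(l-t), and by Kronecker's theorem u_t / u_(l-t) is a
   root of unity, by which tau multiplies theta_t / theta_(l-t), of odd valuation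
   c = 2t - l. These roots of unity are conjugate over K as c varies, since K is
   linearly disjoint from Q(zeta). If tau has odd prime order q, the elements that it
   fixes have a valuation divisible by q, so that these roots of unity, which behave
   multiplicatively in c modulo q, determine a character of (Z/l)^* that is c modulo q
   for c = 3, l - 2 and l - 6; as l - 6 = 3 (l - 2) modulo l, q divides 2l. The case
   q = l is similar modulo l^2. If l = 3, the root of unity has an order divisible by
   q, which is excluded by the condition on q. *)

(** All fields lie in one Galois extension E of Q, at one prime P of E; ramification indices become
    ratios of generators of value groups, so no factorization of ideals has to be established. The
    quotient of theta_t by theta_(l-t) is formed because the units u_t may have infinite order,
    while a quotient of conjugate units has absolute value 1 in every embedding. The contradiction
    is a wrap-around: an automorphism that sends zeta to zeta^m multiplies c = 2t - l by m only
    modulo l, whereas the valuation sees c as an integer between -l and l. Thus 3 (l - 2) and l - 6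
    belong to the same root of unity but differ by 2l, which q, or l^2 in the case q = l, would have
    to divide. For l = 3 only c = 1 and c = -1 occur and nothing wraps around: what remains is that
    the order of the root of unity is divisible by q, hence the condition on q. *)

Notation aint := (integralOver intr).

(** * Algebraic integers *)

Section AlgebraicIntegers.

Lemma aint_rmorph (K1 K2 : fieldType) (f : {rmorphism K1 -> K2}) (x : K1) :
  aint (f x) <-> aint x.
Proof.
have E p : map_poly (intr : int -> K2) p = map_poly f (map_poly intr p).
  by rewrite -map_poly_comp; apply: eq_map_poly => n /=; rewrite rmorph_int.
by split=> -[p mp rp]; exists p => //; move: rp; rewrite E fmorph_root.
Qed.

Lemma aint_rat (a : rat) : aint a -> exists n : int, a = n%:~R.
Proof.
case=> p mp rp; have : (ratr a : algC) \in Num.int.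
  apply: Cint_rat_Aint; first by apply/CratP; exists a.
  apply: (@root_monic_Aint (map_poly intr p)); last 2 first.
  - by rewrite monic_map.
  - by apply/polyOverP=> i; rewrite coef_map /= intr_int.
  have -> : map_poly (intr : int -> algC) p = map_poly ratr (map_poly intr p).
    by rewrite -map_poly_comp; apply: eq_map_poly => n /=; rewrite ratr_int.
  by rewrite fmorph_root.
case/intrP=> n En; exists n.
by apply: (fmorph_inj (ratr : rat -> algC)); rewrite /= ratr_int.
Qed.

Lemma aint_sum (K : fieldType) (I : Type) (r : seq I) (P : pred I) (F : I -> K) :
  (forall i, P i -> aint (F i)) -> aint (\sum_(i <- r | P i) F i).
Proof.
move=> h; elim/big_rec: _ => [|i x Pi ax]; first exact: integral0.
by apply: integral_add => //; apply: h.
Qed.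

Lemma aint_prod (K : fieldType) (I : Type) (r : seq I) (P : pred I) (F : I -> K) :
  (forall i, P i -> aint (F i)) -> aint (\prod_(i <- r | P i) F i).
Proof.
move=> h; elim/big_rec: _ => [|i x Pi ax]; first exact: integral1.
by apply: integral_mul => //; apply: h.
Qed.

Lemma aint_exp (K : fieldType) (x : K) n : aint x -> aint (x ^+ n).
Proof.
move=> ax; elim: n => [|n IH]; first exact: integral1.
by rewrite exprS; apply: integral_mul.
Qed.

Lemma aint_int (K : fieldType) n : aint (n%:~R : K).
Proof. exact: (@integral_id int K intr n). Qed.

Lemma aint_root_unity (K : fieldType) (x : K) n : (0 < n)%N -> x ^+ n = 1 -> aint x.
Proof.
move=> n0 xn; exists ('X^n - 1); first exact: monicXnsubC.
by rewrite rmorphB /= map_polyXn rmorph1 /root !hornerE xn subrr.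
Qed.

Lemma extQ_intr_eq0 (L : fieldExtType rat) (n : int) : (n%:~R == 0 :> L) = (n == 0).
Proof. by rewrite -(rmorph_int (in_alg L)) fmorph_eq0 intr_eq0. Qed.

Lemma extQ_natr_eq0 (L : fieldExtType rat) (n : nat) : (n%:R == 0 :> L) = (n == 0)%N.
Proof. exact: (extQ_intr_eq0 L n). Qed.

Lemma aint_scaled (L : fieldExtType rat) (x : L) :
  exists2 m, (0 < m)%N & aint (x * m%:R).
Proof.
have [p p0 rp] : exists2 p : {poly int}, p != 0 & root (map_poly intr p) x.
  have /polyOver1P[q Eq] := minPolyOver 1 x.
  have [p [a a0 Ep]] := rat_poly_scale q.
  have q0 : q != 0.
    apply: contraTneq (monic_minPoly 1 x) => q0.
    by rewrite Eq q0 map_poly0 monicE lead_coef0 eq_sym oner_eq0.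
  exists p; first by apply: contraNneq q0 => p0; rewrite Ep p0 map_poly0 scaler0.
  have: root (map_poly (in_alg L) q) x by rewrite -Eq root_minPoly.
  rewrite Ep map_polyZ rootZ ?fmorph_eq0 ?invr_eq0 ?intr_eq0 //.
  rewrite -map_poly_comp; congr root; apply: eq_map_poly => n.
  exact: (rmorph_int (in_alg L)).
have [n En] : exists n, size p = n.+1.
  by exists (size p).-1; rewrite prednK // size_poly_gt0.
set c := lead_coef p; have c0 : c != 0 by rewrite lead_coef_eq0.
have Ec : c = p`_n by rewrite /c lead_coefE En.
case: n => [|n] in En Ec.
  case/negP: c0; move: rp; rewrite (size1_polyC (eq_leq En)) map_polyC /=.
  by rewrite rootC extQ_intr_eq0 Ec.
have ac : aint (x * c%:~R).
  (* [h] collects the lower terms of [c ^+ n * p] rewritten in the variable [c * x], in which that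
     polynomial is monic. *)
  pose h : {poly int} := \poly_(i < n.+1) (p`_i * c ^+ (n - i)).
  exists ('X^(n.+1) + h).
    by rewrite monicE lead_coefDl ?lead_coefXn // size_polyXn ltnS size_poly.
  have hornerZ (q : {poly int}) N (y : L) : (size q <= N)%N ->
      (map_poly intr q).[y] = \sum_(i < N) (q`_i)%:~R * y ^+ i.
    move=> le; rewrite (horner_coef_wide _ (leq_trans (size_poly _ _) le)).
    by apply: eq_bigr => i _; rewrite coef_map.
  move: rp; rewrite /root rmorphD /= map_polyXn hornerD hornerXn => /eqP rp.
  rewrite (hornerZ _ _ _ (size_poly _ _)).
  rewrite (hornerZ _ _ _ (eq_leq En)) big_ord_recr /= -Ec in rp.
  apply/eqP; rewrite -[RHS](mulr0 (c%:~R ^+ n)) -[in RHS]rp mulrDr [LHS]addrC; congr (_ + _).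
    rewrite mulr_sumr; apply: eq_bigr => i _.
    rewrite coef_poly ltn_ord /= rmorphM rmorphXn /=.
    have -> : (c%:~R : L) ^+ n = c%:~R ^+ (n - i) * c%:~R ^+ i.
      by rewrite -exprD subnK // -ltnS ltn_ord.
    by rewrite exprMn; ring.
  by rewrite exprMn mulrC mulrA -exprSr.
exists `|c|%N; first by rewrite absz_gt0.
rewrite -[_%:R]/(Posz `|c|%N)%:~R abszE; case: (ger0P c) => _ //.
by rewrite mulrNz mulrN; apply: integral_opp.
Qed.

End AlgebraicIntegers.

Lemma pigeonhole (T : finType) (g : nat -> T) : exists i j, (i < j)%N /\ g i = g j.
Proof.
pose h (i : 'I_#|T|.+1) := g i.
have /injectivePn [i [j ne eq]] : ~~ injectiveb h.
  apply/negP => /injectiveP /leq_card; by rewrite card_ord ltnn.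
have [lt|gt|/val_inj e] := ltngtP i j; last by rewrite e eqxx in ne.
  by exists i, j.
by exists j, i.
Qed.

(** * Traces, and finiteness of the integers modulo [m] *)

Section GaloisNumberField.

Variable E : splittingFieldType rat.
Implicit Types (F : {subfield E}) (s : gal_of {:E}) (x y : E).

Lemma galois_full F : galois F {:E}.
Proof.
apply/and3P; split; [exact: subvf| |exact: normalFieldf].
apply/separableP => x _; apply: pcharf0_separable.
by move=> q; rewrite pchar_lalg pchar_num.
Qed.

Lemma galMx s t x : (s * t)%g x = t (s x).
Proof. by rewrite galM ?memvf. Qed.

Lemma galVK s x : (s^-1)%g (s x) = x.
Proof. by rewrite -galMx mulgV gal_id. Qed.

Lemma galKV s x : s ((s^-1)%g x) = x.
Proof. by rewrite -galMx mulVg gal_id. Qed.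

Lemma mem_galP F s : reflect {in F, forall x, s x = x} (s \in 'Gal({:E} / F)%g).
Proof.
rewrite gal_kHom ?subvf //.
apply: (iffP kHomP_tmp) => [[h _] //|h]; split=> // x y _ _; exact: rmorphM.
Qed.

Lemma galois_mem F x :
  (forall s, s \in 'Gal({:E} / F)%g -> s x = x) -> x \in F.
Proof.
move=> h; rewrite -(elimT galois_fixedField (galois_full F)).
by apply/fixedFieldP; rewrite ?memvf.
Qed.

Lemma aint_gal s x : aint (s x) <-> aint x.
Proof. exact: aint_rmorph. Qed.

Definition traceQ x := \sum_(s : gal_of {:E}) s x.

Lemma traceQ_rat x : exists a : rat, traceQ x = a%:A.
Proof.
have : traceQ x \in 1%AS.
  apply: galois_mem => s _; rewrite rmorph_sum /= [RHS](reindex_inj (mulIg s)) /=.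
  by apply: eq_bigr => t _; rewrite galMx.
by case/vlineP => a ->; exists a.
Qed.

Lemma traceQ_int x : aint x -> exists n : int, traceQ x = n%:~R.
Proof.
move=> ax; have [a Ea] := traceQ_rat x.
have /aint_rat[n En] : aint a.
  apply/(aint_rmorph (in_alg E)); rewrite /= -Ea.
  by apply: aint_sum => s _; apply/aint_gal.
exists n; rewrite Ea En; exact: (rmorph_int (in_alg E)).
Qed.

Definition traceq x : rat := projT1 (cid (traceQ_rat x)).

Lemma traceqE x : traceQ x = (traceq x)%:A.
Proof. by rewrite /traceq; case: cid. Qed.

Lemma traceQ_linear I (r : seq I) (c : I -> rat) (e : I -> E) :
  traceQ (\sum_(i <- r) c i *: e i) = \sum_(i <- r) c i *: traceQ (e i).
Proof.
rewrite /traceQ; under eq_bigr do rewrite linear_sum.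
rewrite exchange_big /=; apply: eq_bigr => i _; rewrite scaler_sumr.
by apply: eq_bigr => s _; rewrite linearZ.
Qed.

Lemma aint_basis : exists N (e : 'I_N -> E),
  [/\ forall i, aint (e i), forall x, exists c, x = \sum_i c i *: e i
    & forall c, \sum_i c i *: e i = 0 -> forall i, c i = 0].
Proof.
pose b := vbasis {:E}; pose N := \dim {:E}.
have scaled (i : 'I_N) : exists n, (0 < n)%N /\ aint (b`_i * n%:R).
  by have [n n0 an] := aint_scaled b`_i; exists n.
have [m mP] := boolp.choice scaled.
have m0 i : (m i)%:R != 0 :> rat by rewrite pnatr_eq0 -lt0n; case: (mP i).
have Ee (i : 'I_N) c : c *: (b`_i * (m i)%:R) = (c * (m i)%:R) *: b`_i.
  by rewrite -(scaler_nat _ (1 : E)) -scalerAr mulr1 scalerA.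
exists N, (fun i : 'I_N => b`_i * (m i)%:R); split=> [i|x|c c0 i].
- by case: (mP i).
- exists (fun i : 'I_N => coord b i x / (m i)%:R).
  rewrite {1}(coord_vbasis (memvf x)); apply: eq_bigr => i _.
  by rewrite Ee divfK.
have/freeP/(_ (fun i : 'I_N => c i * (m i)%:R)) := basis_free (vbasisP {:E}).
move=> /(_ _ i)/eqP; rewrite mulf_eq0 (negPf (m0 i)) orbF => /(_ _)/eqP-> //.
by rewrite -[RHS]c0; apply: eq_bigr => j _; rewrite Ee.
Qed.

Lemma traceQ_nondeg x : (forall y, traceQ (x * y) = 0) -> x = 0.
Proof.
move=> h; apply/eqP/negPn/negP => x0; have /eqP := h x^-1.
rewrite divff // /traceQ; under eq_bigr do rewrite rmorph1.
rewrite sumr_const extQ_natr_eq0 => /eqP/card0_eq/(_ 1%g).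
by rewrite !inE.
Qed.

(** The [e i] are a rational basis made of integers, not an integral basis. The traces against them
    give the coordinates of [x] through the inverse of the Gram matrix of the trace form, and [D]
    clears the denominators of this inverse. *)
Lemma aint_of_traces : exists N (e : 'I_N -> E) (D : nat),
  [/\ forall i, aint (e i), (0 < D)%N,
      forall x, (forall i, traceQ (x * e i) = 0) -> x = 0
    & forall x, (forall i, exists n : int, traceQ (x * e i) = n%:~R) ->
        aint (x * D%:R)].
Proof.
have [N [e [ae genE freeE]]] := aint_basis.
have nondeg x : (forall i, traceQ (x * e i) = 0) -> x = 0.
  move=> h; apply: traceQ_nondeg => y; have [c ->] := genE y.
  rewrite mulr_sumr; under eq_bigr do rewrite -scalerAr.
  by rewrite traceQ_linear big1 // => i _; rewrite h scaler0.
pose G : 'M[rat]_N := \matrix_(i, j) traceq (e i * e j).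
have traceG (c : 'I_N -> rat) j :
    traceQ ((\sum_i c i *: e i) * e j) = ((\row_i c i) *m G) 0 j *: 1.
  rewrite mulr_suml; under eq_bigr do rewrite -scalerAl.
  rewrite traceQ_linear mxE scaler_suml; apply: eq_bigr => i _.
  by rewrite traceqE scalerA !mxE.
have Gu : G \in unitmx.
  rewrite -row_free_unit; apply: inj_row_free => v vG.
  have v0 : \sum_i v 0 i *: e i = 0.
    apply: nondeg => j; rewrite traceG (_ : \row_i v 0 i = v) ?vG ?mxE ?scale0r //.
    by apply/rowP => i; rewrite mxE.
  by apply/rowP => i; rewrite mxE (freeE _ v0).
pose D := (\prod_(ij : 'I_N * 'I_N) `|denq (invmx G ij.1 ij.2)|)%N.
have D0 : (0 < D)%N by apply: prodn_gt0 => ij; rewrite absz_gt0 denq_neq0.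
have DG i j : exists n : int, D%:R * invmx G i j = n%:~R.
  rewrite /D (bigD1 (i, j)) //=; set m := (\prod_(_ | _) _)%N.
  exists (m%:Z * numq (invmx G i j)); rewrite natrM mulrAC.
  rewrite -[`|_|%:R]/((Posz `|denq (invmx G i j)|)%:~R) absz_denq.
  by rewrite [_ * invmx G i j]mulrC -numqE mulrC intrM.
exists N, e, D; split=> // x hx.
have [c Ex] := genE x; rewrite Ex mulr_suml; apply: aint_sum => j _.
have [t Et] : exists t : 'I_N -> int, forall i, ((\row_i c i) *m G) 0 i = (t i)%:~R.
  suff /boolp.choice[t tP] : forall i, exists n : int, ((\row_i c i) *m G) 0 i = n%:~R.
    by exists t.
  move=> i; have [n] := hx i; rewrite Ex traceG => En; exists n.
  apply: (fmorph_inj (in_alg E)); rewrite (rmorph_int (in_alg E)); exact: En.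
have [n En] : exists n : int, D%:R * c j = n%:~R.
  have -> : c j = (\row_i (t i)%:~R *m invmx G) 0 j.
    rewrite (_ : \row_i (t i)%:~R = \row_i c i *m G) ?mulmxK ?mxE //.
    by apply/rowP => i; rewrite mxE -Et.
  have /boolp.choice[u uP] := DG^~ j.
  rewrite mxE mulr_sumr; exists (\sum_i t i * u i); rewrite rmorph_sum /=.
  by apply: eq_bigr => i _; rewrite mxE mulrCA uP intrM.
rewrite mulr_natr -scaler_nat scalerA En scaler_int -mulrzl.
by apply: integral_mul => //; apply: aint_int.
Qed.

Lemma traceQD x y : traceQ (x + y) = traceQ x + traceQ y.
Proof. by rewrite /traceQ -big_split; apply: eq_bigr => s _; rewrite rmorphD. Qed.

Lemma traceQN x : traceQ (- x) = - traceQ x.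
Proof. by rewrite /traceQ -sumrN; apply: eq_bigr => s _; rewrite rmorphN. Qed.

Lemma traceQZ (c : rat) x : traceQ (c *: x) = c *: traceQ x.
Proof. by rewrite /traceQ scaler_sumr; apply: eq_bigr => s _; rewrite linearZ. Qed.

Lemma traceQ_numq x : aint x -> traceQ x = (numq (traceq x))%:~R.
Proof.
move=> ax; have [n En] := traceQ_int ax; rewrite En; congr (_%:~R).
have -> : traceq x = n%:~R; last by rewrite numq_int.
by apply: (fmorph_inj (in_alg E)); rewrite (rmorph_int (in_alg E)) -En traceqE.
Qed.

(** Finiteness of the integers modulo [m], in the form that [pigeonhole] uses: a map to a finite
    type that separates the classes. By [aint_of_traces], the traces modulo [m * D] do so. *)
Lemma aint_mod_fin (m : nat) : (0 < m)%N ->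
  exists (T : finType) (f : E -> T),
    forall x y, aint x -> aint y -> f x = f y -> aint ((x - y) / m%:R).
Proof.
move=> m0; have [N [e [D [ae D0 _ De]]]] := aint_of_traces.
pose M := (m * D)%N; have M0 : (0 < M)%N by rewrite muln_gt0 m0.
(* The traces of integers are rational integers, which [numq] reads off. *)
pose n x i := numq (traceq (x * e i)).
pose f x : {ffun 'I_N -> 'I_M.-1.+1} := [ffun i => inord `|(n x i %% M)%Z|%N].
exists _, f => x y ax ay /ffunP Ef.
have mE : m%:R != 0 :> E by rewrite extQ_natr_eq0 -lt0n.
have DE : D%:R != 0 :> E by rewrite extQ_natr_eq0 -lt0n.
have ME : M%:R != 0 :> E by rewrite extQ_natr_eq0 -lt0n.
have -> : (x - y) / m%:R = (x - y) / M%:R * D%:R.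
  by rewrite /M natrM invfM mulrA divfK.
apply: De => i; have {Ef} := Ef i; rewrite !ffunE => /(congr1 val) /=.
have lt z : (`|(n z i %% M)%Z| < M.-1.+1)%N.
  rewrite prednK // -ltz_nat gez0_abs ?modz_ge0 ?ltz_pmod //.
  by rewrite eqz_nat -lt0n.
rewrite !inordK // => /(congr1 Posz); rewrite !gez0_abs ?modz_ge0 //;
  try by rewrite eqz_nat -lt0n.
move=> /eqP; rewrite eqz_mod_dvd => /dvdzP[q Eq]; exists q.
rewrite mulrAC mulrBl; have -> : x * e i - y * e i = x * e i + - (y * e i) by [].
rewrite (_ : _ / _ = (M%:R^-1 : rat) *: (x * e i + - (y * e i))).
  rewrite traceQZ traceQD traceQN !traceQ_numq; try exact: integral_mul.
  rewrite -rmorphB /= -/(n x i) -/(n y i) Eq -(rmorph_int (in_alg E)) /=.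
  rewrite scalerA intrM mulrC mulfK ?pnatr_eq0 -?lt0n //.
  exact: (rmorph_int (in_alg E)).
rewrite -mulr_algl; rewrite mulrC; congr (_ * _).
by rewrite -(rmorph_nat (in_alg E)) -fmorphV.
Qed.

(* The powers of y lie in the lattice of the integers divided by m, which is finite
   modulo the integers; so y^j - y^i is an integer for some i < j. *)
Lemma aint_of_bounded_powers (m : nat) y : (0 < m)%N ->
  (forall n, aint (y ^+ n * m%:R)) -> aint y.
Proof.
move=> m0 hy; have [T [f fP]] := aint_mod_fin m0.
have mE : m%:R != 0 :> E by rewrite extQ_natr_eq0 -lt0n.
have [i [j [lt Ef]]] := pigeonhole (fun n => f (y ^+ n * m%:R)).
have := fP _ _ (hy j) (hy i) (esym Ef).
rewrite -mulrBl mulfK // => ad; set d := _ - _ in ad.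
apply: (@integral_root_monic _ _ _ _ ('X^j - 'X^i - d%:P)).
- by rewrite -addrA monicE lead_coefDl ?lead_coefXn // size_polyXn -opprD size_polyN
    (leq_ltn_trans (size_polyD _ _)) // gtn_max size_polyXn size_polyC ltnS lt;
     case: (d != 0); rewrite ?ltnS // (leq_ltn_trans _ lt).
- by rewrite /root !hornerE /d subrr.
apply/integral_poly => k; rewrite !coefE.
apply: integral_sub; last by case: ifP => _ //; apply: integral0.
by apply: integral_sub; apply: integral_nat.
Qed.

(* Kronecker: the traces of the powers of w against an integral basis are bounded
   rational integers, hence so do two powers of w coincide. *)
Lemma kronecker (f : {rmorphism E -> algC}) w : aint w ->
  (forall s : gal_of {:E}, `|f (s w)| = 1) -> exists2 n, (0 < n)%N & w ^+ n = 1.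
Proof.
move=> aw w1; have [N [e [D [ae D0 nondeg _]]]] := aint_of_traces.
pose T n i := numq (traceq (w ^+ n * e i)).
have awe n i : aint (w ^+ n * e i) by apply: integral_mul => //; apply: aint_exp.
pose C i := \sum_(s : gal_of {:E}) `|f (s (e i))|.
have C0 i : 0 <= C i by apply: sumr_ge0 => s _; apply: normr_ge0.
have TC n i : `|(T n i)%:~R| <= C i.
  rewrite -(rmorph_int f) -traceQ_numq // /traceQ rmorph_sum.
  apply: le_trans (ler_norm_sum _ _ _) _; apply: ler_sum => s _ /=.
  by rewrite rmorphM rmorphXn rmorphM rmorphXn normrM normrX w1 expr1n mul1r.
pose B := (\sum_i Num.bound (C i))%N.
have TB n i : (`|T n i| <= B)%N.
  have : `|(T n i)%:~R| < (Num.bound (C i))%:R :> algC.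
    by apply: le_lt_trans (TC n i) _; apply: archi_boundP.
  rewrite -intr_norm -abszE; set t := `|T n i|%N; rewrite -[t%:~R]/(t%:R) ltr_nat.
  by move=> /ltnW /leq_trans -> //; rewrite /B (bigD1 i) //= leq_addr.
pose g n : {ffun 'I_N -> 'I_(B + B).+1} := [ffun i => inord `|(T n i + B)%R|%N].
have [i [j [lt /ffunP Eg]]] := pigeonhole g.
have w0 : w != 0.
  by apply/eqP => w0; have /eqP := w1 1%g; rewrite w0 !rmorph0 normr0 eq_sym oner_eq0.
have Ew : w ^+ j - w ^+ i = 0.
  apply: nondeg => k; have /(congr1 val) := Eg k; rewrite !ffunE /=.
  have := TB i k; have := TB j k => h1 h2; rewrite !inordK; try lia.
  move=> Et; rewrite mulrBl traceQD traceQN !traceQ_numq // -/(T i k) -/(T j k).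
  by rewrite (_ : T j k = T i k) ?subrr //; lia.
exists (j - i)%N; first by rewrite subn_gt0.
apply: (mulfI (expf_neq0 i w0)); rewrite -exprD subnKC 1?ltnW // mulr1.
by apply/eqP; rewrite -subr_eq0 Ew.
Qed.

End GaloisNumberField.

(** * Discrete valuations *)

Section DiscreteValuation.

Variables (E : splittingFieldType rat) (F : {subfield E}) (P : set E).
Hypothesis primeP : is_prime_of F P.
Implicit Types x y a s : E.

Local Notation O := (int_ring F).

Lemma int_ring_sub x y : O x -> O y -> O (x - y).
Proof. by case=> Fx ax [Fy ay]; split; [apply: rpredB|apply: integral_sub]. Qed.

Lemma int_ring_add x y : O x -> O y -> O (x + y).
Proof. by case=> Fx ax [Fy ay]; split; [apply: rpredD|apply: integral_add]. Qed.

Lemma int_ring_mul x y : O x -> O y -> O (x * y).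
Proof. by case=> Fx ax [Fy ay]; split; [apply: rpredM|apply: integral_mul]. Qed.

Lemma int_ring_nat n : O n%:R.
Proof. by split; [apply: rpred_nat|apply: integral_nat]. Qed.

Lemma int_ring1 : O 1. Proof. exact: int_ring_nat 1%N. Qed.

Lemma int_ring_exp x n : O x -> O (x ^+ n).
Proof. by case=> Fx ax; split; [apply: rpredX|apply: aint_exp]. Qed.

Lemma int_ring_prod (I : Type) (r : seq I) (Q : pred I) (f : I -> E) :
  (forall i, Q i -> O (f i)) -> O (\prod_(i <- r | Q i) f i).
Proof.
move=> h; elim/big_rec: _ => [|i x Qi Ox]; first exact: int_ring1.
by apply: int_ring_mul => //; apply: h.
Qed.

Lemma prime_sub x : P x -> O x.
Proof. by case: primeP => -[h _ _ _] _ _ _; apply: h. Qed.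

Lemma prime_mulr a x : O a -> P x -> P (a * x).
Proof. by case: primeP => -[_ _ _ h] _ _ _; apply: h. Qed.

Lemma prime_mull a x : O a -> P x -> P (x * a).
Proof. by rewrite mulrC; apply: prime_mulr. Qed.

Lemma prime_add x y : P x -> P y -> P (x + y).
Proof. by case: primeP => -[_ _ h _] _ _ _; apply: h. Qed.

Lemma prime_not1 : ~ P 1. Proof. by case: primeP. Qed.

Lemma prime0 : P 0. Proof. by case: primeP => -[_ h _ _] _ _ _. Qed.

Lemma prime_or x y : O x -> O y -> P (x * y) -> P x \/ P y.
Proof. by case: primeP => _ _ _; apply. Qed.

(** The denominators of the localization at P. The local ring is not formed: divisibility in it is
    expressed by identities with a factor from this set. *)
Definition coprime_to s := O s /\ ~ P s.
Local Notation U := coprime_to.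

Lemma coprime_to_mul s t : U s -> U t -> U (s * t).
Proof.
case=> Os Ps [Ot Pt]; split; first exact: int_ring_mul.
by case/(prime_or Os Ot).
Qed.

Lemma coprime_to1 : U 1. Proof. split; [exact: int_ring1|exact: prime_not1]. Qed.

Lemma coprime_to_prod (I : Type) (r : seq I) (Q : pred I) (f : I -> E) :
  (forall i, Q i -> U (f i)) -> U (\prod_(i <- r | Q i) f i).
Proof.
move=> h; elim/big_rec: _ => [|i x Qi Ux]; first exact: coprime_to1.
by apply: coprime_to_mul => //; apply: h.
Qed.

Lemma coprime_to_sub1 x : P x -> U (1 - x).
Proof.
move=> Px; split; first exact: int_ring_sub int_ring1 (prime_sub Px).
by move=> h; apply: prime_not1; rewrite -(subrK x 1); apply: prime_add.
Qed.

Lemma coprime_to_neq0 s : U s -> s != 0.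
Proof. by case=> _ h; apply/eqP => s0; apply: h; rewrite s0; apply: prime0. Qed.

(** Up to sign, [y] is the product of the other conjugates of [x]; it lies in F as the quotient of a
    rational integer by [x]. *)
Lemma nat_multiple x : O x -> x != 0 ->
  exists m y, [/\ (0 < m)%N, O y & x * y = m%:R].
Proof.
move=> [Fx ax] x0; pose N := \prod_(s : gal_of {:E}) s x.
have aN : aint N by apply: aint_prod => s _; apply/aint_gal.
have N0 : N != 0 by apply/prodf_neq0 => s _; rewrite fmorph_eq0.
have [n En] : exists n : int, N = n%:~R.
  have : N \in 1%AS.
    apply: galois_mem => s _; rewrite /N rmorph_prod [RHS](reindex_inj (mulIg s)) /=.
    by apply: eq_bigr => t _; rewrite galMx.
  case/vlineP => a Ea; have /aint_rat[n En] : aint a.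
    by apply/(aint_rmorph (in_alg E)); rewrite /= -Ea.
  exists n; rewrite Ea En; exact: (rmorph_int (in_alg E)).
have aNx : aint (N / x).
  rewrite /N (bigD1 1%g) //= gal_id mulrAC divff // mul1r.
  by apply: aint_prod => s _; apply/aint_gal.
have FN : N \in F by rewrite En rpred_int.
have n0 : n != 0 by apply: contraNneq N0 => n0; rewrite En n0.
exists `|n|%N, (N / x * (Num.sg n)%:~R); split; first by rewrite absz_gt0.
  apply: int_ring_mul; first by split=> //; apply: rpred_div.
  by split; [apply: rpred_int|apply: aint_int].
rewrite mulrA mulrCA divff // mulr1 En -intrM -[RHS]/(Posz `|n|)%:~R abszE.
by rewrite mulrC -normrEsg.
Qed.

Lemma prime_nat : exists2 r, prime r & P r%:R.
Proof.
have ex : exists m, (0 < m)%N && `[< P m%:R >].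
  case: primeP => _ [x Px x0] _ _.
  have [m [y [m0 Oy Exy]]] := nat_multiple (prime_sub Px) x0.
  by exists m; rewrite m0; apply/asboolP; rewrite -Exy; apply: prime_mull.
case: (ex_minnP ex) => m /andP[m0 /asboolP Pm] minm; exists m => //.
have m1 : (1 < m)%N.
  by rewrite ltn_neqAle m0 andbT eq_sym; apply/eqP => m1; apply: prime_not1; rewrite m1 in Pm.
apply/prime.primeP; split=> // d /dvdnP[c Ec].
have [c0 d0] : (0 < c)%N /\ (0 < d)%N.
  by move: m0; rewrite Ec muln_gt0 => /andP.
have [Pc|Pd] : P c%:R \/ P d%:R.
  by apply: prime_or; try exact: int_ring_nat; rewrite -natrM -Ec.
- have : (m <= c)%N by apply: minm; rewrite c0; apply/asboolP.
  by rewrite Ec -{2}[c]muln1 leq_pmul2l // => ?; apply/orP; left; rewrite eqn_leq d0 andbT.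
- have : (m <= d)%N by apply: minm; rewrite d0; apply/asboolP.
  rewrite Ec -{2}[d]mul1n leq_pmul2r // => ?; apply/orP; right.
  by rewrite -{1}[d]mul1n eqn_pmul2r // eqn_leq c0.
Qed.

Lemma int_ring_mod_fin (m : nat) : (0 < m)%N -> exists (T : finType) (f : E -> T),
  forall x y, O x -> O y -> f x = f y -> O ((x - y) / m%:R).
Proof.
move=> m0; have [T [f fP]] := aint_mod_fin E m0; exists T, f => x y [Fx ax] [Fy ay] e.
split; last exact: fP.
by rewrite rpred_div ?rpredB ?rpred_nat.
Qed.

(* b generates the socle of the finite local ring (O / m O)_P. *)
Lemma socle_element (m : nat) : (0 < m)%N -> P m%:R ->
  exists b, [/\ O b, forall s, U s -> ~ O (s * b / m%:R)
              & forall x, P x -> exists2 s, U s & O (s * (b * x) / m%:R)].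
Proof.
move=> m0 Pm; have [T [f fP]] := int_ring_mod_fin m0.
have mE : m%:R != 0 :> E by rewrite extQ_natr_eq0 -lt0n.
pose good b := O b /\ forall s, U s -> ~ O (s * b / m%:R).
suff [b [[Ob gb] nb]] : exists b, good b /\ forall x, P x -> ~ good (b * x).
  exists b; split=> // x Px; apply: contrapT => h; apply: (nb x Px).
  split; first exact: int_ring_mul (prime_sub Px).
  by move=> s Us Os; apply: h; exists s.
apply: contrapT => none.
(* Otherwise a good element can be multiplied by elements of P forever while staying good. Two of
   the products agree modulo [m], so [m] divides some [bs i * (1 - X)] with X in P, and [1 - X] is
   prime to P. *)
have next b : exists x, good b -> P x /\ good (b * x).
  have [gb|ngb] := pselect (good b); last by exists 0.
  apply: contrapT => h; apply: none; exists b; split=> // x Px gx.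
  by apply: h; exists x.
have [h hP] := boolp.choice next.
pose bs n := iter n (fun b => b * h b) 1.
have g1 : good 1.
  split; first exact: int_ring1.
  move=> s [Os Ps] Osm; apply: Ps; rewrite -[s](divfK mE) -[s]mulr1.
  exact: prime_mulr.
have gbs n : good (bs n) by elim: n => //= n /hP[].
have bsX i d : exists2 X, P X & bs (i + d.+1)%N = bs i * X.
  elim: d => [|d [X PX EX]].
    by exists (h (bs i)); [case: (hP _ (gbs i))|rewrite addn1].
  rewrite addnS /= EX; exists (X * h (bs i * X)); last by rewrite mulrA.
  by apply: prime_mulr; [apply: prime_sub|rewrite -EX; case: (hP _ (gbs (i + d.+1)%N))].
have [i [j [lt Ef]]] := pigeonhole (f \o bs).
have [X PX EX] : exists2 X, P X & bs j = bs i * X.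
  by have := bsX i (j - i).-1; rewrite prednK ?subn_gt0 // subnKC // ltnW.
have := fP _ _ (gbs i).1 (gbs j).1 Ef; rewrite EX -{1}[bs i]mulr1 -mulrBr mulrC.
rewrite [bs i * _]mulrC mulrC; apply: (gbs i).2; exact: coprime_to_sub1.
Qed.

(** The classical proof that P is invertible. The element [y = s * b / m] sends P into the integers
    but is not an integer. If [y * P] were contained in P, all the [y ^+ n * m] would be integral,
    hence [y] too. So [y * pi] is outside P for some [pi] in P, and
    [x * (y * pi) = pi * (y * x)]. *)
Lemma uniformizer_exists : exists pi, P pi /\
  forall x, P x -> exists a s, [/\ O a, U s & x * s = pi * a].
Proof.
have [m /prime_gt0 m0 Pm] := prime_nat; have [T [f fP]] := int_ring_mod_fin m0.
have mE : m%:R != 0 :> E by rewrite extQ_natr_eq0 -lt0n.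
have [b [Ob gb bP]] := socle_element m0 Pm.
(* The factor that [bP] gives can be chosen according to the class of [x] modulo [m]; the product
   over the finitely many classes then serves for all [x]. *)
have [s [Us sP]] : exists s, U s /\ forall x, P x -> O (s * b / m%:R * x).
  have loc t : exists s, U s /\ forall x, P x -> f x = t -> O (s * b / m%:R * x).
    have [[x0 [Px0 Ex0]]|none] := pselect (exists x0, P x0 /\ f x0 = t); last first.
      by exists 1; split; [exact: coprime_to1|move=> x Px Ex; case: none; exists x].
    have [s Us Os] := bP _ Px0; exists s; split=> // x Px Ex.
    have -> : s * b / m%:R * x = s * (b * x0) / m%:R + s * b * ((x - x0) / m%:R).
      by field.
    apply: int_ring_add => //; apply: int_ring_mul.
      by apply: int_ring_mul => //; case: Us.
    by apply: fP; rewrite ?Ex0 //; apply: prime_sub.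
  have [g gP] := boolp.choice loc; exists (\prod_t g t).
  split; first by apply: coprime_to_prod => t _; case: (gP t).
  move=> x Px; rewrite (bigD1 (f x)) //=; set q := \prod_(_ | _) _.
  rewrite (_ : _ * x = q * (g (f x) * b / m%:R * x)); last by field.
  apply: int_ring_mul; last by case: (gP (f x)) => _; apply.
  by apply: int_ring_prod => t _; case: (gP t) => -[].
set y := s * b / m%:R in sP.
have [pi Ppi Pypi] : exists2 pi, P pi & ~ P (y * pi).
  apply: contrapT => none.
  have yP x : P x -> P (y * x) by move=> Px; apply: contrapT => h; apply: none; exists x.
  have ym n : P (y ^+ n * m%:R).
    by elim: n => [|n IH]; rewrite ?mul1r // exprS -mulrA; apply: yP.
  apply: (gb s Us); split.
    by case: Us Ob => -[Fs _] _ [Fb _]; rewrite rpred_div ?rpredM ?rpred_nat.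
  by apply: (aint_of_bounded_powers m0) => n; case: (prime_sub (ym n)).
exists pi; split=> // x Px; exists (y * x), (y * pi); split.
- exact: sP.
- by split=> //; apply: sP.
- by ring.
Qed.

(** Two powers of [pi] agree modulo [m], so [m], a multiple of [x], divides
    [pi ^+ i * (1 - pi ^+ (j - i))]. This bounds how often [pi] can be extracted from [x]. *)
Lemma uniformizer_bound pi x : P pi -> O x -> x != 0 ->
  exists n a s, [/\ O a, U s & x * a = pi ^+ n * s].
Proof.
move=> Ppi Ox x0; have [m [y [m0 Oy Exy]]] := nat_multiple Ox x0.
have [T [f fP]] := int_ring_mod_fin m0.
have mE : m%:R != 0 :> E by rewrite extQ_natr_eq0 -lt0n.
have Opi := prime_sub Ppi.
have [i [j [lt Ef]]] := pigeonhole (fun n => f (pi ^+ n)).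
exists i, (y * ((pi ^+ i - pi ^+ j) / m%:R)), (1 - pi ^+ (j - i)); split.
- by apply: int_ring_mul => //; apply: fP => //; apply: int_ring_exp.
- apply: coprime_to_sub1; rewrite -(subnSK lt) exprSr; apply: prime_mulr => //.
  exact: int_ring_exp.
- by rewrite mulrBr mulr1 -exprD subnKC 1?ltnW // mulrA Exy mulrCA divff // mulr1.
Qed.

Lemma uniformizer_factor : exists pi, [/\ P pi, pi != 0 & forall x, x \in F -> x != 0 ->
  exists (n : int) a s, [/\ U a, U s & x = pi ^ n * (a / s)]].
Proof.
have [pi [Ppi piP]] := uniformizer_exists.
have pi0 : pi != 0.
  apply/eqP => pi0; case: primeP => _ [x Px /eqP x0] _ _; apply: x0.
  have [a [s [_ /coprime_to_neq0 s0]]] := piP _ Px; rewrite pi0 mul0r => /eqP.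
  by rewrite mulf_eq0 (negPf s0) orbF => /eqP.
have intP n : forall x a u, O x -> O a -> U u -> x * a = pi ^+ n * u ->
    exists k b s, [/\ U b, U s & x * s = pi ^+ k * b].
  elim: n => [|n IH] x a u Ox Oa Uu Exa.
    exists 0%N, x, 1; rewrite mulr1 mul1r; split=> //; last exact: coprime_to1.
    split=> // Px; case: Uu => _; apply; move: Exa; rewrite mul1r => <-.
    exact: prime_mull.
  have [Px|Px] := pselect (P x); last first.
    by exists 0%N, x, 1; rewrite mulr1 mul1r; split=> //; exact: coprime_to1.
  have [y [s [Oy Us Exs]]] := piP x Px.
  have Eya : y * a = pi ^+ n * (u * s).
    by apply: (mulfI pi0); rewrite (mulrA pi y a) -Exs mulrAC Exa exprS; ring.
  have [k [b [t [Ub Ut Eyt]]]] := IH y a (u * s) Oy Oa (coprime_to_mul Uu Us) Eya.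
  exists k.+1, b, (s * t); split=> //; first exact: coprime_to_mul.
  by rewrite mulrA Exs -mulrA Eyt exprS mulrA.
exists pi; split=> // x Fx x0.
have [m m0 axm] := aint_scaled x.
have mE : m%:R != 0 :> E by rewrite extQ_natr_eq0 -lt0n.
have factor z : O z -> z != 0 -> exists k b s, [/\ U b, U s & z * s = pi ^+ k * b].
  move=> Oz z0; have [n [a [u [Oa Uu Ez]]]] := uniformizer_bound Ppi Oz z0.
  exact: intP Ez.
have Oxm : O (x * m%:R) by split=> //; rewrite rpredM ?rpred_nat.
have [k [b [s [Ub Us Ek]]]] := factor _ Oxm (mulf_neq0 x0 mE).
have [k' [b' [s' [Ub' Us' Ek']]]] := factor _ (int_ring_nat m) mE.
exists (k%:Z - k'%:Z), (b * s'), (s * b'); split; try exact: coprime_to_mul.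
have [s0 s0' b0'] := And3 (coprime_to_neq0 Us) (coprime_to_neq0 Us') (coprime_to_neq0 Ub').
rewrite expfzDr // -exprnN -exprnP; apply: (mulIf mE).
have -> : x * m%:R = pi ^+ k * b / s by rewrite -Ek mulfK.
have -> : m%:R = pi ^+ k' * b' / s' by rewrite -Ek' mulfK.
have pik : pi ^+ k' != 0 by rewrite expf_neq0.
by field; rewrite s0 s0' b0' pik.
Qed.

End DiscreteValuation.

(** The normalized valuation at P, an additive valuation with integer values. The value [v 0] is
    unspecified, so inequalities that may concern 0 are stated with [vge]. *)
Record valuation (E : splittingFieldType rat) (P : set E) (v : E -> int) : Prop :=
  Valuation {
    valM : forall x y, x != 0 -> y != 0 -> v (x * y) = v x + v y;
    val_aint : forall x, aint x -> x != 0 -> 0 <= v x;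
    val_prime : forall x, P x -> x != 0 -> 0 < v x;
    val_coprime : forall x, aint x -> ~ P x -> v x = 0;
    val_frac : forall x, x != 0 -> 0 <= v x -> exists s, [/\ aint s, ~ P s & aint (s * x)];
    val_uniformizer : exists pi, [/\ P pi, pi != 0 & v pi = 1] }.

Lemma int_ring_full (E : splittingFieldType rat) (x : E) : int_ring {:E}%AS x <-> aint x.
Proof. by split=> [[]|ax] //; split=> //; apply: memvf. Qed.

Lemma valuation_exists (E : splittingFieldType rat) (P : set E) :
  is_prime_of {:E}%AS P -> exists v, valuation P v.
Proof.
move=> pP; have [pi [Ppi pi0 piP]] := uniformizer_factor pP.
have U0 := coprime_to_neq0 pP; have UM := coprime_to_mul pP.
have lt_false (n m : int) a s b t : coprime_to {:E}%AS P a -> coprime_to {:E}%AS P s ->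
    coprime_to {:E}%AS P b -> coprime_to {:E}%AS P t ->
    pi ^ n * (a / s) = pi ^ m * (b / t) -> n < m -> False.
  move=> Ua Us Ub Ut En lt; have : P (a * t); last by case: (UM _ _ Ua Ut).
  have -> : a * t = pi ^ (m - n) * (b * s).
    have s0 := U0 _ Us; have t0 := U0 _ Ut.
    have pin0 : pi ^ n != 0 by rewrite expfz_neq0.
    apply: (mulfI pin0); rewrite [RHS]mulrA -expfzDr // addrC subrK.
    have -> : a * t = a / s * (s * t) by field.
    by rewrite [LHS]mulrA En; field.
  have [d ->] : exists d, m - n = d.+1%:Z by exists `|m - n|.-1%N; lia.
  rewrite -exprnP exprS; apply: (prime_mull pP); last first.
    by apply: (prime_mull pP) => //; apply: int_ring_exp; apply: (prime_sub pP).
  by case: (UM _ _ Ub Us).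
have vP x : exists n : int, x != 0 -> exists a s,
    [/\ coprime_to {:E}%AS P a, coprime_to {:E}%AS P s & x = pi ^ n * (a / s)].
  have [->|x0] := eqVneq x 0; first by exists 0.
  by have [n h] := piP x (memvf x) x0; exists n.
have [v vx] := boolp.choice vP.
have vE x n a s : x != 0 -> coprime_to {:E}%AS P a -> coprime_to {:E}%AS P s ->
    x = pi ^ n * (a / s) -> v x = n.
  move=> x0 Ua Us Ex; have [b [t [Ub Ut Ex']]] := vx x x0.
  have [lt|gt|//] := ltgtP (v x) n.
    by case: (@lt_false (v x) n b t a s) => //; rewrite -Ex'.
  by case: (@lt_false n (v x) a s b t) => //; rewrite -Ex'.
have v1 x : coprime_to {:E}%AS P x -> v x = 0.
  move=> Ux; apply: (@vE x 0 x 1) => //; [exact: U0|exact: coprime_to1|].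
  by rewrite expr0z mul1r divr1.
have vpi : v pi = 1.
  apply: (@vE pi 1 1 1) => //; try exact: coprime_to1.
  by rewrite expr1z divr1 mulr1.
have vM x y : x != 0 -> y != 0 -> v (x * y) = v x + v y.
  move=> x0 y0; have [a [s [Ua Us Ex]]] := vx x x0.
  have [b [t [Ub Ut Ey]]] := vx y y0.
  apply: (@vE _ _ (a * b) (s * t)); rewrite ?mulf_neq0 //; try exact: UM.
  by rewrite expfzDr // invfM {1}Ex {1}Ey; ring.
have vpos x : P x -> x != 0 -> 0 < v x.
  move=> Px x0; have [a [s [Ua Us Ex]]] := vx x x0.
  rewrite ltNge; apply/negP => le0.
  have [d Ed] : exists d, v x = - d%:Z by exists `|v x|%N; lia.
  have s0 := U0 _ Us; case: Ua => _; apply.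
  have -> : a = x * s * pi ^+ d.
    have pid : pi ^+ d != 0 by rewrite expf_neq0.
    by rewrite {1}Ex Ed -exprnN; field; rewrite s0.
  rewrite -mulrA; apply: (prime_mull pP) => //.
  by apply: int_ring_mul; [case: Us|apply: int_ring_exp; apply: (prime_sub pP)].
exists v; split=> //.
- move=> x ax x0; have [Px|Px] := pselect (P x); first exact/ltW/vpos.
  by rewrite v1 //; split=> //; apply/int_ring_full.
- by move=> x ax Px; apply: v1; split=> //; apply/int_ring_full.
- move=> x x0 ge0; have [a [s [Ua Us Ex]]] := vx x x0.
  exists s; case: (Us) => /int_ring_full as_ Ps; split=> //.
  have [d Ed] : exists d, v x = d%:Z by exists `|v x|%N; lia.
  have -> : s * x = pi ^+ d * a.
    by rewrite {1}Ex Ed -exprnP; field; apply: U0.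
  apply: integral_mul; last by case: Ua => /int_ring_full.
  by apply: aint_exp; apply/int_ring_full/(prime_sub pP).
- by exists pi.
Qed.

Section Valued.

Variables (E : splittingFieldType rat) (P : set E) (v : E -> int).
Hypotheses (pP : is_prime_of {:E}%AS P) (hv : valuation P v).
Implicit Types (x y z : E) (s t : gal_of {:E}).

Local Notation vM := (valM hv).

Lemma val1 : v 1 = 0.
Proof.
have := vM (oner_neq0 E) (oner_neq0 E); rewrite mulr1 => h.
by apply: (addrI (v 1)); rewrite addr0 -h.
Qed.

Lemma valV x : x != 0 -> v x^-1 = - v x.
Proof.
move=> x0; have : v (x * x^-1) = 0 by rewrite divff // val1.
by rewrite vM ?invr_eq0 //; lia.
Qed.

Lemma val_div x y : x != 0 -> y != 0 -> v (x / y) = v x - v y.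
Proof. by move=> x0 y0; rewrite vM ?invr_eq0 // valV. Qed.

Lemma valX x n : x != 0 -> v (x ^+ n) = v x * n%:Z.
Proof.
move=> x0; elim: n => [|n IH]; first by rewrite val1 mulr0.
by rewrite exprS vM ?expf_neq0 // IH; lia.
Qed.

Lemma valN x : v (- x) = v x.
Proof.
have [->|x0] := eqVneq x 0; first by rewrite oppr0.
have m0 : (-1 : E) != 0 by rewrite oppr_eq0 oner_eq0.
have := vM m0 m0; rewrite mulrNN mulr1 val1 => h.
by rewrite -mulN1r vM //; lia.
Qed.

Lemma val_prod (I : finType) (Q : pred I) (f : I -> E) :
  (forall i, Q i -> f i != 0) -> v (\prod_(i | Q i) f i) = \sum_(i | Q i) v (f i).
Proof.
move=> h; suff [] : \prod_(i | Q i) f i != 0 /\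
    v (\prod_(i | Q i) f i) = \sum_(i | Q i) v (f i) by [].
elim/big_rec2: _ => [|i y1 y2 Qi [n0 <-]]; first by rewrite oner_eq0 val1.
by rewrite mulf_neq0 ?vM ?h.
Qed.

Definition vge (n : int) x := (x == 0) || (n <= v x).

Lemma vge0 n : vge n 0. Proof. by rewrite /vge eqxx. Qed.

Lemma vge_val n x : x != 0 -> vge n x = (n <= v x).
Proof. by rewrite /vge => /negPf->. Qed.

Lemma vge_le m n x : m <= n -> vge n x -> vge m x.
Proof. by rewrite /vge => le /orP[->//|h]; rewrite (le_trans le h) orbT. Qed.

Lemma vge_aint x : aint x -> vge 0 x.
Proof.
by move=> ax; rewrite /vge; case: eqVneq => //= x0; apply: (val_aint hv).
Qed.

Lemma vge_prime x : P x -> vge 1 x.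
Proof.
move=> Px; rewrite /vge; case: eqVneq => //= x0.
by rewrite -gtz0_ge1; apply: (val_prime hv).
Qed.

Lemma prime_vge x : aint x -> vge 1 x -> P x.
Proof.
move=> ax h; apply: contrapT => nPx; move: h; rewrite /vge (val_coprime hv) // orbF.
by move/eqP => x0; apply: nPx; rewrite x0; apply: (prime0 pP).
Qed.

Lemma vgeM m n x y : vge m x -> vge n y -> vge (m + n) (x * y).
Proof.
have [->|x0] := eqVneq x 0; first by rewrite mul0r => *; apply: vge0.
have [->|y0] := eqVneq y 0; first by rewrite mulr0 => *; apply: vge0.
by rewrite !vge_val ?mulf_neq0 // vM //; lia.
Qed.

Lemma vgeN n x : vge n (- x) = vge n x.
Proof. by rewrite /vge oppr_eq0 valN. Qed.

(** The ultrametric inequality follows from [val_frac]: if [v x <= v y], some [s] outside P makes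
    [s * (1 + y / x)] an integer. *)
Lemma vgeD n x y : vge n x -> vge n y -> vge n (x + y).
Proof.
have [->|x0] := eqVneq x 0; first by rewrite add0r.
have [->|y0] := eqVneq y 0; first by rewrite addr0.
wlog le : x y x0 y0 / v x <= v y.
  move=> h; have [/h|/ltW/h] := leP (v x) (v y); first exact.
  by rewrite addrC => h' hx hy; apply: h'.
rewrite vge_val // => hx _; apply: (vge_le hx).
have yx0 : y / x != 0 by rewrite mulf_neq0 ?invr_eq0.
have := val_frac hv yx0; rewrite val_div // subr_ge0 => /(_ le)[s [as_ Ps asyx]].
have s0 : s != 0 by apply/eqP => s0; apply: Ps; rewrite s0; apply: (prime0 pP).
have : vge 0 (s * (1 + y / x)).
  by apply: vge_aint; rewrite mulrDr mulr1; apply: integral_add.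
have -> : x + y = x * (1 + y / x) by field.
have [->|n0] := eqVneq (1 + y / x) 0; first by rewrite !mulr0 => _; apply: vge0.
by rewrite !vge_val ?mulf_neq0 // !vM // (val_coprime hv as_ Ps); lia.
Qed.

Lemma vgeB n x y : vge n x -> vge n y -> vge n (x - y).
Proof. by move=> hx hy; apply: vgeD; rewrite ?vgeN. Qed.

Lemma vge_sum n (I : Type) (r : seq I) (Q : pred I) (f : I -> E) :
  (forall i, Q i -> vge n (f i)) -> vge n (\sum_(i <- r | Q i) f i).
Proof.
move=> h; elim/big_rec: _ => [|i x Qi hx]; first exact: vge0.
by apply: vgeD => //; apply: h.
Qed.

Lemma vge01 : vge 0 1. Proof. by rewrite vge_val ?oner_eq0 // val1. Qed.

Lemma vge_mul0 x y : vge 0 x -> vge 0 y -> vge 0 (x * y).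
Proof. by move=> hx hy; rewrite -[0]addr0; apply: vgeM. Qed.

Lemma vge_mull n x y : vge 0 x -> vge n y -> vge n (x * y).
Proof. by move=> hx hy; rewrite -[n]add0r; apply: vgeM. Qed.

Lemma vge_mulr n x y : vge n x -> vge 0 y -> vge n (x * y).
Proof. by move=> hx hy; rewrite -[n]addr0; apply: vgeM. Qed.

Lemma vge_exp0 x n : vge 0 x -> vge 0 (x ^+ n).
Proof.
by move=> hx; elim: n => [|n IH]; rewrite ?vge01 // exprS; apply: vge_mul0.
Qed.

Lemma val_nondiv_eq0 x : (forall n : nat, vge n%:Z x) -> x = 0.
Proof.
move=> h; apply/eqP; apply: contraT => x0.
by have := h `|v x|.+1%N; rewrite vge_val //; lia.
Qed.

Lemma val_near x y : x != 0 -> vge (v x + 1) (y - x) -> y != 0 /\ v y = v x.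
Proof.
move=> x0 h; have y0 : y != 0.
  by apply/eqP => y0; move: h; rewrite y0 sub0r vgeN vge_val //; lia.
split=> //; have ge : v x <= v y.
  rewrite -vge_val // -(subrK x y); apply: vgeD; last by rewrite vge_val.
  by apply: vge_le h; lia.
apply/eqP; rewrite eq_le ge andbT leNgt; apply/negP => lt.
have : vge (v x + 1) (y - (y - x)).
  by apply: vgeB => //; rewrite vge_val //; lia.
by rewrite subKr vge_val //; lia.
Qed.

Definition cong x y := vge 1 (x - y).

Lemma cong_refl x : cong x x. Proof. by rewrite /cong subrr vge0. Qed.

Lemma cong_sym x y : cong x y -> cong y x.
Proof. by rewrite /cong -vgeN opprB. Qed.

Lemma cong_trans y x z : cong x y -> cong y z -> cong x z.
Proof. by move=> h1 h2; rewrite /cong -(subrKA y); apply: vgeD. Qed.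

Lemma cong_add x y x' y' : cong x x' -> cong y y' -> cong (x + y) (x' + y').
Proof. by move=> h1 h2; rewrite /cong opprD addrACA; apply: vgeD. Qed.

Lemma cong_opp x y : cong x y -> cong (- x) (- y).
Proof. by rewrite /cong -opprD vgeN. Qed.

Lemma cong_sub x y x' y' : cong x x' -> cong y y' -> cong (x - y) (x' - y').
Proof. by move=> h1 h2; apply: cong_add => //; apply: cong_opp. Qed.

Lemma cong_vge0 x y : cong x y -> vge 0 y -> vge 0 x.
Proof.
by move=> h hy; rewrite -(subrK y x); apply: vgeD => //; apply: vge_le h.
Qed.

Lemma cong_mul x y x' y' : vge 0 x' -> vge 0 y' ->
  cong x x' -> cong y y' -> cong (x * y) (x' * y').
Proof.
move=> hx hy h1 h2; rewrite /cong.
have -> : x * y - x' * y' = (x - x') * y + x' * (y - y') by ring.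
apply: vgeD; last by rewrite -[1]add0r; apply: vgeM.
by rewrite -[1]addr0; apply: vgeM => //; apply: cong_vge0 h2 _.
Qed.

Lemma cong_exp x y n : vge 0 y -> cong x y -> cong (x ^+ n) (y ^+ n).
Proof.
move=> hy h; elim: n => [|n IH]; first exact: cong_refl.
by rewrite !exprS; apply: cong_mul => //; apply: vge_exp0.
Qed.

Lemma cong_sum (I : Type) (r : seq I) (Q : pred I) (f g : I -> E) :
  (forall i, Q i -> cong (f i) (g i)) ->
  cong (\sum_(i <- r | Q i) f i) (\sum_(i <- r | Q i) g i).
Proof. by move=> h; rewrite /cong -sumrB; apply: vge_sum. Qed.

Lemma cong_prod (I : Type) (r : seq I) (Q : pred I) (f g : I -> E) :
  (forall i, Q i -> vge 0 (g i)) -> (forall i, Q i -> cong (f i) (g i)) ->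
  cong (\prod_(i <- r | Q i) f i) (\prod_(i <- r | Q i) g i).
Proof.
move=> hg h; suff [] : vge 0 (\prod_(i <- r | Q i) g i) /\
    cong (\prod_(i <- r | Q i) f i) (\prod_(i <- r | Q i) g i) by [].
elim/big_rec2: _ => [|i y1 y2 Qi [h1 h2]]; first by rewrite vge01 cong_refl.
by split; [apply: vge_mul0; rewrite ?hg|apply: cong_mul; rewrite ?hg ?h].
Qed.

Lemma cong_val0 x y : y != 0 -> v y = 0 -> cong x y -> x != 0 /\ v x = 0.
Proof. move=> y0 vy h; have [] := @val_near y x y0; first by rewrite vy.
by rewrite vy. Qed.

Lemma not_cong0 x : x != 0 -> v x = 0 -> ~~ cong x 0.
Proof. by move=> x0 vx; rewrite /cong subr0 vge_val // vx. Qed.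

Lemma val_not_cong0 x : vge 0 x -> ~~ cong x 0 -> x != 0 /\ v x = 0.
Proof.
rewrite /cong subr0 /vge; have [->|x0] := eqVneq x 0; first by [].
by move=> /= h1 h2; split=> //; lia.
Qed.

End Valued.

(** * The residue field at P *)

Section Residues.

Variables (E : splittingFieldType rat) (P : set E) (v : E -> int).
Hypotheses (pP : is_prime_of {:E}%AS P) (hv : valuation P v).
Implicit Types (x y z : E) (s t : gal_of {:E}) (F : {subfield E}).

Local Notation vge := (vge v).
Local Notation cong := (cong v).

(** With [s] outside P such that [s * x] is integral, some power [s ^+ d] is 1 modulo P, and
    [s ^+ d * x] is an integer with the residue of [x]. *)
Lemma val_frac_cong x : vge 0 x -> exists2 a, aint a & cong a x.
Proof.
have [->|x0] := eqVneq x 0.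
  by exists 0; [apply: integral0|apply: (cong_refl v)].
rewrite vge_val // => /(val_frac hv x0)[s [as_ Ps asx]].
have [r rp Pr] := prime_nat pP.
have [T [f fP]] := int_ring_mod_fin {:E}%AS (prime_gt0 rp).
have [i [j [lt Ef]]] := pigeonhole (fun n => f (s ^+ n)).
have rE : r%:R != 0 :> E by rewrite extQ_natr_eq0 -lt0n prime_gt0.
have s0 : s != 0 by apply/eqP => s0; apply: Ps; rewrite s0; apply: (prime0 pP).
have vs : v s = 0 by apply: (val_coprime hv).
have sd : cong (s ^+ (j - i)) 1.
  have : vge 1 (s ^+ j - s ^+ i).
    apply: (vge_prime hv); rewrite -(divfK rE (_ - _)); apply: (prime_mulr pP) => //.
    by apply: fP => //; apply/int_ring_full/aint_exp.
  have -> : s ^+ j - s ^+ i = s ^+ i * (s ^+ (j - i) - 1).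
    by rewrite mulrBr mulr1 -exprD subnKC 1?ltnW.
  move=> h; rewrite /cong -[_ - _](mulKf (expf_neq0 i s0)).
  apply: (vge_mull hv) => //.
  by rewrite vge_val ?invr_eq0 ?expf_neq0 // (valV hv) ?expf_neq0 // (valX hv) // vs mul0r.
exists (s ^+ (j - i).-1 * (s * x)); first by apply: integral_mul => //; apply: aint_exp.
rewrite mulrA -exprSr prednK ?subn_gt0 // -[X in cong _ X]mul1r.
apply: (cong_mul pP hv) => //; try exact: (vge01 hv); try exact: cong_refl.
have : vge 0 (s * x) by apply: (vge_aint hv).
by rewrite !vge_val ?mulf_neq0 // (valM hv) // vs add0r.
Qed.

Lemma residue_fin : exists (T : finType) (f : E -> T),
  forall x y, vge 0 x -> vge 0 y -> f x = f y -> cong x y.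
Proof.
have [r rp Pr] := prime_nat pP.
have rE : r%:R != 0 :> E by rewrite extQ_natr_eq0 -lt0n prime_gt0.
have [T [f fP]] := int_ring_mod_fin {:E}%AS (prime_gt0 rp).
have lift x : exists a, vge 0 x -> aint a /\ cong a x.
  have [/val_frac_cong[a aa h]|n] := boolP (vge 0 x); first by exists a.
  by exists 0.
have [g gP] := boolp.choice lift.
exists T, (f \o g) => x y /gP[ax cx] /gP[ay cy] Ef.
apply: (cong_trans pP hv (y := g x)); first exact: (cong_sym hv).
apply: (cong_trans pP hv (y := g y)) => //.
apply: (vge_prime hv); rewrite -(divfK rE (_ - _)); apply: (prime_mulr pP) => //.
by apply: fP => //; apply/int_ring_full.
Qed.

Variable r : nat.
Hypotheses (rp : prime r) (Pr : P r%:R).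

Lemma val_nat n : vge 0 n%:R.
Proof. by apply: (vge_aint hv); apply: integral_nat. Qed.

Lemma val_dvd n : (r %| n)%N -> cong n%:R 0.
Proof.
case/dvdnP => m ->; rewrite /cong subr0 natrM.
by apply: (vge_mull hv); [apply: val_nat|apply: (vge_prime hv)].
Qed.

Lemma cong_nat m n : m = n %[mod r] -> cong m%:R n%:R.
Proof.
wlog le : m n / (n <= m)%N => [h|].
  have [/h|/ltnW/h h' e] := leqP n m; first by [].
  by apply: (cong_sym hv); apply: h'.
move/eqP; rewrite eqn_mod_dvd // => /val_dvd; rewrite /cong subr0.
by rewrite natrB.
Qed.

Lemma inv_mod n : coprime r n -> exists m, (m * n = 1 %[mod r])%N.
Proof.
move=> cop; have n0 : (0 < n)%N.
  case: n cop => // ; rewrite /coprime gcdn0 => /eqP r1.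
  by move: rp; rewrite r1.
have [[|u] w Eu _] := egcdnP r n0.
  move: Eu; rewrite mul0n gcdnC (eqP cop); lia.
by exists u.+1; rewrite Eu gcdnC (eqP cop) modnMDl.
Qed.

Lemma val_coprime_nat n : coprime r n -> n%:R != 0 :> E /\ v n%:R = 0.
Proof.
case/inv_mod => m /cong_nat; rewrite natrM => h.
apply: (val_not_cong0); first exact: val_nat.
apply/negP => hn.
have := not_cong0 (oner_neq0 E) (val1 hv); case/negP.
apply: (cong_trans pP hv (y := m%:R * n%:R)); first exact: (cong_sym hv).
rewrite -(mulr0 m%:R); apply: (cong_mul pP hv) => //; try exact: val_nat 0%N.
  exact: val_nat.
exact: cong_refl.
Qed.

Lemma frobenius_cong x y : vge 0 x -> vge 0 y -> cong (x ^+ r) (y ^+ r) -> cong x y.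
Proof.
move=> hx hy h; set w := x - y.
have hw : vge 0 w by apply: (vgeB pP hv).
have r0 := prime_gt0 rp.
have : cong (x ^+ r) (w ^+ r + y ^+ r).
  have -> : x = w + y by rewrite /w subrK.
  rewrite exprDn -(prednK r0) big_ord_recr big_ord_recl /=.
  rewrite subnn subn0 !expr0 mulr1 mul1r bin0 binn !mulr1n /cong.
  have E3 (a b c : E) : a + b + c - (a + c) = b by ring.
  rewrite E3; apply: (vge_sum pP hv) => i _.
  rewrite -mulr_natr; apply: (vge_mull hv).
    by apply: (vge_mul0 hv); apply: (vge_exp0 hv).
  have := @val_dvd 'C(r.-1.+1, bump 0 i); rewrite /cong subr0; apply.
  rewrite (prednK r0) prime_dvd_bin // /bump /= add1n /=.
  by have := ltn_ord i; lia.
move=> h'; have : vge 1 (w ^+ r).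
  rewrite -(addrK (y ^+ r) (w ^+ r)); apply: (cong_trans pP hv (y := x ^+ r)) => //.
  exact: (cong_sym hv).
have [w0|w0] := eqVneq w 0; first by rewrite /cong -/w w0 vge0.
rewrite /cong -/w !vge_val ?expf_neq0 // (valX hv) // => h2.
by case: (v w) h2 => [[|n]|n] //=; rewrite ?mul0r //; nia.
Qed.

(** Finite residue fields are perfect. The root is found among the powers of [z], hence in every
    subfield that contains [z]. *)
Lemma frobenius_root z a : vge 0 z -> exists k, cong ((z ^+ k) ^+ (r ^ a)) z.
Proof.
move=> hz; have [T [f fP]] := residue_fin.
have [i [j [lt Ef]]] := pigeonhole (fun n => f (z ^+ (r ^ n))).
have hX n : vge 0 (z ^+ n) by apply: (vge_exp0 hv).
have base : cong (z ^+ (r ^ (j - i))) z.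
  have : cong ((z ^+ (r ^ (j - i))) ^+ (r ^ i)) (z ^+ (r ^ i)).
    rewrite -exprM -expnD subnK 1?ltnW //; apply: fP => //.
  move: (r ^ (j - i))%N => N; elim: (i) => [|n IH] //; rewrite expnS !exprM => h.
  apply: IH; apply: frobenius_cong; rewrite -?exprM ?hX //.
  by move: h; rewrite -!exprM [(r ^ n * r)%N]mulnC mulnA.
have pow n : cong (z ^+ (r ^ ((j - i) * n))) z.
  elim: n => [|n IH]; first by rewrite muln0 expn0 expr1; apply: cong_refl.
  rewrite mulnS expnD exprM; apply: (cong_trans pP hv (y := z ^+ (r ^ ((j - i) * n)))) => //.
  exact: (cong_exp pP hv).
exists (r ^ ((j - i) * a - a))%N; rewrite -exprM -expnD subnK //.
by rewrite -{1}[a]mul1n leq_mul2r subn_gt0 lt orbT.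
Qed.

End Residues.

(** * Decomposition and inertia *)

Section Inertia.

Variables (E : splittingFieldType rat) (P : set E) (v : E -> int).
Hypotheses (pP : is_prime_of {:E}%AS P) (hv : valuation P v).
Implicit Types (x y z : E) (s t : gal_of {:E}) (F : {subfield E}).

Local Notation vge := (vge v).
Local Notation cong := (cong v).

(** An inclusion is enough, as [s] has finite order: see [decomposesV]. *)
Definition decomposes (Q : set E) s := forall x, Q x -> Q (s x).
Definition inert (Q : set E) s := forall x, aint x -> Q (s x - x).

Local Notation D := (decomposes P).
Local Notation I := (inert P).

Lemma decomposesM s t : D s -> D t -> D (s * t)%g.
Proof. by move=> hs ht x Px; rewrite galMx; apply/ht/hs. Qed.

Lemma decomposesV s : D s -> D s^-1%g.
Proof.
move=> hs; rewrite invg_expg; elim: _.-1 => [|n IH]; first by rewrite expg0 => x; rewrite gal_id.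
by rewrite expgS; apply: decomposesM.
Qed.

Lemma decomposes_iff s x : D s -> P (s x) <-> P x.
Proof. by move=> Ds; split=> [/(decomposesV Ds)|/Ds //]; rewrite galVK. Qed.

Lemma inert_decomposes s : I s -> D s.
Proof.
move=> Is x Px; rewrite -(subrK x (s x)); apply: (prime_add pP) => //.
by apply: Is; apply/int_ring_full/(prime_sub pP).
Qed.

Lemma inertM s t : I s -> I t -> I (s * t)%g.
Proof.
move=> Is It x ax; rewrite galMx -(subrKA (s x)); apply: (prime_add pP); last exact: Is.
by apply: It; apply/aint_gal.
Qed.

Lemma inert1 : I 1%g.
Proof. by move=> x _; rewrite gal_id subrr; apply: (prime0 pP). Qed.

Lemma inertV s : I s -> I s^-1%g.
Proof.
move=> Is; rewrite invg_expg; elim: _.-1 => [|n IH]; first exact: inert1.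
by rewrite expgS; apply: inertM.
Qed.

(** Since [s] preserves the units at P, [v (s y) = v y * v (s pi)]. The corresponding factor of
    [s^-1] is its inverse, and both are positive integers, hence 1. *)
Lemma val_decomposes s x : D s -> v (s x) = v x.
Proof.
move=> Ds.
have ge0 t y : D t -> y != 0 -> 0 <= v y -> 0 <= v (t y).
  move=> Dt y0 hy; have [u [au Pu auy]] := val_frac hv y0 hy.
  have u0 : u != 0 by apply/eqP => u0; apply: Pu; rewrite u0; apply: (prime0 pP).
  have tu : v (t u) = 0.
    by apply: (val_coprime hv); [apply/aint_gal|move/(decomposes_iff _ Dt)].
  have : 0 <= v (t (u * y)).
    by apply: (val_aint hv); [apply/aint_gal|rewrite fmorph_eq0 mulf_neq0].
  by rewrite rmorphM /= (valM hv) ?fmorph_eq0 // tu add0r.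
have eq0 t y : D t -> y != 0 -> v y = 0 -> v (t y) = 0.
  move=> Dt y0 vy; apply/eqP; rewrite eq_le ge0 ?vy // andbT.
  have : 0 <= v (t y^-1) by apply: ge0; rewrite ?invr_eq0 // (valV hv) // vy.
  by rewrite fmorphV /= (valV hv) ?fmorph_eq0 // oppr_ge0.
have [pi [Ppi pi0 vpi]] := val_uniformizer hv.
have lin t y : D t -> y != 0 -> v (t y) = v y * v (t pi).
  move=> Dt y0; have pos n : v (t (pi ^+ n)) = n%:Z * v (t pi).
    by rewrite rmorphXn /= (valX hv) ?fmorph_eq0 // mulrC.
  have [[n|n] En] : exists n, n = v y by exists (v y).
  - have : v (t (y / pi ^+ n)) = 0.
      apply: eq0 => //; first by rewrite mulf_neq0 // invr_eq0 expf_neq0.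
      by rewrite (val_div hv) ?expf_neq0 // (valX hv) // vpi -En; lia.
    rewrite rmorphM fmorphV /= (val_div hv) ?fmorph_eq0 ?expf_neq0 // pos -En; lia.
  - have : v (t (y * pi ^+ n.+1)) = 0.
      apply: eq0 => //; first by rewrite mulf_neq0 // expf_neq0.
      by rewrite (valM hv) ?expf_neq0 // (valX hv) // vpi -En; lia.
    rewrite rmorphM /= (valM hv) ?fmorph_eq0 ?expf_neq0 // pos -En NegzE; lia.
have [->|x0] := eqVneq x 0; first by rewrite rmorph0.
rewrite lin //; have pos t : D t -> 0 < v (t pi).
  by move=> Dt; apply: (val_prime hv); [apply: Dt|rewrite fmorph_eq0].
have := lin _ (s pi) (decomposesV Ds); rewrite galVK vpi fmorph_eq0 => /(_ pi0).
have := pos _ Ds; have := pos _ (decomposesV Ds).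
by case: (v (s pi)) => [[|[|n]]|n] //; case: (v (s^-1%g pi)) => [[|[|m]]|m] //; nia.
Qed.

Lemma vge_decomposes s n x : D s -> vge n (s x) = vge n x.
Proof. by move=> Ds; rewrite /vge fmorph_eq0 val_decomposes. Qed.

Lemma cong_decomposes s x y : D s -> cong (s x) (s y) = cong x y.
Proof. by move=> Ds; rewrite /cong -rmorphB vge_decomposes. Qed.

Lemma val_inert s x : I s -> v (s x) = v x.
Proof. by move/inert_decomposes/val_decomposes. Qed.

Lemma cong_inert s x : I s -> vge 0 x -> cong (s x) x.
Proof.
move=> Is hx; have [a aa h] := val_frac_cong pP hv hx.
have Ds := inert_decomposes Is.
apply: (cong_trans pP hv (y := s a)); first by rewrite cong_decomposes //; apply: (cong_sym hv).
apply: (cong_trans pP hv (y := a)) => //.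
exact/(vge_prime hv)/Is.
Qed.

Definition inertia F : {set gal_of {:E}} := [set s in 'Gal({:E} / F)%g | `[< I s >]].

Lemma inertiaP F s : reflect (s \in 'Gal({:E} / F)%g /\ I s) (s \in inertia F).
Proof. by rewrite inE; apply: (iffP andP) => -[? /asboolP]. Qed.

Lemma inertia_group_set F : group_set (inertia F).
Proof.
apply/group_setP; split; first by apply/inertiaP; split; [apply: group1|apply: inert1].
move=> s t /inertiaP[Gs Is] /inertiaP[Gt It]; apply/inertiaP; split; first exact: groupM.
exact: inertM.
Qed.

Canonical inertia_group F := Group (inertia_group_set F).

Section Cosets.

Variables (R : Type) (idx : R) (op : Monoid.com_law idx).
Variables (act : gal_of {:E} -> R -> R).
Hypothesis actM : forall s t a, act (s * t)%g a = act t (act s a).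
Hypothesis act_op : forall s a b, act s (op a b) = op (act s a) (act s b).
Hypothesis act_idx : forall s, act s idx = idx.

(** The trace or norm from the field fixed by H to the field fixed by G, according to the law [op].
    The choice of representatives is harmless because H fixes [a]. *)
Lemma big_rcosets_fixed (H G : {group gal_of {:E}}) (a : R) s :
  (forall h, h \in H -> act h a = a) -> H \subset G -> s \in G ->
  act s (\big[op/idx]_(C in rcosets H G) act (repr C) a) =
  \big[op/idx]_(C in rcosets H G) act (repr C) a.
Proof.
move=> Ha sHG Gs; rewrite (big_morph _ (act_op s) (act_idx s)).
rewrite [RHS](reindex_inj (@rcoset_inj _ s)) /=.
apply: eq_big => [C|C /rcosetsP[g Gg ->]].
  apply/idP/idP => /rcosetsP[g Gg E1]; apply/rcosetsP.
    by exists (g * s)%g; rewrite ?groupM // E1 rcosetM.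
  exists (g * s^-1)%g; rewrite ?groupM ?groupV // rcosetM -E1.
  by rewrite -rcosetM mulgV rcoset1.
have rep t : exists2 h, h \in H & repr (H :* t)%g = (h * t)%g.
  by apply/rcosetP; apply: mem_repr_rcoset.
rewrite -rcosetM -actM; have [h Hh ->] := rep g; have [h' Hh' ->] := rep (g * s)%g.
by rewrite -mulgA (actM h) (actM h') (Ha h Hh) (Ha h' Hh').
Qed.

End Cosets.

Variable r : nat.
Hypotheses (rp : prime r) (Pr : P r%:R).

(* The norm over a Sylow r-subgroup S followed by the trace from S to H acts on the
   residue field, which is perfect, as z -> [H : S] z^|S|. *)
Lemma residue_fixed (H : {group gal_of {:E}}) z :
  (forall s, s \in H -> I s) -> vge 0 z ->
  exists w, [/\ forall s, s \in H -> s w = w, vge 0 w & cong w z].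
Proof.
move=> HI hz; have [S sylS] := Sylow_exists r H.
have sSH : S \subset H by apply: pHall_sub sylS.
have [a Ea] : {a | #|S| = (r ^ a)%N} by apply: p_natP; case/and3P: sylS.
have [k hk] := frobenius_root pP hv rp Pr a hz.
set y := z ^+ k in hk; have hy : vge 0 y by apply: (vge_exp0 hv).
pose N := \prod_(s in S) s y.
have NS s : s \in S -> s N = N.
  move=> Ss; rewrite /N rmorph_prod [RHS](reindex_inj (mulIg s)) /=.
  apply: eq_big => t; last by rewrite galMx.
  by rewrite groupMr.
have hN : cong N z.
  apply: (cong_trans pP hv (y := y ^+ (r ^ a))) => //; rewrite -Ea -prodr_const.
  apply: (cong_prod pP hv) => // s Ss.
  by apply: cong_inert => //; apply/HI/(fintype.subsetP sSH).
have hN0 : vge 0 N by apply: (cong_vge0 pP hv) hN hz.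
pose W := \sum_(C in rcosets S H) (repr C) N.
have WH s : s \in H -> s W = W.
  move=> Hs; apply: (big_rcosets_fixed (op := +%R) (act := fun s x => s x)) => //.
  - by move=> ? ? x; rewrite galMx.
  - by move=> ? x y'; rewrite rmorphD.
  - by move=> ?; rewrite rmorph0.
have cop : coprime r #|H : S|%g.
  by rewrite prime_coprime // -p'natE //; case/and3P: sylS.
have hW : cong W (#|H : S|%g%:R * z).
  rewrite mulr_natl -sumr_const; apply: (cong_sum pP hv) => C /rcosetsP[g Hg EC].
  apply: (cong_trans pP hv (y := N)) => //; apply: cong_inert => //; apply: HI.
  have: repr C \in C by rewrite EC; apply: mem_repr (rcoset_refl S g).
  by rewrite {2}EC => /rcosetP[h Sh ->]; rewrite groupM // (fintype.subsetP sSH).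
have [m Em] := inv_mod rp cop.
exists (m%:R * W); split.
- by move=> s Hs; rewrite rmorphM rmorph_nat /= WH.
- apply: (vge_mul0 hv); first exact: (val_nat hv).
  apply: (cong_vge0 pP hv hW); apply: (vge_mul0 hv) => //; exact: (val_nat hv).
- apply: (cong_trans pP hv (y := m%:R * (#|H : S|%g%:R * z))).
    apply: (cong_mul pP hv) => //; try exact: (val_nat hv); try exact: cong_refl.
    by apply: (vge_mul0 hv) => //; apply: (val_nat hv).
  rewrite mulrA -natrM -[X in cong _ X]mul1r; apply: (cong_mul pP hv) => //; last exact: cong_refl.
    exact: (vge01 hv).
  exact: (cong_nat hv Pr Em).
Qed.

End Inertia.

Lemma absz_sub_ge (m : nat) (a b : int) : (`|a| + `|b| + 1 <= m)%N -> 1 - m%:Z <= a - b.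
Proof. by lia. Qed.

Lemma pos_multiple_ge (m e : int) : 0 < e -> 1 <= m * e -> e <= m * e.
Proof. by case: m => [[|m]|m] => h; rewrite ?mul0r // ?NegzE; nia. Qed.

Lemma leq_pos_mul (n : nat) (e : int) : 0 < e -> n%:Z <= e * n%:Z.
Proof. by nia. Qed.

(** * Fixed fields of inertia groups, and inert automorphisms of prime order *)

Section FixedFields.

Variables (E : splittingFieldType rat) (P : set E) (v : E -> int) (r : nat).
Hypotheses (pP : is_prime_of {:E}%AS P) (hv : valuation P v).
Hypotheses (rp : prime r) (Pr : P r%:R).
Implicit Types (x y z : E) (s t : gal_of {:E}) (F : {subfield E}).

Local Notation vge := (vge v).
Local Notation cong := (cong v).
Local Notation D := (decomposes P).
Local Notation I := (inert P).

Lemma cong_mul_cancel x y : vge 0 x -> vge 0 y ->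
  cong (x * y) 0 -> ~~ cong y 0 -> cong x 0.
Proof.
move=> hx hy h /(val_not_cong0 hy)[y0 vy]; move: h; rewrite /cong !subr0.
have [->|x0] := eqVneq x 0; first by rewrite vge0.
by rewrite !vge_val ?mulf_neq0 // (valM hv) // vy addr0.
Qed.

(* Dedekind's independence of characters, for the residue field. *)
Lemma residue_independence (Z : E -> Prop) (ss : seq (gal_of {:E})) (u : gal_of {:E} -> E) :
  Z 1 -> (forall x y, Z x -> Z y -> Z (x * y)) -> (forall x, Z x -> vge 0 x) ->
  (forall s, s \in ss -> D s) -> uniq ss ->
  (forall s t, s \in ss -> t \in ss -> s != t -> exists2 x, Z x & ~~ cong (s x) (t x)) ->
  (forall s, s \in ss -> vge 0 (u s)) ->
  (forall z, Z z -> cong (\sum_(s <- ss) u s * s z) 0) ->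
  forall s, s \in ss -> cong (u s) 0.
Proof.
move=> Z1 ZM Z0; elim: ss u => [|s0 ss IH] u //= Dss /andP[n0 uss] dist u0 rel.
have Dmem s : s \in ss -> s \in s0 :: ss by rewrite inE => ->; rewrite orbT.
have h s : s \in s0 :: ss -> forall x, Z x -> vge 0 (s x).
  by move=> Ds x Zx; rewrite (vge_decomposes pP hv) ?Z0 //; apply: Dss.
have tail s : s \in ss -> cong (u s) 0.
  move=> hs; have [|x Zx ne] := dist s s0 (Dmem _ hs) (mem_head _ _).
    by apply: contraNneq n0 => <-.
  apply: (cong_mul_cancel (y := s x - s0 x)).
  - exact/u0/Dmem.
  - by apply: (vgeB pP hv); apply: h => //; [apply: Dmem|apply: mem_head].
  - apply: (IH (fun s => u s * (s x - s0 x))) => //.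
    + by move=> t ht; apply/Dss/Dmem.
    + by move=> a b ha hb; apply: dist; apply: Dmem.
    + move=> t ht; apply: (vge_mul0 hv); first exact/u0/Dmem.
      by apply: (vgeB pP hv); apply: h => //; [apply: Dmem|apply: mem_head].
    + move=> z Zz.
      have -> : \sum_(t <- ss) u t * (t x - s0 x) * t z =
          \sum_(t <- s0 :: ss) u t * t (x * z) - s0 x * \sum_(t <- s0 :: ss) u t * t z.
        rewrite !big_cons mulrDr mulr_sumr rmorphM opprD addrACA -sumrB.
        have -> : u s0 * (s0 x * s0 z) - s0 x * (u s0 * s0 z) = 0 by ring.
        by rewrite add0r; apply: eq_bigr => t _; rewrite rmorphM /=; ring.
      have hx0 : vge 0 (s0 x) by apply: h => //; apply: mem_head.
      have := cong_mul pP hv hx0 (vge0 v 0) (cong_refl v (s0 x)) (rel z Zz).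
      by move/(cong_sub pP hv (rel _ (ZM _ _ Zx Zz))); rewrite mulr0 subrr.
  - apply: contra ne; rewrite /cong subr0; exact: id.
move=> s; rewrite inE => /orP[/eqP->|]; last exact: tail.
have := rel 1 Z1; rewrite big_cons rmorph1 mulr1 => hsum.
rewrite -(addrK (\sum_(j <- ss) u j * j 1) (u s0)) -[X in cong _ X](subrr 0).
apply: (cong_sub pP hv) => //; rewrite /cong subr0 big_seq.
apply: (vge_sum pP hv) => t ht; rewrite rmorph1 mulr1.
by have := tail t ht; rewrite /cong subr0.
Qed.

Lemma rcosets_repr_mem (S H : {group gal_of {:E}}) C :
  S \subset H -> C \in rcosets S H -> repr C \in H /\ C = (S :* repr C)%g.
Proof.
move=> sSH /rcosetsP[g Hg EC].
have hr : repr C \in C by rewrite EC; apply: mem_repr (rcoset_refl S g).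
split; last by apply/eqP; rewrite {1}EC; rewrite EC in hr *; rewrite eq_sym; apply/eqP/rcoset_eqP.
by move: hr; rewrite {2}EC => /rcosetP[h Sh ->]; rewrite groupM // (fintype.subsetP sSH).
Qed.

Lemma val0_pow_cong1 x : x != 0 -> v x = 0 -> exists2 n, (0 < n)%N & cong (x ^+ n) 1.
Proof.
move=> x0 vx; have [T [f fP]] := residue_fin pP hv.
have hX n : v (x ^+ n) = 0 by rewrite (valX hv) // vx mul0r.
have [i [j [lt Ef]]] := pigeonhole (fun n => f (x ^+ n)).
exists (j - i)%N; first by rewrite subn_gt0.
have : cong (x ^+ i * x ^+ (j - i)) (x ^+ i).
  rewrite -exprD subnKC 1?ltnW //; apply: fP => //; by rewrite vge_val ?expf_neq0 ?hX.
rewrite /cong -{2}[x ^+ i]mulr1 -mulrBr => h.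
rewrite -[_ - 1](mulKf (expf_neq0 i x0)); apply: (vge_mull hv) => //.
by rewrite vge_val ?invr_eq0 ?expf_neq0 // (valV hv) ?expf_neq0 // hX.
Qed.

Lemma vge_pow n x : vge 1 x -> vge n%:Z (x ^+ n).
Proof.
move=> hx; have [->|x0] := eqVneq x 0.
  by case: n => [|n]; [rewrite expr0; apply: (vge01 hv)|rewrite exprS mul0r vge0].
rewrite vge_val ?expf_neq0 // (valX hv) //; by move: hx; rewrite vge_val // => h; rewrite -{1}[n%:Z]mul1r ler_wpM2r.
Qed.

(** For each [s] that does not preserve P, some integer outside P is sent into P by [s]. The product
    of these integers separates P from its other conjugates, and its norm over the inertia group is
    fixed by that group. *)
Lemma decomposition_separator F : exists b, [/\ aint b, ~ P b,
  forall s, s \in inertia P F -> s b = b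
  & forall s, s \in 'Gal({:E} / F)%g -> ~ D s -> P (s b)].
Proof.
have sep s : exists a, [/\ aint a, ~ P a & ~ D s -> P (s a)].
  have [Ds|nDs] := pselect (D s).
    by exists 1; split=> //; [apply: integral1|apply: (prime_not1 pP)].
  have [x [Px nPx]] : exists x, P x /\ ~ P (s^-1%g x).
    apply: contrapT => none; apply: nDs; rewrite -[s]invgK; apply: (decomposesV (P := P)).
    by move=> x Px; apply: contrapT => h; apply: none; exists x.
  exists (s^-1%g x); split=> //; last by rewrite galKV.
  by apply/aint_gal/int_ring_full/(prime_sub pP).
have [g gP] := boolp.choice sep; pose a := \prod_s g s.
have ag s : aint (g s) by case: (gP s).
have aa : aint a by apply: aint_prod.
have [Oa nPa] : coprime_to {:E}%AS P a.
  by apply: (coprime_to_prod pP) => s _; case: (gP s) => ags Pgs _; split=> //; apply/int_ring_full.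
exists (\prod_(s in inertia P F) s a); split.
- by apply: aint_prod => s _; apply/aint_gal.
- suff [] : coprime_to {:E}%AS P (\prod_(s in inertia P F) s a) by [].
  apply: (coprime_to_prod pP) => s /inertiaP[_ Is]; split; first by apply/int_ring_full/aint_gal.
  by move/(decomposes_iff _ (inert_decomposes pP Is)).
- move=> s Is; rewrite rmorph_prod [RHS](reindex_inj (mulIg s)) /=.
  apply: eq_big => t; last by rewrite galMx.
  by rewrite (@groupMr _ (inertia_group pP F)).
- move=> s _ nDs; rewrite rmorph_prod (bigD1 1%g) /=; last exact: (@group1 _ (inertia_group pP F)).
  rewrite gal_id; apply: (prime_mull pP).
    by apply/int_ring_full/aint_prod => t _; do 2 apply/aint_gal.
  rewrite /a rmorph_prod (bigD1 s) //=; apply: (prime_mull pP).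
    by apply/int_ring_full/aint_prod => t _; apply/aint_gal.
  by case: (gP s) => _ _; apply.
Qed.

(* The trace to F of y z b^M, where b is 1 at P and small at the other conjugates
   of P, has the valuation of y as soon as the residue of the sum over the
   decomposition group is not 0, which independence of characters provides for some z. *)
Lemma inertia_field_unramified F y : y != 0 ->
  (forall s, s \in inertia P F -> s y = y) ->
  exists x, [/\ x \in F, x != 0 & v x = v y].
Proof.
move=> y0 Ty; pose G := 'Gal({:E} / F)%G; pose J := inertia_group pP F.
have sJG : J \subset G by apply/fintype.subsetP => s /inertiaP[].
have [b [ab nPb Jb Gb]] := decomposition_separator F.
have b0 : b != 0 by apply/eqP => b0; apply: nPb; rewrite b0; apply: (prime0 pP).
have [N N0 bN] := val0_pow_cong1 b0 (val_coprime hv ab nPb).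
pose Z z := (forall s, s \in J -> s z = z) /\ vge 0 z.
pose Q (C : {set gal_of {:E}}) := `[< D (repr C) >].
pose ss := [seq repr C | C <- enum (rcosets J G) & Q C].
have ssP s : s \in ss -> exists2 C, C \in rcosets J G & s = repr C /\ D s.
  case/mapP => C; rewrite mem_filter mem_enum => /andP[/asboolP DC hC] ->.
  by exists C.
pose S z := \sum_(s <- ss) (s y / y) * s z.
(* The coset J itself has coefficient 1 in [S], so by independence of characters [S z] cannot vanish
   modulo P for all [z]. *)
have [z [[Jz z0] Sz]] : exists z, Z z /\ ~~ cong (S z) 0.
  apply: contrapT => none.
  have rel z : Z z -> cong (S z) 0.
    by move=> Zz; apply: contrapT => /negP h; apply: none; exists z.
  have s1 : repr (J : {set gal_of {:E}}) \in ss.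
    apply/mapP; exists (J : {set gal_of {:E}}) => //; rewrite mem_filter mem_enum.
    apply/andP; split; last by apply/rcosetsP; exists 1%g; rewrite ?group1 // rcoset1.
    apply/asboolP; have : repr J \in J by apply: mem_repr (group1 J).
    by case/inertiaP => _; apply: (inert_decomposes pP).
  have Js1 : repr (J : {set gal_of {:E}}) \in J by apply: mem_repr (group1 J).
  suff : cong (repr (J : {set gal_of {:E}}) y / y) 0.
    rewrite Ty // divff //; apply/negP; apply: not_cong0; rewrite ?oner_eq0 //.
    exact: (val1 hv).
  apply: (@residue_independence Z ss (fun s => s y / y)) => //.
  - by split=> [s _|]; [rewrite rmorph1|apply: (vge01 hv)].
  - move=> a c [Ja ha] [Jc hc]; split; last exact: (vge_mul0 hv).
    by move=> s Js; rewrite rmorphM /= Ja ?Jc.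
  - by move=> a [].
  - by move=> s /ssP[C _ []].
  - rewrite map_inj_in_uniq; first by rewrite filter_uniq // enum_uniq.
    move=> C C'; rewrite mem_filter mem_enum => /andP[_ hC].
    rewrite mem_filter mem_enum => /andP[_ hC'] e.
    have [_ ->] := rcosets_repr_mem sJG hC; have [_ ->] := rcosets_repr_mem sJG hC'.
    by rewrite e.
  (* Every residue has a representative fixed by J, by [residue_fixed]. So if [s] and [t] agree
     modulo P on the elements fixed by J, they agree on all integers, and [s * t^-1] is inert. *)
  - move=> s t /ssP[C hC [Es Ds]] /ssP[C' hC' [Et Dt]] ne; apply: contrapT => none'.
    case/eqP: ne; rewrite Es Et; congr repr.
    have [Gs EC] := rcosets_repr_mem sJG hC; have [Gt EC'] := rcosets_repr_mem sJG hC'.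
    rewrite EC EC' -Es -Et; apply/rcoset_eqP; rewrite mem_rcoset.
    apply/inertiaP; split; first by rewrite groupM ?groupV ?Es ?Et.
    move=> x ax; apply: (prime_vge pP hv).
      by apply: integral_sub => //; apply/aint_gal.
    have DVt := decomposesV Dt.
    rewrite galMx -{2}(galVK t x) -/(cong _ _) (cong_decomposes pP hv) //.
    have [w [Jw w0 hw]] := residue_fixed pP hv rp Pr
      (fun s (Js : s \in J) => (elimT (inertiaP P F s) Js).2) (vge_aint hv ax).
    apply: (cong_trans pP hv (y := s w)).
      by rewrite (cong_decomposes pP hv) //; apply: (cong_sym hv).
    apply: (cong_trans pP hv (y := t w)); last by rewrite (cong_decomposes pP hv).
    by apply: contrapT => /negP h; apply: none'; exists w.
  - move=> s /ssP[C _ [_ Ds]]; rewrite vge_val ?mulf_neq0 ?invr_eq0 ?fmorph_eq0 //.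
    by rewrite (val_div hv) ?fmorph_eq0 // (val_decomposes pP hv) // subrr.
(* The exponent [N * M] of [b] has two effects: [b ^+ N] is 1 modulo P, and outside the
   decomposition group a factor of valuation at least [M] outweighs the poles of [s (y * z) / y]. *)
pose M := (\sum_(s : gal_of {:E}) `|v (s (y * z)%R)| + `|v y| + 1)%N.
have MP s : (`|v (s (y * z)%R)| + `|v y| + 1 <= M)%N.
  by rewrite /M (bigD1 s) //= -!addnA leq_add2l addnA leq_add2r leq_addl.
pose c := y * z * b ^+ (N * M).
have Jc s : s \in J -> s c = c.
  by move=> Js; rewrite /c !rmorphM rmorphXn /= Ty // Jz // Jb.
pose x := \sum_(C in rcosets J G) (repr C) c.
have Fx : x \in F.
  apply: galois_mem => s Gs; apply: (big_rcosets_fixed (op := +%R) (act := fun s x => s x)) => //.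
  - by move=> ? ? ?; rewrite galMx.
  - by move=> ? ? ?; rewrite rmorphD.
  - by move=> ?; rewrite rmorph0.
have hxy : cong (x / y) (S z).
  rewrite /S big_map big_filter big_enum_cond /= /x mulr_suml (bigID Q) /=.
  rewrite -[X in cong _ X]addr0; apply: (cong_add pP hv).
    apply: (cong_sum pP hv) => C /andP[hC /asboolP DC].
    have -> : (repr C) c / y = (repr C) y / y * (repr C) z * (repr C) ((b ^+ N) ^+ M).
      by rewrite /c -exprM !rmorphM /= mulrAC; congr (_ * _); apply: mulrAC.
    rewrite -[X in cong _ X]mulr1; apply: (cong_mul pP hv); try exact: (vge01 hv).
    + apply: (vge_mul0 hv); last by rewrite (vge_decomposes pP hv).
      rewrite vge_val ?mulf_neq0 ?invr_eq0 ?fmorph_eq0 //.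
      by rewrite (val_div hv) ?fmorph_eq0 // (val_decomposes pP hv) // subrr.
    + exact: cong_refl.
    + rewrite -(rmorph1 (repr C)) (cong_decomposes pP hv) // -[X in cong _ X](expr1n _ M).
      by apply: (cong_exp pP hv) => //; apply: (vge01 hv).
  rewrite /cong subr0; apply: (vge_sum pP hv) => C /andP[hC /asboolP nDC].
  have [GC _] := rcosets_repr_mem sJG hC.
  rewrite /c rmorphM rmorphXn /= mulrAC.
  have hb : vge M%:Z ((repr C) b ^+ (N * M)).
    apply: (vge_le (n := (N * M)%N%:Z)); first by rewrite lez_nat leq_pmull.
    by apply: vge_pow; apply/(vge_prime hv)/Gb.
  have [z1|z1] := eqVneq z 0; first by rewrite z1 mulr0 rmorph0 !mul0r vge0.
  have yz0 : (repr C) (y * z) != 0 by rewrite fmorph_eq0 mulf_neq0.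
  have hyz : vge (1 - M%:Z) ((repr C) (y * z) / y).
    rewrite vge_val ?mulf_neq0 ?invr_eq0 // (val_div hv) //.
    exact: absz_sub_ge (MP (repr C)).
  by have := vgeM hv hyz hb; rewrite subrK.
have [S0 vS] : S z != 0 /\ v (S z) = 0.
  apply: (val_not_cong0) => //; rewrite /S big_seq; apply: (vge_sum pP hv) => s.
  case/ssP => C _ [_ Ds]; apply: (vge_mul0 hv); last by rewrite (vge_decomposes pP hv).
  rewrite vge_val ?mulf_neq0 ?invr_eq0 ?fmorph_eq0 //.
  by rewrite (val_div hv) ?fmorph_eq0 // (val_decomposes pP hv) // subrr.
have [xy0 vxy] := cong_val0 pP hv S0 vS hxy.
have x0 : x != 0 by apply: contraNneq xy0 => ->; rewrite mul0r.
exists x; split=> //; by move: vxy; rewrite (val_div hv) // => /eqP; rewrite subr_eq0 => /eqP.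
Qed.

Lemma valXz x (n : int) : x != 0 -> v (x ^ n) = v x * n.
Proof.
move=> x0; case: n => n; first by rewrite -exprnP (valX hv).
by rewrite NegzE -exprnN (valV hv) ?expf_neq0 // (valX hv) // mulrN.
Qed.

Section PrimeOrderInertia.

Variables (F : {subfield E}) (e : int) (pi : E) (q : nat) (s : gal_of {:E}).
Hypotheses (e0 : 0 < e) (Fpi : pi \in F) (pi0 : pi != 0) (vpi : v pi = e).
Hypothesis gen : forall x, x \in F -> x != 0 -> exists m, v x = m * e.
Hypotheses (q_prime : prime q) (Is : I s).
Hypothesis sF : forall x, x \in F -> s x \in F.
Hypothesis sq : forall x, x \in F -> iter q s x = x.

Local Lemma iter_mem n x : x \in F -> iter n s x \in F.
Proof. by move=> Fx; elim: n => //= n; apply: sF. Qed.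

Local Lemma iter_cong n x : vge 0 x -> cong (iter n s x) x.
Proof.
move=> hx; elim: n => [|n IH] /=; first exact: cong_refl.
apply: (cong_trans pP hv (y := s x)); last exact: (cong_inert pP hv).
by rewrite (cong_decomposes pP hv) //; apply: (inert_decomposes pP).
Qed.

Local Lemma iter_val n x : v (iter n s x) = v x.
Proof. by elim: n => //= n IH; rewrite (val_inert pP hv). Qed.

Local Lemma iter_neq0 n x : x != 0 -> iter n s x != 0.
Proof. by move=> x0; elim: n => //= n; rewrite fmorph_eq0. Qed.

Local Lemma iter_norm_fixed x : x \in F -> s (\prod_(i < q) iter i s x) = \prod_(i < q) iter i s x.
Proof.
move=> Fx; rewrite rmorph_prod; have q0 := prime_gt0 q_prime.
rewrite -(prednK q0) [RHS]big_ord_recl [LHS]big_ord_recr /= mulrC.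
by congr (_ * _); rewrite -/(iter _.+1 s x) (prednK q0) sq.
Qed.

Local Lemma iter_trace_fixed x : x \in F -> s (\sum_(i < q) iter i s x) = \sum_(i < q) iter i s x.
Proof.
move=> Fx; rewrite rmorph_sum; have q0 := prime_gt0 q_prime.
rewrite -(prednK q0) [RHS]big_ord_recl [LHS]big_ord_recr /= addrC.
by congr (_ + _); rewrite -/(iter _.+1 s x) (prednK q0) sq.
Qed.

(** If [q] is the residue characteristic, the norm of a [q]-th root of [z] modulo P has the residue
    of [z]; otherwise the trace of [z] divided by [q] has it. *)
Local Lemma residue_fixed_in z : z \in F -> vge 0 z ->
  exists c, [/\ c \in F, s c = c, vge 0 c & cong c z].
Proof.
move=> Fz hz; have [Eq|ne] := eqVneq q r.
  have [k hk] := frobenius_root pP hv rp Pr 1 hz; rewrite expn1 in hk.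
  have Fk : z ^+ k \in F by apply: rpredX.
  have hc : cong (\prod_(i < q) iter i s (z ^+ k)) z.
    apply: (cong_trans pP hv) hk; rewrite -Eq.
    have -> : (z ^+ k) ^+ q = \prod_(i < q) z ^+ k by rewrite prodr_const card_ord.
    by apply: (cong_prod pP hv) => i _; [|apply: iter_cong]; apply: (vge_exp0 hv).
  exists (\prod_(i < q) iter i s (z ^+ k)); split=> //.
  - by apply: rpred_prod => i _; apply: iter_mem.
  - exact: iter_norm_fixed.
  - exact: (cong_vge0 pP hv) hc hz.
have [m Em] : exists m, (m * q = 1 %[mod r])%N.
  by apply: inv_mod => //; rewrite prime_coprime // dvdn_prime2 // eq_sym.
have hW : cong (\sum_(i < q) iter i s z) (q%:R * z).
  have -> : q%:R * z = \sum_(i < q) z by rewrite sumr_const card_ord mulr_natl.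
  by apply: (cong_sum pP hv) => i _; apply: iter_cong.
have hqz : vge 0 (q%:R * z) by apply: (vge_mul0 hv) => //; apply: (val_nat hv).
have hc : cong (m%:R * \sum_(i < q) iter i s z) z.
  apply: (cong_trans pP hv (y := m%:R * (q%:R * z))).
    by apply: (cong_mul pP hv) => //; [apply: (val_nat hv)|apply: cong_refl].
  rewrite mulrA -natrM -[X in cong _ X]mul1r; apply: (cong_mul pP hv) => //.
  - exact: (vge01 hv).
  - exact: (cong_nat hv Pr Em).
  - exact: cong_refl.
exists (m%:R * \sum_(i < q) iter i s z); split=> //.
- by rewrite rpredM ?rpred_nat // rpred_sum // => i _; apply: iter_mem.
- by rewrite rmorphM rmorph_nat /= iter_trace_fixed.
- exact: (cong_vge0 pP hv) hc hz.
Qed.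

(** Successive approximation: residues have representatives fixed by [s], so every integral [x] is
    approximated to any order by polynomials in [p] with fixed coefficients, and [s x - x] has
    arbitrarily large valuation. *)
Local Lemma fixed_uniformizer_trivial p : p \in F -> p != 0 -> s p = p -> v p = e ->
  forall x, x \in F -> s x = x.
Proof.
move=> Fp p0 sp vp.
have nat_case n x : x \in F -> vge 0 x ->
    exists c, [/\ c \in F, s c = c & vge (e * n%:Z) (x - c)].
  move=> Fx hx; elim: n => [|n [c [Fc sc hc]]].
    by exists 0; rewrite mulr0 subr0 rpred0 rmorph0.
  have pn0 : p ^+ n != 0 by rewrite expf_neq0.
  have hz : vge 0 ((x - c) / p ^+ n).
    rewrite -(subrr (e * n%:Z)); apply: (vgeM hv) => //.
    by rewrite vge_val ?invr_eq0 // (valV hv) // (valX hv) // vp.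
  have Fz : (x - c) / p ^+ n \in F by rewrite rpred_div ?rpredB ?rpredX.
  have [d [Fd sd hd hdz]] := residue_fixed_in Fz hz.
  exists (c + d * p ^+ n); split.
  - by rewrite rpredD ?rpredM ?rpredX.
  - by rewrite rmorphD rmorphM rmorphXn /= sc sd sp.
  have -> : x - (c + d * p ^+ n) = ((x - c) / p ^+ n - d) * p ^+ n.
    by field.
  have -> : e * n.+1%:Z = e + e * n%:Z by rewrite -addn1 PoszD mulrDr mulr1 addrC.
  apply: (vgeM hv); last by rewrite vge_val // (valX hv) // vp.
  move: (cong_sym hv hdz); rewrite /cong; set w := _ - _ => hw.
  have Fw : w \in F by rewrite rpredB.
  have [->|w0] := eqVneq w 0; first exact: vge0.
  move: hw; rewrite !vge_val //; have [m ->] := gen Fw w0; exact: pos_multiple_ge.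
have pos x : x \in F -> vge 0 x -> s x = x.
  move=> Fx hx; apply/eqP; rewrite -subr_eq0; apply/eqP; apply: (val_nondiv_eq0 (v := v)) => n.
  have [c [Fc sc hc]] := nat_case n x Fx hx.
  have -> : s x - x = s (x - c) - (x - c) by rewrite rmorphB /= sc; ring.
  apply: (vge_le (n := e * n%:Z)); first exact: leq_pos_mul.
  by apply: (vgeB pP hv) => //; rewrite (vge_decomposes pP hv) //; apply: (inert_decomposes pP).
move=> x Fx; have [hx|/negPf hx] := boolP (vge 0 x); first exact: pos.
have x0 : x != 0 by apply: contraFneq hx => ->; apply: vge0.
apply: invr_inj; rewrite -fmorphV; apply: pos; first by rewrite rpredV.
by move: hx; rewrite !vge_val ?invr_eq0 // (valV hv) // oppr_ge0 => /negbT; rewrite -ltNge => /ltW.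
Qed.

(** If [q] did not divide [m], a Bezout combination of [y] and of the norm of [pi], of valuations
    [m * e] and [q * e], would be a fixed uniformizer of F, and [s] would be trivial on F. *)
Lemma prime_order_ramified y m : (exists2 x, x \in F & s x != x) ->
  y \in F -> y != 0 -> s y = y -> v y = m * e -> (q %| m)%Z.
Proof.
move=> [x Fx /eqP sx] Fy y0 sy vy; apply: contrapT => /negP nd; apply: sx.
have [a [b Eab]] : exists a b, a * m + b * q%:Z = 1.
  have [a [b]] := Bezoutz m q; rewrite (_ : gcdz m q = 1); first by exists a, b.
  by apply/eqP; rewrite gcdzC -/(coprimez _ _) coprimezE prime_coprime.
pose N := \prod_(i < q) iter i s pi.
have N0 : N != 0 by apply/prodf_neq0 => i _; apply: iter_neq0.
have vN : v N = q%:Z * e.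
  rewrite (val_prod hv) => [|i _]; last exact: iter_neq0.
  under eq_bigr do rewrite iter_val vpi.
  by rewrite sumr_const card_ord -mulr_natl natz.
apply: (@fixed_uniformizer_trivial (y ^ a * N ^ b)) => //.
- rewrite rpredM ?rpredXz //.
  by apply: rpred_prod => i _; apply: iter_mem.
- by rewrite mulf_neq0 // expfz_neq0.
- by rewrite rmorphM !fmorphXz /= sy iter_norm_fixed.
- rewrite (valM hv) ?expfz_neq0 // !valXz // vy vN -[RHS]mul1r -Eab; ring.
Qed.

End PrimeOrderInertia.

End FixedFields.

(** * Primes in subfields *)

Section PrimesInSubfields.

Variable E : splittingFieldType rat.
Implicit Types (F : {subfield E}) (P Q : set E) (x y : E).

Lemma prime_restrict F P : is_prime_of {:E}%AS P ->
  is_prime_of F (P `&` [set x | x \in F]).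
Proof.
move=> pP; have FO x : int_ring F x -> int_ring {:E}%AS x.
  by case=> _ ax; apply/int_ring_full.
split.
- split=> [x [Px Fx]||x y [Px Fx] [Py Fy]|a x Oa [Px Fx]].
  + by split=> //; apply/int_ring_full/(prime_sub pP).
  + by split; [apply: (prime0 pP)|apply: rpred0].
  + by split; [apply: (prime_add pP)|apply: rpredD].
  + by split; [apply: (prime_mulr pP) => //; apply: FO|apply: rpredM => //; case: Oa].
- have [r rp Pr] := prime_nat pP; exists r%:R; first by split=> //; apply: rpred_nat.
  by rewrite extQ_natr_eq0 -lt0n prime_gt0.
- by case=> /(prime_not1 pP).
- move=> x y Ox Oy [Pxy _].
  case: (prime_or pP (FO x Ox) (FO y Oy) Pxy) => h; [left|right]; split=> //.
    by case: Ox.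
  by case: Oy.
Qed.

(** The generator [e] of the value group of F is the ramification index of P over F, as [v] is
    normalized on E; the index in a tower of subfields is a ratio of two such generators. *)
Lemma val_generator F P v : is_prime_of {:E}%AS P -> valuation P v ->
  exists e pi, [/\ 0 < e, pi \in F, P pi, pi != 0 & v pi = e /\
    forall x, x \in F -> x != 0 -> exists m, v x = m * e].
Proof.
move=> pP hv; have pQ := prime_restrict F pP.
have [pi [[Ppi Fpi] pi0 piP]] := uniformizer_factor pQ.
exists (v pi), pi; split=> //; first exact: (val_prime hv).
split=> // x Fx x0; have [n [a [s [Ua Us Ex]]]] := piP x Fx x0.
have v0 u : coprime_to F (P `&` [set x | x \in F]) u -> u != 0 /\ v u = 0.
  move=> Uu; split; first exact: (coprime_to_neq0 pQ).
  case: Uu => -[Fu au] nP; apply: (val_coprime hv) => // Pu.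
  by apply: nP; split.
have [[a0 va] [s0 vs]] := (v0 _ Ua, v0 _ Us).
exists n; rewrite Ex (valM hv) ?mulf_neq0 ?invr_eq0 ?expfz_neq0 //.
rewrite (val_div hv) // va vs (valXz hv) //; ring.
Qed.

(** Lying over, by Zorn's lemma: an ideal of the integers of E that is maximal among those meeting F
    inside Q is prime. *)
Lemma prime_above F Q : is_prime_of F Q ->
  exists P, is_prime_of {:E}%AS P /\ lies_above F Q P.
Proof.
move=> pQ; have [pi [Qpi piP]] := uniformizer_exists pQ.
have pi0 : pi != 0.
  apply/eqP => pi0; case: (pQ) => _ [x Qx /eqP x0] _ _; apply: x0.
  have [a [s [_ /(coprime_to_neq0 pQ) s0]]] := piP _ Qx; rewrite pi0 mul0r => /eqP.
  by rewrite mulf_eq0 (negPf s0) orbF => /eqP.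
(* Q is required to be contained in nonempty J only, so that the union of an empty chain qualifies.
   That the maximal set is not empty follows by comparison with [B0], the local multiples of
   [pi]. *)
pose C (J : set E) := [/\ J `<=` [set x | aint x],
  forall x y, J x -> J y -> J (x + y), forall a x, aint a -> J x -> J (a * x),
  forall x, J x -> x \in F -> Q x & forall x, J x -> Q `<=` J].
have [A [[AO AD AM AF AQ] maxA]] : exists A, C A /\ forall B, A `<` B -> ~ C B.
  apply: Zorn_bigcup => W WC Wtot; split.
  - by move=> x [X /WC[h _ _ _ _]]; apply: h.
  - move=> x y [X WX Xx] [Y WY Yy]; case: (Wtot X Y WX WY) => h.
      by exists Y => //; case: (WC Y WY) => _ hD _ _ _; apply: hD => //; apply: h.
    by exists X => //; case: (WC X WX) => _ hD _ _ _; apply: hD => //; apply: h.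
  - by move=> a x aa [X WX Xx]; exists X => //; case: (WC X WX) => _ _ hM _ _; apply: hM.
  - by move=> x [X WX Xx] Fx; case: (WC X WX) => _ _ _ hF _; apply: hF.
  - by move=> x [X WX Xx] y Qy; exists X => //; case: (WC X WX) => _ _ _ _ h; apply: (h x Xx).
have Q_sub_aint x : Q x -> aint x by move/(prime_sub pQ) => [].
pose B0 := [set x : E | aint x /\ exists s a, [/\ coprime_to F Q s, aint a & x * s = pi * a]].
have CB0 : C B0.
  split.
  - by move=> x [].
  - move=> x y [ax [s [a [Us aa Ex]]]] [ay [t [b [Ut ab Ey]]]]; split; first exact: integral_add.
    exists (s * t), (a * t + b * s); split; first exact: (coprime_to_mul pQ).
      by case: Us Ut => -[_ as_] _ [[_ at_] _]; apply: integral_add; apply: integral_mul.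
    have -> : (x + y) * (s * t) = x * s * t + y * t * s by ring.
    by rewrite Ex Ey; ring.
  - move=> c x ac [ax [s [a [Us aa Ex]]]]; split; first exact: integral_mul.
    exists s, (c * a); split=> //; first exact: integral_mul.
    by rewrite -mulrA Ex mulrCA.
  - move=> x [ax [s [a [Us aa Ex]]]] Fx.
    have Fa : a \in F.
      have -> : a = x * s / pi by rewrite Ex mulrAC divff // mul1r.
      by rewrite rpred_div ?rpredM //; [case: Us => -[]|case: (prime_sub pQ Qpi)].
    have Qxs : Q (x * s) by rewrite Ex; apply: (prime_mull pQ).
    by case: (prime_or pQ _ _ Qxs) => //; case: Us => // Os nQ [].
  - move=> x _ y Qy; split; first exact: Q_sub_aint.
    by have [a [s [[_ aa] Us Ey]]] := piP y Qy; exists s, a.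
have [x0 Ax0] : exists x, A x.
  apply: contrapT => none; apply: (maxA B0) => //; split; first by move=> x Ax; case: none; exists x.
  move=> /(_ pi) h; apply: none; exists pi; apply: h; split; first exact: Q_sub_aint.
  by exists 1, 1; split; [exact: (coprime_to1 pQ)|exact: integral1|].
have QA := AQ x0 Ax0.
have AQF x : int_ring F x -> A x -> Q x by case=> Fx _ Ax; apply: AF.
have AN x : A x -> A (- x).
  by move=> Ax; rewrite -mulN1r; apply: AM => //; apply/integral_opp/integral1.
have Q1 : ~ Q 1 by apply: (prime_not1 pQ).
exists A; split; last first.
  apply/seteqP; split=> [x [Ax Fx]|x Qx]; first exact: AF.
  by split; [apply: QA|case: (prime_sub pQ Qx)].
(* By maximality, the ideal generated by A and [x] meets F outside Q. Multiplying two such relations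
   gives primality of A from that of Q. *)
have ext x : aint x -> ~ A x ->
    exists u c, [/\ int_ring F u, ~ Q u, aint c & A (u - c * x)].
  move=> ax nAx; pose B := [set y | exists c, aint c /\ A (y - c * x)].
  have AB : A `<` B.
    split=> [y Ay|]; first by exists 0; rewrite mul0r subr0; split=> //; apply: integral0.
    move=> /(_ x) h; apply: nAx; apply: h; exists 1; rewrite mul1r subrr.
    split; first exact: integral1.
    by rewrite -(subrr x0); apply: AD => //; apply: AN.
  have aB y : B y -> aint y.
    case=> c [ac /AO h]; rewrite -(subrK (c * x) y).
    by apply: integral_add => //; apply: integral_mul.
  apply: contrapT => none; apply: (maxA B AB); split=> //.
  - move=> y z [c [ac Ay]] [d [ad Az]]; exists (c + d); split; first exact: integral_add.
    by rewrite mulrDl opprD addrACA; apply: AD.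
  - move=> a y aa [c [ac Ay]]; exists (a * c); split; first exact: integral_mul.
    by rewrite -mulrA -mulrBr; apply: AM.
  - move=> y [c [ac Ay]] Fy; apply: contrapT => nQy; apply: none.
    by exists y, c; split=> //; split=> //; apply: aB; exists c.
  - by move=> y _ z Qz; case: AB => h _; apply/h/QA.
split.
- split=> [x /AO ax||x y|a x [_ aa]]; [exact/int_ring_full| |exact: AD|exact: AM].
  by rewrite -(subrr x0); apply: AD => //; apply: AN.
- by case: (pQ) => _ [x Qx x1] _ _; exists x => //; apply: QA.
- by move=> A1; apply: Q1; apply: AQF => //; apply: int_ring1.
- move=> x y [_ ax] [_ ay] Axy; apply: contrapT => h.
  have [nAx nAy] : ~ A x /\ ~ A y by split=> ?; apply: h; [left|right].
  have [u [c [Ou nQu ac Au]]] := ext x ax nAx.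
  have [w [d [Ow nQw ad Aw]]] := ext y ay nAy.
  case: (prime_or pQ Ou Ow) => //; apply: AQF; first exact: int_ring_mul.
  have -> : u * w = w * (u - c * x) + (c * x) * (w - d * y) + (c * d) * (x * y) by ring.
  apply: (AD); last by apply: AM => //; apply: integral_mul.
  apply: AD; apply: (AM) => //; first by case: Ow.
  exact: integral_mul.
Qed.

End PrimesInSubfields.

(** * Tame ramification *)

Section RootsOfUnity.

Variables (E : splittingFieldType rat) (P : set E) (v : E -> int) (r : nat).
Hypotheses (pP : is_prime_of {:E}%AS P) (hv : valuation P v).
Hypotheses (rp : prime r) (Pr : P r%:R).
Implicit Types (x y : E) (s : gal_of {:E}).

Local Notation vge := (vge v).
Local Notation cong := (cong v).

Lemma galXx s n x : (s ^+ n)%g x = iter n s x.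
Proof.
by elim: n => [|n IH] /=; rewrite ?expg0 ?gal_id // expgSr galMx IH.
Qed.

Lemma unity_neq0 x n : (0 < n)%N -> x ^+ n = 1 -> x != 0.
Proof.
move=> n0 xn; apply/eqP => x0; move: xn; rewrite x0 expr0n eqn0Ngt n0 => /eqP.
by rewrite eq_sym oner_eq0.
Qed.

Lemma unity_val x n : (0 < n)%N -> x ^+ n = 1 -> v x = 0.
Proof.
move=> n0 xn; have x0 := unity_neq0 n0 xn.
have := valX hv n x0; rewrite xn (val1 hv) => /eqP; rewrite eq_sym mulf_eq0.
by case/orP => /eqP // h; move: n0; case: (n) h.
Qed.

(** If [x] were not 1, the sum of its [n] first powers would be 0; but it is congruent to [n], a
    unit at P. *)
Lemma unity_cong1 x n : coprime r n -> x ^+ n = 1 -> cong x 1 -> x = 1.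
Proof.
move=> cop xn h; apply/eqP; rewrite -subr_eq0; apply: contraT => x1.
have : (x - 1) * \sum_(i < n) x ^+ i = 0 by rewrite -subrX1 xn subrr.
move=> /eqP; rewrite mulf_eq0 (negPf x1) /= => /eqP s0.
have : cong (\sum_(i < n) x ^+ i) n%:R.
  have -> : n%:R = \sum_(i < n) (1 : E) by rewrite sumr_const card_ord.
  apply: (cong_sum pP hv) => i _; rewrite -[X in cong _ X](expr1n _ i).
  by apply: (cong_exp pP hv) => //; apply: (vge01 hv).
have [n0 vn] := val_coprime_nat pP hv rp Pr cop.
by rewrite s0 => /(cong_val0 pP hv n0 vn)[]; rewrite eqxx.
Qed.

Lemma cong_divr x y z : v z = 0 -> z != 0 -> cong x y -> cong (x / z) (y / z).
Proof.
move=> vz z0 h; rewrite /cong -mulrBl; apply: (vge_mulr hv) => //.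
by rewrite vge_val ?invr_eq0 // (valV hv) // vz.
Qed.

Lemma cong_inv x y : v y = 0 -> y != 0 -> cong x y -> cong x^-1 y^-1.
Proof.
move=> vy y0 h; have [x0 vx] := cong_val0 pP hv y0 vy h.
have -> : x^-1 = y / (x * y) by field; rewrite x0 y0.
have -> : y^-1 = x / (x * y) by field; rewrite x0 y0.
by apply: cong_divr; rewrite ?mulf_neq0 // ?(valM hv) // ?vx ?vy //; apply: (cong_sym hv).
Qed.

Lemma cong_expz x y (n : int) : v y = 0 -> y != 0 -> cong x y -> cong (x ^ n) (y ^ n).
Proof.
move=> vy y0 h; have hy : vge 0 y by rewrite vge_val // vy.
case: n => n; first exact: (cong_exp pP hv).
rewrite NegzE -!exprnN; apply: cong_inv; rewrite ?expf_neq0 //.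
  by rewrite (valX hv) // vy mul0r.
exact: (cong_exp pP hv).
Qed.

Lemma inert_unity s x n : coprime r n -> (0 < n)%N -> x ^+ n = 1 -> inert P s -> s x = x.
Proof.
move=> cop n0 xn Is; have x0 := unity_neq0 n0 xn; have vx := unity_val n0 xn.
have hx : vge 0 x by rewrite vge_val // vx.
apply: (divIf x0); rewrite divff //; apply: (unity_cong1 cop).
  by rewrite expr_div_n -rmorphXn xn rmorph1 divr1.
by rewrite -(divff x0); apply: cong_divr => //; apply: (cong_inert pP hv).
Qed.

(* If s acts on a uniformizer pi through omega modulo P, then it acts through
   omega^m on all the elements of valuation m. *)
Lemma inert_character s pi om x (m : int) : inert P s -> pi != 0 -> x != 0 -> om != 0 ->
  v om = 0 -> cong (s pi / pi) om -> v x = m * v pi -> cong (s x / x) (om ^ m).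
Proof.
move=> Is pi0 x0 om0 vom h vx.
have pm0 : pi ^ m != 0 by rewrite expfz_neq0.
pose u := x / pi ^ m; have u0 : u != 0 by rewrite mulf_neq0 ?invr_eq0.
have vu : v u = 0 by rewrite (val_div hv) // (valXz hv) // vx mulrC subrr.
have hu : vge 0 u by rewrite vge_val // vu.
have Ex : x = u * pi ^ m by rewrite divfK.
have -> : s x / x = (s u / u) * (s pi / pi) ^ m.
  rewrite Ex rmorphM fmorphXz /= invfM mulrACA; congr (_ * _).
  by rewrite expfzMl exprz_inv invr_expz.
rewrite -[X in cong _ X]mul1r; apply: (cong_mul pP hv).
- exact: (vge01 hv).
- by rewrite vge_val ?expfz_neq0 // (valXz hv) // vom mul0r.
- by rewrite -(divff u0); apply: cong_divr => //; apply: (cong_inert pP hv).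
- exact: cong_expz.
Qed.

End RootsOfUnity.

Section TameGenerator.

Variables (E : splittingFieldType rat) (K1 L1 : {subfield E}).
Variables (P : set E) (v : E -> int) (r : nat).
Hypotheses (pP : is_prime_of {:E}%AS P) (hv : valuation P v).
Hypotheses (rp : prime r) (Pr : P r%:R).
Implicit Types (x y : E) (s t : gal_of {:E}).

Local Notation vge := (vge v).
Local Notation cong := (cong v).

Variables (l : nat) (z : E).
Hypotheses (l_prime : prime l) (z_prim : l.-primitive_root z).
Hypothesis sKL : (K1 <= L1)%VS.
Hypothesis galL_mem : forall s x, s \in 'Gal({:E} / K1)%g -> x \in L1 -> s x \in L1.
Hypothesis galL_order : forall s x, s \in 'Gal({:E} / K1)%g -> x \in L1 -> iter l s x = x.
Hypothesis galL_cyclic : forall s t, s \in 'Gal({:E} / K1)%g -> t \in 'Gal({:E} / K1)%g ->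
  (exists2 x, x \in L1 & s x != x) -> exists i, forall x, x \in L1 -> t x = iter i s x.

Variables (eK eL : int) (piL : E) (e' : nat).
Hypotheses (eL0 : 0 < eL) (LpiL : piL \in L1) (piL0 : piL != 0) (vpiL : v piL = eL).
Hypothesis genK : forall x, x \in K1 -> x != 0 -> exists m, v x = m * eK.
Hypotheses (eKE : eK = e'%:Z * eL) (e'1 : (1 < e')%N) (tameL : ~~ (r %| e')%N).

(** Otherwise [piL] would be fixed by inertia, and [inertia_field_unramified] would give an element
    of K1 of valuation [eL], which is no multiple of [eK]. *)
Lemma inert_nontrivial :
  exists2 g, g \in inertia P K1 & exists2 x, x \in L1 & g x != x.
Proof.
apply: contrapT => none.
have fixL s x : s \in inertia P K1 -> x \in L1 -> s x = x.
  move=> Is Lx; apply/eqP; apply: contrapT => /negP h; apply: none.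
  by exists s => //; exists x.
have [x [Kx x0 vx]] := inertia_field_unramified pP hv rp Pr piL0
  (fun s (Is : s \in inertia P K1) => fixL s piL Is LpiL).
have [m Em] := genK Kx x0; move: vx; rewrite Em vpiL eKE mulrA.
move/(congr1 (fun n => (n %/ eL)%Z)); rewrite mulzK ?gt_eqF // divzz gt_eqF //= => h.
have : (e'%:Z %| 1)%Z by apply/dvdzP; exists m.
by rewrite dvdz1 => /eqP /= e1; move: e'1; rewrite e1.
Qed.

Section Generator.

Variable g : gal_of {:E}.
Hypotheses (Ig : g \in inertia P K1) (g_nontriv : exists2 x, x \in L1 & g x != x).

Local Lemma g_gal : g \in 'Gal({:E} / K1)%g. Proof. by case/inertiaP: Ig. Qed.
Local Lemma g_inert : inert P g. Proof. by case/inertiaP: Ig. Qed.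

Lemma iter_g_mem i x : x \in L1 -> iter i g x \in L1.
Proof. by move=> Lx; elim: i => //= i; apply: galL_mem g_gal. Qed.

Lemma g_fixed_mem x : x \in L1 -> g x = x -> x \in K1.
Proof.
move=> Lx gx; apply: galois_mem => s Gs.
have [i ->] // := galL_cyclic g_gal Gs g_nontriv.
by elim: i => //= i ->.
Qed.

Lemma iter_g_inert i : inert P (g ^+ i)%g.
Proof.
elim: i => [|i IH]; first by rewrite expg0; apply: (inert1 pP).
by rewrite expgS; apply: (inertM pP) => //; apply: g_inert.
Qed.

(** The norm of [piL] lies in K1 and has valuation [l * eL], so [e'] divides the prime [l]. *)
Lemma ram_index_eq : e' = l.
Proof.
pose N := \prod_(i < l) iter i g piL.
have it0 i : iter i g piL != 0 by rewrite -galXx fmorph_eq0.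
have LN : N \in L1 by apply: rpred_prod => i _; apply: iter_g_mem.
have gN : g N = N.
  rewrite rmorph_prod; have l0 := prime_gt0 l_prime.
  rewrite /N -(prednK l0) [RHS]big_ord_recl [LHS]big_ord_recr /= mulrC.
  by congr (_ * _); rewrite -/(iter _.+1 g piL) (prednK l0) galL_order ?g_gal.
have N0 : N != 0 by apply/prodf_neq0 => i _; apply: it0.
have vN : v N = l%:Z * eL.
  rewrite (val_prod hv) => [|i _]; last exact: it0.
  under eq_bigr do rewrite -galXx (val_inert pP hv _ (iter_g_inert _)) vpiL.
  by rewrite sumr_const card_ord -mulr_natl natz.
have [m Em] := genK (g_fixed_mem LN gN) N0; move: vN; rewrite Em eKE mulrA => h.
have : (e' %| l)%N.
  have : (e'%:Z %| l%:Z)%Z.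
    by apply/dvdzP; exists m; apply: (mulIf (lt0r_neq0 eL0)); rewrite -h.
  by [].
case/primeP: l_prime => _ hl /hl /orP[/eqP e1|/eqP //]; by move: e'1; rewrite e1.
Qed.

Lemma coprime_rl : coprime r l.
Proof.
rewrite prime_coprime // dvdn_prime2 //; apply: contraNneq tameL => ->.
by rewrite ram_index_eq.
Qed.

(* g acts on the uniformizer through a primitive l-th root of unity modulo P: were
   it through 1, the trace of piL, which lies in K1, would have the valuation of piL. *)
Lemma tame_character : exists zeta i,
  [/\ zeta = z ^+ i, l.-primitive_root zeta & cong (g piL / piL) zeta].
Proof.
have l0 := prime_gt0 l_prime; have Ig' := g_inert.
set om := g piL / piL.
have om0 : om != 0 by rewrite mulf_neq0 ?invr_eq0 ?fmorph_eq0.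
have vom : v om = 0 by rewrite (val_div hv) ?fmorph_eq0 // (val_inert pP hv) // subrr.
have hom : vge 0 om by rewrite vge_val // vom.
have iter_om j : cong (iter j g piL / piL) (om ^+ j).
  elim: j => [|j IH] /=; first by rewrite divff // expr0; apply: cong_refl.
  have -> : g (iter j g piL) / piL = g (iter j g piL / piL) * om.
    by rewrite fmorph_div /= /om mulrA divfK // fmorph_eq0.
  rewrite exprSr; apply: (cong_mul pP hv) => //.
  - exact: (vge_exp0 hv).
  - apply: (cong_trans pP hv (y := iter j g piL / piL)) => //.
    apply: (cong_inert pP hv) => //.
    exact: (cong_vge0 pP hv IH (vge_exp0 hv _ hom)).
  - exact: cong_refl.
have oml : cong (om ^+ l) 1.
  by apply: (cong_sym hv); have := iter_om l; rewrite galL_order ?g_gal // divff.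
(* Modulo P, [om] is a root of [X^l - 1], which is the product of the [X - z ^+ i]; so one factor
   vanishes modulo P. *)
have prod1 : vge 1 (\prod_(i < l) (om - z ^+ i)).
  have := oml; rewrite /cong; congr (vge _ _).
  have := congr1 (fun p => p.[om]) (factor_Xn_sub_1 z_prim).
  rewrite horner_prod big_mkord !hornerE => <-.
  by apply: eq_bigr => i _; rewrite !hornerE.
have hz i : vge 0 (z ^+ i).
  have zi : (z ^+ i) ^+ l = 1 by rewrite exprAC (prim_expr_order z_prim) expr1n.
  by rewrite vge_val ?(unity_neq0 l0 zi) // (unity_val hv l0 zi).
have [i hi] : exists i, cong om (z ^+ i).
  apply: contrapT => none.
  have n0 (i : 'I_l) : om - z ^+ i != 0 /\ v (om - z ^+ i) = 0.
    apply: val_not_cong0; first exact: (vgeB pP hv).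
    by rewrite /cong subr0; apply/negP => h; apply: none; exists i.
  have : \prod_(i < l) (om - z ^+ i) != 0 by apply/prodf_neq0 => i _; case: (n0 i).
  move=> p0; move: prod1; rewrite vge_val // (val_prod hv) => [|i _]; last by case: (n0 i).
  by rewrite big1 // => i _; case: (n0 i).
have zil : (z ^+ i) ^+ l = 1 by rewrite exprAC (prim_expr_order z_prim) expr1n.
exists (z ^+ i), i; split=> //.
rewrite (prim_root_exp_coprime _ z_prim) coprime_sym prime_coprime //; apply/negP => /dvdnP[j Ej].
have om1 : cong om 1.
  by move: hi; rewrite Ej mulnC exprM (prim_expr_order z_prim) expr1n.
pose T := \sum_(i < l) iter i g piL.
have LT : T \in L1 by apply: rpred_sum => k _; apply: iter_g_mem.
have gT : g T = T.
  rewrite rmorph_sum /T -(prednK l0) [RHS]big_ord_recl [LHS]big_ord_recr /= addrC.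
  by congr (_ + _); rewrite -/(iter _.+1 g piL) (prednK l0) galL_order ?g_gal.
have hT : cong (T / piL) l%:R.
  have -> : l%:R = \sum_(i < l) (1 : E) by rewrite sumr_const card_ord.
  rewrite mulr_suml; apply: (cong_sum pP hv) => k _.
  apply: (cong_trans pP hv (iter_om k)); rewrite -[X in cong _ X](expr1n _ k).
  by apply: (cong_exp pP hv) => //; apply: (vge01 hv).
have [l0' vl] := val_coprime_nat pP hv rp Pr coprime_rl.
have [T0' vT] := cong_val0 pP hv l0' vl hT.
have T0 : T != 0 by apply: contraNneq T0' => ->; rewrite mul0r.
have [m Em] := genK (g_fixed_mem LT gT) T0.
move: vT; rewrite (val_div hv) // vpiL Em eKE mulrA => /eqP; rewrite subr_eq0 => /eqP.
rewrite -{2}[eL]mul1r => /(mulIf (lt0r_neq0 eL0)) h.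
have : (e'%:Z %| 1)%Z by apply/dvdzP; exists m.
by rewrite dvdz1 => /eqP /= e1; move: e'1; rewrite e1.
Qed.

End Generator.
End TameGenerator.

(** * Resolvents *)

Lemma galM_adjoin (E : splittingFieldType rat) (F : {subfield E}) (z : E)
    (s t : gal_of {:E}) : {in F, s =1 t} -> s z = t z -> {in <<F; z>>%VS, s =1 t}.
Proof.
move=> eqF eqz x /Fadjoin_polyP[p Fp ->]; rewrite -!horner_map /= eqz; congr (_.[_]).
by apply/polyP => i; rewrite !coef_map; apply/eqF/(polyOverP Fp).
Qed.

Lemma gal_adjoin_mem (E : splittingFieldType rat) (F : {subfield E}) (z : E)
    (s : gal_of {:E}) : {in F, forall x, s x \in F} -> s z \in <<F; z>>%VS ->
  {in <<F; z>>%VS, forall x, s x \in <<F; z>>%VS}.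
Proof.
move=> sF sz x /Fadjoin_polyP[p Fp ->]; rewrite -horner_map /=.
apply: rpred_horner => //; apply/polyOverP => i; rewrite coef_map.
by apply: (subvP (subv_adjoin F z)); apply: sF; apply: (polyOverP Fp).
Qed.

Lemma prim_order_dvdz (K : fieldType) (n : nat) (z : K) (m : int) :
  n.-primitive_root z -> (n%:Z %| m)%Z = (z ^ m == 1).
Proof.
move=> pz; rewrite dvdzE /= (prim_order_dvd pz); case: m => m //=.
by rewrite NegzE -exprnN -[1 in RHS]invr1 (inj_eq invr_inj).
Qed.

Lemma ge_of_dvd_sub (l t : nat) (m : int) :
  (t < l)%N -> 0 <= m -> (l%:Z %| m - t%:Z)%Z -> t%:Z <= m.
Proof. by move=> tl m0 /dvdzP[[q|q] Eq]; rewrite ?NegzE in Eq; nia. Qed.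

Lemma sub_bounds (l t : nat) : (0 < t < l)%N -> (0 < l - t < l)%N.
Proof. by lia. Qed.

Lemma pred_mul_mod (l t : nat) : (0 < t < l)%N -> l.-1 * t = l - t %[mod l].
Proof.
move=> tl; have -> : (l.-1 * t = l - t + t.-1 * l)%N by nia.
by rewrite addnC modnMDl.
Qed.

Lemma mul_sub_mod (l m h h' : nat) : (h <= l)%N -> (h' <= l)%N ->
  m * h = h' %[mod l] -> m * (l - h) = l - h' %[mod l].
Proof.
move=> hl hl' e; apply/eqP; rewrite -(eqn_modDr (m * h)) -mulnDr subnK //.
by rewrite modnMl -modnDmr e modnDmr subnK // modnn.
Qed.

(** The product of the first two congruences gives 3 (l - 2) = l - 6 modulo [q], whose sides differ
    by 2l. It is applied both to a prime [q] and to [l * l]. *)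
Lemma dvdz_exponents (q s3 s2 : nat) (l : int) :
  (q%:Z %| 3 - s3%:Z)%Z -> (q%:Z %| l - 2 - s2%:Z)%Z ->
  (q%:Z %| l - 6 - (s3 * s2)%N%:Z)%Z -> (q%:Z %| l * 2)%Z.
Proof.
move=> /dvdzP[a Ea] /dvdzP[b Eb] /dvdzP[c Ec]; apply/dvdzP.
exists (a * (l - 2) + s3%:Z * b - c).
have -> : l * 2 = (3 - s3%:Z) * (l - 2) + s3%:Z * (l - 2 - s2%:Z) - (l - 6 - (s3 * s2)%N%:Z).
  by rewrite PoszM; ring.
by rewrite Ea Eb Ec; ring.
Qed.

(** The four indices h are those for which c = 2h - l equals 1, 3, l - 2 and l - 6 ([half_values]).
    The multipliers 3 and l - 2 connect them modulo [l] ([half_congruences]). *)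
Lemma half_bounds k l : l = k.*2.+1 -> (1 < k)%N ->
  [/\ (0 < k.+1 < l)%N, (0 < k.+2 < l)%N, (0 < k.*2 < l)%N & (0 < k.*2 - 2 < l)%N].
Proof. by move=> -> k1; split; lia. Qed.

Lemma half_congruences k l : l = k.*2.+1 -> (1 < k)%N ->
  [/\ 3 * k.+1 = k.+2 %[mod l], (k.*2 - 1) * k.+1 = k.*2 %[mod l]
    & 3 * k.*2 = k.*2 - 2 %[mod l]].
Proof.
move=> -> k1; split.
- by rewrite (_ : 3 * k.+1 = 1 * k.*2.+1 + k.+2)%N ?modnMDl //; lia.
- by rewrite (_ : (k.*2 - 1) * k.+1 = (k - 1) * k.*2.+1 + k.*2)%N ?modnMDl //; nia.
- by rewrite (_ : 3 * k.*2 = 2 * k.*2.+1 + (k.*2 - 2))%N ?modnMDl //; lia.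
Qed.

Lemma half_not_dvd k l : l = k.*2.+1 -> (1 < k)%N ->
  ~~ (l %| 3)%N /\ ~~ (l %| k.*2 - 1)%N.
Proof.
move=> -> k1; split; apply/negP => /dvdn_leq h; first by have := h isT; lia.
have p : (0 < k.*2 - 1)%N by lia.
by have := h p; lia.
Qed.

Lemma half_values k l : l = k.*2.+1 -> (1 < k)%N ->
  [/\ k.+1%:Z - (l - k.+1)%N%:Z = 1, k.+2%:Z - (l - k.+2)%N%:Z = 3,
      k.*2%:Z - (l - k.*2)%N%:Z = l%:Z - 2
    & (k.*2 - 2)%N%:Z - (l - (k.*2 - 2))%N%:Z = l%:Z - 6].
Proof. by move=> -> k1; split; lia. Qed.

Lemma half_first k l : l = k.*2.+1 -> (0 < k)%N ->
  (0 < k.+1 < l)%N /\ k.+1%:Z - (l - k.+1)%N%:Z = 1.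
Proof. by move=> -> k1; split; lia. Qed.

Lemma dvdz_subC (d a b : int) : (d %| a - b)%Z = (d %| b - a)%Z.
Proof. by rewrite -(opprB b a) !dvdzE abszN. Qed.

Section Resolvents.

Variables (E : splittingFieldType rat) (k1 K1 L1 : {subfield E}).
Variables (P : set E) (v : E -> int) (r : nat).
Hypotheses (pP : is_prime_of {:E}%AS P) (hv : valuation P v).
Hypotheses (rp : prime r) (Pr : P r%:R).
Implicit Types (x y a : E) (s : gal_of {:E}) (t : nat).

Local Notation vge := (vge v).
Local Notation cong := (cong v).

Variables (l : nat) (zeta : E).
Hypotheses (l_prime : prime l) (zeta_prim : l.-primitive_root zeta).
Hypothesis cop : coprime r l.
Hypotheses (skK : (k1 <= K1)%VS) (sKL : (K1 <= L1)%VS).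
Hypothesis normK : forall s x, s \in 'Gal({:E} / k1)%g -> x \in K1 -> s x \in K1.
Hypothesis normL : forall s x, s \in 'Gal({:E} / k1)%g -> x \in L1 -> s x \in L1.
Variable g : gal_of {:E}.
Hypotheses (Gg : g \in 'Gal({:E} / K1)%g) (Ig : inert P g).
Hypothesis g_order : forall x, x \in L1 -> iter l g x = x.
Hypothesis g_gen : forall s, s \in 'Gal({:E} / K1)%g ->
  exists i, forall x, x \in L1 -> s x = iter i g x.
Variables (eL : int) (piL : E).
Hypotheses (eL0 : 0 < eL) (LpiL : piL \in L1) (PpiL : P piL) (piL0 : piL != 0).
Hypothesis vpiL : v piL = eL.
Hypothesis genL : forall x, x \in L1 -> x != 0 -> exists m, v x = m * eL.
Hypothesis g_char : cong (g piL / piL) zeta.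

Local Notation C := <<K1; zeta>>%VS.
Local Notation M := <<L1; zeta>>%VS.

Let l0 : (0 < l)%N. Proof. exact: prime_gt0. Qed.
Let zl : zeta ^+ l = 1. Proof. exact: prim_expr_order. Qed.
Let zl1 t : (zeta ^+ t) ^+ l = 1. Proof. by rewrite exprAC zl expr1n. Qed.
Let zt0 t : zeta ^+ t != 0. Proof. exact: unity_neq0 (zl1 t). Qed.
Let vz t : v (zeta ^+ t) = 0. Proof. exact: (unity_val hv l0 (zl1 t)). Qed.
Let hz t : vge 0 (zeta ^+ t).
Proof. by rewrite vge_val; [rewrite vz|apply: zt0]. Qed.
Let hu x : x ^+ l = 1 -> vge 0 x.
Proof. by move=> xl; rewrite vge_val; [rewrite (unity_val hv l0 xl)|apply: unity_neq0 xl]. Qed.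
Let CM : {subset C <= M}.
Proof. by apply/subvP; apply: adjoinSl. Qed.
Let LM x : x \in L1 -> x \in M. Proof. exact: (subvP (subv_adjoin L1 zeta)). Qed.
Let zM : zeta \in M. Proof. exact: memv_adjoin. Qed.
Let zC : zeta \in C. Proof. exact: memv_adjoin. Qed.
Let gk1 : g \in 'Gal({:E} / k1)%g.
Proof. by apply: (fintype.subsetP (galS _ skK)). Qed.
Let gL x : x \in L1 -> g x \in L1. Proof. exact: normL. Qed.
Let itL i x : x \in L1 -> iter i g x \in L1.
Proof. by move=> Lx; elim: i => //= i; apply: gL. Qed.

Lemma inert_zeta s : inert P s -> s zeta = zeta.
Proof. by move=> Is; apply: (inert_unity pP hv rp Pr cop) zl Is. Qed.

Let gz := inert_zeta Ig.

(** Adjoining zeta is unramified at P: inertia fixes zeta, whose order is prime to [r], so [x] lies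
    in the inertia field over L1. *)
Lemma val_adjoin_unity x : x \in M -> x != 0 -> exists m, v x = m * eL.
Proof.
move=> Mx x0; have fix_x s : s \in inertia P L1 -> s x = x.
  case/inertiaP => /mem_galP sL Is; rewrite -[RHS](gal_id {:E}).
  apply: galM_adjoin Mx; last by rewrite gal_id inert_zeta.
  by move=> y Ly; rewrite gal_id sL.
have [y [Ly y0 <-]] := inertia_field_unramified pP hv rp Pr x0 fix_x.
exact: genL.
Qed.

Definition resolvent a x := \sum_(j < l) a ^+ j * iter j g x.

Lemma resolvent_mem a x : a \in M -> x \in L1 -> resolvent a x \in M.
Proof.
move=> Ma Lx; apply: rpred_sum => j _.
by apply: rpredM; [apply: rpredX|apply/LM/itL].
Qed.

Lemma resolvent_g a x : a ^+ l = 1 -> g a = a -> x \in L1 ->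
  g (resolvent a x) = a^-1 * resolvent a x.
Proof.
move=> al ga Lx; have a0 := unity_neq0 l0 al.
apply: (mulfI a0); rewrite mulVKf // /resolvent rmorph_sum mulr_sumr -(prednK l0).
rewrite [RHS]big_ord_recl [LHS]big_ord_recr /= addrC; congr (_ + _).
  rewrite rmorphM rmorphXn /= ga mulrA -exprS (prednK l0) al expr0.
  by rewrite -/(iter _.+1 g x) (prednK l0) g_order.
by apply: eq_bigr => i _; rewrite rmorphM rmorphXn /= ga mulrA -exprS.
Qed.

(** The inverse makes this an eigenvector of [g] for the eigenvalue [zeta ^+ t]. *)
Definition eigres t x := resolvent (zeta ^+ t)^-1 x.

Let zV t : ((zeta ^+ t)^-1) ^+ l = 1.
Proof. by rewrite exprVn zl1 invr1. Qed.

Lemma eigres_mod t t' x : t = t' %[mod l] -> eigres t x = eigres t' x.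
Proof. by rewrite /eigres => /eqP; rewrite -(eq_prim_root_expr zeta_prim) => /eqP ->. Qed.

Lemma eigres_mem t x : x \in L1 -> eigres t x \in M.
Proof.
move=> Lx; apply: resolvent_mem => //; rewrite rpredV.
exact: rpredX.
Qed.

Lemma eigres_g t x : x \in L1 -> g (eigres t x) = zeta ^+ t * eigres t x.
Proof.
move=> Lx; rewrite /eigres resolvent_g ?invrK //.
by rewrite fmorphV rmorphXn /= gz.
Qed.

(** By [inert_character], [g] multiplies an element of valuation [m * eL] by [zeta ^ m] modulo P;
    comparison with the eigenvalue determines [m] modulo [l]. *)
Lemma val_g_eigen t x : x \in M -> x != 0 -> g x = zeta ^+ t * x ->
  exists m : int, v x = m * eL /\ (l%:Z %| m - t%:Z)%Z.
Proof.
move=> Mx x0 gx; have [m Em] := val_adjoin_unity Mx x0; exists m; split=> //.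
have z0 : zeta != 0 by rewrite -[zeta]expr1.
have vz1 : v zeta = 0 by rewrite -[zeta]expr1.
have := inert_character pP hv Ig piL0 x0 z0 vz1 g_char; rewrite vpiL => /(_ m Em).
rewrite gx mulfK // => h.
have hzm : zeta ^ (m - t%:Z) = 1.
  apply: (unity_cong1 pP hv rp Pr cop).
    by rewrite exprnP exprz_exp mulrC -exprz_exp -exprnP zl exp1rz.
  rewrite expfzDr // -exprnN -(divff (zt0 t)); by apply: (cong_divr hv (vz t) (zt0 t)); apply: (cong_sym hv).
by rewrite (prim_order_dvdz _ zeta_prim) hzm.
Qed.

Lemma eigres_vge t x : (0 < t < l)%N -> x \in L1 -> aint x -> vge (t%:Z * eL) (eigres t x).
Proof.
case/andP=> t0 tl Lx ax; have [->|n0] := eqVneq (eigres t x) 0; first exact: vge0.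
have [m [Em lm]] := val_g_eigen (eigres_mem t Lx) n0 (eigres_g t Lx).
have : 0 <= v (eigres t x).
  apply: (val_aint hv) => //; apply: aint_sum => j _; apply: integral_mul.
    apply: aint_exp; exact: aint_root_unity (zV t).
  by rewrite -galXx; apply/aint_gal.
rewrite vge_val // Em pmulr_lge0 // ler_pM2r // => m0.
exact: ge_of_dvd_sub tl m0 lm.
Qed.

(** All the terms of the resolvent are congruent to [piL ^+ t] after division by it, so their sum is
    [l * piL ^+ t] to first order, and [l] is a unit at P. *)
Lemma eigres_uniformizer t : (0 < t < l)%N ->
  eigres t (piL ^+ t) != 0 /\ v (eigres t (piL ^+ t)) = t%:Z * eL.
Proof.
move=> tl; have pt0 : piL ^+ t != 0 by rewrite expf_neq0.
have it0 i : iter i g piL != 0 by rewrite -galXx fmorph_eq0.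
have iter_om j : cong (iter j g piL / piL) (zeta ^+ j).
  elim: j => [|j IH] /=; first by rewrite divff // expr0; apply: cong_refl.
  have -> : g (iter j g piL) / piL = g (iter j g piL / piL) * (g piL / piL).
    by rewrite fmorph_div /= mulrA divfK // fmorph_eq0.
  rewrite exprSr; apply: (cong_mul pP hv) => //; first by rewrite -[zeta]expr1.
  apply: (cong_trans pP hv (y := iter j g piL / piL)) => //.
  by apply: (cong_inert pP hv) => //; apply: (cong_vge0 pP hv IH).
have iterX j x n : iter j g (x ^+ n) = (iter j g x) ^+ n by rewrite -!galXx rmorphXn.
have h : cong (eigres t (piL ^+ t) / piL ^+ t) l%:R.
  have -> : l%:R = \sum_(i < l) (1 : E) by rewrite sumr_const card_ord.
  rewrite mulr_suml; apply: (cong_sum pP hv) => j _.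
  rewrite iterX -mulrA -expr_div_n.
  have -> : 1 = (zeta ^+ t)^-1 ^+ j * (zeta ^+ j) ^+ t :> E.
    by rewrite exprVn -!exprM mulnC mulVf.
  apply: (cong_mul pP hv) => //.
  - exact/(vge_exp0 hv)/hu/zV.
  - by rewrite -exprM.
  - exact: cong_refl.
  - exact: (cong_exp pP hv).
have [l0' vl] := val_coprime_nat pP hv rp Pr cop.
have [T0' vT] := cong_val0 pP hv l0' vl h.
have T0 : eigres t (piL ^+ t) != 0 by apply: contraNneq T0' => ->; rewrite mul0r.
split=> //; move: vT; rewrite (val_div hv) // (valX hv) // vpiL mulrC => /eqP.
by rewrite subr_eq0 => /eqP ->.
Qed.

Lemma eigres_galL s m t x : s \in 'Gal({:E} / L1)%g -> s zeta = zeta ^+ m -> x \in L1 ->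
  s (eigres t x) = eigres (m * t) x.
Proof.
move=> /mem_galP sL sz Lx; rewrite rmorph_sum; apply: eq_bigr => j _.
by rewrite rmorphM rmorphXn fmorphV rmorphXn /= sz (sL _ (itL j Lx)) -exprM.
Qed.

Lemma inertia_commute s x : s \in inertia P k1 -> x \in L1 -> s (g x) = g (s x).
Proof.
case/inertiaP => Gs Is Lx.
have Gs' : s^-1%g \in 'Gal({:E} / k1)%g by rewrite groupV.
pose h := (s^-1 * g * s)%g.
have hE y : h y = s (g (s^-1%g y)) by rewrite /h !galMx.
have Gh : h \in 'Gal({:E} / K1)%g.
  apply/mem_galP => y Ky; rewrite hE.
  by move/mem_galP: Gg => -> //; [rewrite galKV|apply: normK].
have [i hi] := g_gen Gh.
have Ih : inert P h.
  move=> y ay; rewrite hE.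
  have -> : s (g (s^-1%g y)) - y = s (g (s^-1%g y) - s^-1%g y).
    by rewrite rmorphB /= galKV.
  by apply: (inert_decomposes pP Is); apply/Ig/aint_gal.
have hpi : cong (h piL / piL) zeta.
  have si0 : s^-1%g piL != 0 by rewrite fmorph_eq0.
  have vsi : v (s^-1%g piL) = 1 * v piL.
    by rewrite mul1r (val_inert pP hv) //; apply: (inertV pP).
  have z0 : zeta != 0 by rewrite -[zeta]expr1.
  have vz1 : v zeta = 0 by rewrite -[zeta]expr1.
  have := inert_character pP hv Ig piL0 si0 z0 vz1 g_char vsi; rewrite expr1z.
  rewrite -(cong_decomposes pP hv _ _ (inert_decomposes pP Is)) fmorph_div /=.
  by rewrite galKV -hE (inert_zeta Is).
(* On L1 the conjugate [h] is [g ^+ i]; its two descriptions on [piL] force [i = 1] modulo [l]. *)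
have iz : zeta ^+ i = zeta.
  have hi' : cong (h piL / piL) (zeta ^+ i).
    rewrite hi //; elim: (i) => [|j IH] /=; first by rewrite divff // expr0; apply: cong_refl.
    have -> : g (iter j g piL) / piL = g (iter j g piL / piL) * (g piL / piL).
      by rewrite fmorph_div /= mulrA divfK // fmorph_eq0.
    rewrite exprSr; apply: (cong_mul pP hv) => //; first by rewrite -[zeta]expr1.
    apply: (cong_trans pP hv (y := iter j g piL / piL)) => //.
    by apply: (cong_inert pP hv) => //; apply: (cong_vge0 pP hv IH).
  have z0 : zeta != 0 by rewrite -[zeta]expr1.
  have vz1 : v zeta = 0 by rewrite -[zeta]expr1.
  apply: (divIf z0); rewrite divff //; apply: (unity_cong1 pP hv rp Pr cop).
    by rewrite expr_div_n zl1 zl divr1.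
  rewrite -(divff z0); apply: (cong_divr hv) => //.
  by apply: (cong_trans pP hv) hpi; apply: (cong_sym hv).
have iE y : y \in L1 -> iter i g y = g y.
  move=> Ly; have e : i = 1 %[mod l].
    by apply/eqP; rewrite -(eq_prim_root_expr zeta_prim) iz expr1.
  have per n y' : y' \in L1 -> iter (n * l) g y' = y'.
    move=> Ly'; elim: n => [|n IH]; rewrite ?mul0n // mulSn iterD IH.
    exact: g_order.
  rewrite (divn_eq i l) e iterD per ?itL // modn_small ?prime_gt1 //.
have := hi (s x) (normL Gs Lx); rewrite hE galVK => ->; apply: iE; exact: normL.
Qed.

Lemma eigres_inert s t x : s \in inertia P k1 -> x \in L1 -> s (eigres t x) = eigres t (s x).
Proof.
move=> Is Lx; have [Gs iP] := elimT (inertiaP _ _ _) Is.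
rewrite rmorph_sum; apply: eq_bigr => j _.
rewrite rmorphM rmorphXn fmorphV rmorphXn /= (inert_zeta iP); congr (_ * _).
by elim: (val j) => //= i <-; rewrite (inertia_commute Is (itL i Lx)).
Qed.

(** The trace of a weak normal integral basis on resolvents. As [b] lies in M O_L and need not be an
    integer, [b_span] replaces its integrality. *)
Variable b : E.
Hypothesis Lb : b \in L1.
Hypothesis b_gen : forall a x, a ^+ l = 1 -> x \in L1 -> aint x ->
  exists c, [/\ c \in C, aint c & resolvent a x = c * resolvent a b].
Hypothesis b_span : forall a, a ^+ l = 1 -> exists n (c y : 'I_n -> E),
  [/\ forall i, c i \in C /\ aint (c i), forall i, y i \in L1 /\ aint (y i)
    & resolvent a b = \sum_i c i * resolvent a (y i)].

Local Notation theta t := (eigres t b).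

(** The valuation is at most that of the resolvent of [piL ^+ t], an integral multiple of [theta t];
    it is at least that since [theta t] is an integral combination of resolvents of integers. *)
Lemma theta_val t : (0 < t < l)%N -> theta t != 0 /\ v (theta t) = t%:Z * eL.
Proof.
move=> tl; have [R0 vR] := eigres_uniformizer tl.
have api : aint (piL ^+ t).
  by apply: aint_exp; apply/int_ring_full/(prime_sub pP).
have [c [_ ac Ec]] := b_gen (zV t) (rpredX t LpiL) api.
rewrite -/(eigres _ _) -/(eigres _ _) in Ec.
have th0 : theta t != 0 by apply: contraNneq R0 => h; rewrite Ec h mulr0.
have c0 : c != 0 by apply: contraNneq R0 => h; rewrite Ec h mul0r.
split=> //; apply/eqP; rewrite eq_le; apply/andP; split.
  by rewrite -vR Ec (valM hv) // ler_wpDl // (val_aint hv).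
rewrite -vge_val //; have [n [d [y [dP yP Eb]]]] := b_span (zV t).
rewrite {1}/eigres Eb.
apply: (vge_sum pP hv) => i _; have [_ ad] := dP i; have [Ly ay] := yP i.
by apply: (vge_mull hv); [apply: (vge_aint hv)|apply: eigres_vge].
Qed.

Definition twist s t := s (theta t) / theta t.

Lemma inertia_adjoin s x : s \in inertia P k1 -> x \in C -> s x \in C.
Proof.
case/inertiaP => Gs Is; apply: gal_adjoin_mem => [y|]; first exact: normK.
by rewrite (inert_zeta Is).
Qed.

(** Applying [s] to the expression of [theta t] by resolvents of integers [y i] gives resolvents of
    the integers [s (y i)], again integral multiples of [theta t]. *)
Lemma twist_aint s t : s \in inertia P k1 -> (0 < t < l)%N -> twist s t \in C /\ aint (twist s t).
Proof.
move=> Is tl; have [th0 _] := theta_val tl; have [Gs _] := elimT (inertiaP _ _ _) Is.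
have [n [d [y [dP yP Eb]]]] := b_span (zV t).
have dual (i : 'I_n) : exists c, [/\ c \in C, aint c & eigres t (s (y i)) = c * theta t].
  by have [Ly ay] := yP i; apply: b_gen => //; [apply: normL|apply/aint_gal].
have [c cP] := boolp.choice dual.
have -> : twist s t = \sum_i s (d i) * c i.
  rewrite /twist {1}/eigres Eb rmorph_sum mulr_suml; apply: eq_bigr => i _.
  rewrite rmorphM /= -/(eigres t (y i)) eigres_inert //; last by case: (yP i).
  by case: (cP i) => _ _ ->; rewrite mulrA mulfK.
split.
  apply: rpred_sum => i _; apply: rpredM; last by case: (cP i).
  by apply: inertia_adjoin => //; case: (dP i).
apply: aint_sum => i _; apply: integral_mul; last by case: (cP i).
by apply/aint_gal; case: (dP i).
Qed.

Lemma twist_neq0 s t : (0 < t < l)%N -> twist s t != 0.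
Proof. by case/theta_val => th0 _; rewrite mulf_neq0 ?invr_eq0 ?fmorph_eq0. Qed.

(** The inverse is the image under [s] of the twist by [s^-1]. *)
Lemma twist_inv_aint s t : s \in inertia P k1 -> (0 < t < l)%N -> aint (twist s t)^-1.
Proof.
move=> Is tl; have [th0 _] := theta_val tl.
have Is' : s^-1%g \in inertia P k1 by rewrite (@groupV _ (inertia_group pP k1)).
have [_ au] := twist_aint Is' tl; have : aint (s (twist s^-1%g t)) by apply/aint_gal.
by rewrite /twist fmorph_div /= galKV invf_div.
Qed.

Lemma twist_galL s sg m t : s \in inertia P k1 -> sg \in 'Gal({:E} / L1)%g ->
  sg zeta = zeta ^+ m -> sg (twist s t) = twist s (m * t).
Proof.
move=> Is Gsg sgz; rewrite /twist fmorph_div /= (eigres_inert t Is Lb) (eigres_inert (m * t) Is Lb).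
have [Gs _] := elimT (inertiaP _ _ _) Is.
by rewrite !(eigres_galL _ Gsg sgz) // normL.
Qed.

Lemma twist_mod s t t' : t = t' %[mod l] -> twist s t = twist s t'.
Proof. by move=> e; rewrite /twist (eigres_mod _ e). Qed.

Variable f : {rmorphism E -> algC}.
Hypothesis K_real : forall s x, x \in K1 -> f (s x) \is Num.real.
Hypothesis cyclotomic : forall m, coprime m l ->
  exists2 sg, sg \in 'Gal({:E} / L1)%g & sg zeta = zeta ^+ m.

(** In every embedding, K1 is real and zeta has absolute value 1, so inverting zeta over K1 is
    complex conjugation. *)
Lemma conj_adjoin sg s x : sg \in 'Gal({:E} / L1)%g -> sg zeta = zeta ^+ l.-1 ->
  x \in C -> f (s (sg x)) = (f (s x))^*.
Proof.
move=> /mem_galP sgL sgz /Fadjoin_polyP[p Kp ->].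
pose h1 : {rmorphism E -> algC} := f \o s \o sg.
pose h2 : {rmorphism E -> algC} := Num.conj \o f \o s.
rewrite -[LHS]/(h1 _) -[RHS]/(h2 _) -!horner_map.
have -> : map_poly h1 p = map_poly h2 p.
  apply/polyP => i; rewrite !coef_map /h1 /h2 /=.
  have Kpi := polyOverP Kp i; rewrite sgL; last exact: (subvP sKL).
  by rewrite conj_Creal // K_real.
congr (_.[_]); rewrite /h1 /h2 /= sgz.
have z1 : `|f (s zeta)| = 1.
  by apply/eqP; rewrite -(@pexpr_eq1 _ _ l) // -normrX -!rmorphXn zl !rmorph1 normr1.
have fz0 : f (s zeta) != 0 by rewrite -normr_eq0 z1 oner_eq0.
apply: (mulfI fz0); rewrite -normCK z1 expr1n !rmorphXn -exprS (prednK l0).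
by rewrite -!rmorphXn zl !rmorph1.
Qed.

Lemma twist_ratio_unity s t : s \in inertia P k1 -> (0 < t < l)%N ->
  exists2 n, (0 < n)%N & (twist s t / twist s (l - t)) ^+ n = 1.
Proof.
move=> Is tl; have tl' := sub_bounds tl.
(* [l.-1] plays the role of -1 modulo [l]; the corresponding automorphism exchanges the indices [t]
   and [l - t]. *)
have cop' : coprime l.-1 l by rewrite coprime_sym coprimenP.
have [sg Gsg sgz] := cyclotomic cop'.
have sgU : sg (twist s t) = twist s (l - t).
  rewrite (twist_galL t Is Gsg sgz); apply: twist_mod.
  exact: pred_mul_mod.
have [Cu au] := twist_aint Is tl.
apply: (@kronecker E f); first by apply: integral_mul => //; apply: twist_inv_aint.
move=> t0; rewrite -sgU 2!fmorph_div /= (conj_adjoin t0 Gsg sgz Cu).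
rewrite normrM normfV norm_conjC divff // normr_eq0 !fmorph_eq0; exact: twist_neq0.
Qed.

Definition quot h := theta h / theta (l - h).
Definition quot_twist s h := twist s h / twist s (l - h).

Section Gamma.

Variable h : nat.
Hypothesis hl : (0 < h < l)%N.
Let hl' := sub_bounds hl.

Lemma quot_neq0 : quot h != 0.
Proof.
by rewrite mulf_neq0 ?invr_eq0 //; [case: (theta_val hl)|case: (theta_val hl')].
Qed.

Lemma quot_val : v (quot h) = (h%:Z - (l - h)%N%:Z) * eL.
Proof.
have [a0 va] := theta_val hl; have [b0 vb] := theta_val hl'.
by rewrite (val_div hv) // va vb mulrBl.
Qed.

Lemma quot_mem : quot h \in M.
Proof. by apply: rpred_div; apply: eigres_mem. Qed.

Lemma quot_g : g (quot h) = zeta ^+ (h + h) * quot h.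
Proof.
have hl1 : (h <= l)%N by case/andP: hl => _ /ltnW.
rewrite /quot fmorph_div /= !eigres_g // -mulf_div exprD; congr (_ * _).
have e : zeta ^+ (l - h) * zeta ^+ h = 1 by rewrite -exprD subnK // zl.
have z0 := zt0 (l - h); apply: (mulIf z0); rewrite divfK //.
by rewrite -mulrA [_ ^+ h * zeta ^+ (l - h)]mulrC e mulr1.
Qed.

Lemma quot_inert s : s (quot h) = quot_twist s h * quot h.
Proof.
have [a0 _] := theta_val hl; have [b0 _] := theta_val hl'.
rewrite /quot_twist /quot /twist fmorph_div /=.
have c0 : s (theta (l - h)) != 0 by rewrite fmorph_eq0.
by field; rewrite a0 b0 c0.
Qed.

Lemma quot_twist_mem s : s \in inertia P k1 -> quot_twist s h \in C.
Proof. by move=> Is; apply: rpred_div; [case: (twist_aint Is hl)|case: (twist_aint Is hl')]. Qed.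

Lemma quot_twist_unity s : s \in inertia P k1 -> exists2 n, (0 < n)%N & quot_twist s h ^+ n = 1.
Proof. by move=> Is; apply: twist_ratio_unity. Qed.

Variables (sg : gal_of {:E}) (m h' : nat).
Hypotheses (Gsg : sg \in 'Gal({:E} / L1)%g) (sgz : sg zeta = zeta ^+ m).
Hypotheses (h'l : (h' <= l)%N) (eh : m * h = h' %[mod l]).

Lemma quot_twist_galL s : s \in inertia P k1 -> sg (quot_twist s h) = quot_twist s h'.
Proof.
move=> Is; have hl1 : (h <= l)%N by case/andP: hl => _ /ltnW.
rewrite /quot_twist fmorph_div /= !(twist_galL _ Is Gsg sgz); congr (_ / _); apply: twist_mod => //.
exact: mul_sub_mod.
Qed.

End Gamma.

Lemma conj_unity_power w n (sg : gal_of {:E}) : (0 < n)%N -> w ^+ n = 1 ->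
  exists j, sg w = w ^+ j.
Proof.
move=> n0 wn; have [m [pm _]] := prim_order_exists n0 wn.
have : sg w ^+ m = 1 by rewrite -rmorphXn (prim_expr_order pm) rmorph1.
by case/(prim_rootP pm) => j ->; exists j.
Qed.

(** The automorphisms [sg] and [sg'] raise zeta to the powers 3 and l - 2, and the root of unity for
    c = 1 to the powers [s3] and [s2]. Their composite leads from c = 1 to c = l - 6, whence the
    product of exponents. *)
Lemma quot_twist_exponents s k : l = k.*2.+1 -> (1 < k)%N -> s \in inertia P k1 ->
  exists s3 s2 : nat, [/\ quot_twist s k.+2 = quot_twist s k.+1 ^+ s3, quot_twist s k.*2 = quot_twist s k.+1 ^+ s2
    & quot_twist s (k.*2 - 2) = quot_twist s k.+1 ^+ (s3 * s2)].
Proof.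
move=> El k1' Is; have [b1 b2 b3 b4] := half_bounds El k1'.
have [e1 e2 e3] := half_congruences El k1'; have [d1 d2] := half_not_dvd El k1'.
have le h : (0 < h < l)%N -> (h <= l)%N by case/andP => _ /ltnW.
have cop3 : coprime 3 l by rewrite coprime_sym prime_coprime.
have cop2 : coprime (k.*2 - 1) l by rewrite coprime_sym prime_coprime.
have [sg Gsg sgz] := cyclotomic cop3; have [sg' Gsg' sgz'] := cyclotomic cop2.
have [n n0 wn] := quot_twist_unity b1 Is.
have [s3 Es3] := conj_unity_power sg n0 wn; have [s2 Es2] := conj_unity_power sg' n0 wn.
have E2 := quot_twist_galL b1 Gsg' sgz' (le _ b3) e2 Is.
exists s3, s2; rewrite -Es3 -Es2 E2; split=> //.
  by rewrite (quot_twist_galL b1 Gsg sgz (le _ b2) e1).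
by rewrite exprM -Es3 -rmorphXn /= -Es2 E2 (quot_twist_galL b3 Gsg sgz (le _ b4) e3).
Qed.

Lemma inertia_exp s n : s \in inertia P k1 -> (s ^+ n)%g \in inertia P k1.
Proof. by move=> Is; apply: (@groupX _ (inertia_group pP k1)). Qed.

Lemma inertia_adjoinL s x : s \in inertia P k1 -> x \in M -> s x \in M.
Proof.
case/inertiaP => Gs Is; apply: gal_adjoin_mem => [y|]; first exact: normL.
by rewrite (inert_zeta Is).
Qed.

(* An inertia automorphism of prime order q on L1(zeta) makes every element it fixes
   have a valuation divisible by q. *)
Lemma fixed_val_dvd q s x (c : int) : prime q -> s \in inertia P k1 ->
  (forall y, y \in M -> iter q s y = y) -> (exists2 y, y \in K1 & s y != y) ->
  x \in M -> x != 0 -> s x = x -> v x = c * eL -> (q%:Z %| c)%Z.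
Proof.
move=> q_prime Is sq [y Ky sy] Mx x0 sx vx; have [_ iP] := elimT (inertiaP _ _ _) Is.
apply: (prime_order_ramified pP hv rp Pr eL0 _ piL0 vpiL _ q_prime iP _ sq _ Mx x0 sx vx).
- exact: LM.
- exact: val_adjoin_unity.
- by move=> u; apply: inertia_adjoinL.
- by exists y => //; apply/CM/(subvP (subv_adjoin K1 zeta)).
Qed.

(** On L1 such an [s] is a power of [g], of order dividing [l], and it fixes zeta. *)
Lemma galXM_adjoin s (n : nat) x : s \in 'Gal({:E} / K1)%g -> inert P s -> x \in M ->
  iter (l * n) s x = x.
Proof.
move=> Gs Is Mx; rewrite -galXx mulnC -[RHS](gal_id {:E}); apply: galM_adjoin Mx.
  move=> y Ly; rewrite gal_id galXx.
  have [i hi] := g_gen Gs; have Gs1 : s \in 'Gal({:E} / k1)%g.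
    by apply: (fintype.subsetP (galS _ skK)).
  have it u : u \in L1 -> iter l s u = u.
    move=> Lu; have -> : iter l s u = iter (l * i) g u.
      elim: (l) => //= j ->; rewrite mulSn iterD; apply: hi; exact: itL.
    by rewrite mulnC; elim: (i) => //= j IH; rewrite mulSn iterD IH g_order.
  by elim: (n) => // j IH; rewrite mulSn iterD IH it.
rewrite gal_id galXx; elim: (n * l)%N => //= j ->; exact: inert_zeta.
Qed.

(* The case q <> l: s^l has order q on L1(zeta), and multiplies quot h, which has
   valuation c = 2h - l, by a root of unity. For c = 1 its order is divisible by q,
   and for the other odd c it is the conjugate w^(s(c)) of the one w for c = 1, with
   s(c) = c modulo q; the relation s(l - 6) = s(3) s(l - 2) then gives q | 2l. *)
Lemma no_resolvent_generator_neq q s : prime q -> odd q -> q != l -> odd l ->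
  s \in inertia P k1 -> (s ^+ q)%g \in 'Gal({:E} / K1)%g ->
  (exists2 y, y \in K1 & s y != y) ->
  (l = 3 -> forall x, x \in C -> ~~ q.-primitive_root x) -> False.
Proof.
move=> q_prime q_odd ql l_odd Is sqK [y Ky sy] l3.
pose rho := (s ^+ l)%g; have Irho : rho \in inertia P k1 by apply: inertia_exp.
have [_ iP] := elimT (inertiaP _ _ _) Is.
have rho_q u : u \in M -> iter q rho u = u.
  move=> Mu; have isq : inert P (s ^+ q)%g.
    by have [_] := elimT (inertiaP _ _ _) (inertia_exp q Is).
  by rewrite -galXx -expgM mulnC expgM galXx -[l]muln1; apply: galXM_adjoin.
have rho_y : rho y != y.
  have s_fix n : (s ^+ n)%g y = y -> forall j, iter (j * n) s y = y.
    by move=> h j; elim: j => // j IH; rewrite mulSn iterD IH -galXx.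
  apply: contra sy => /eqP hl; apply/eqP.
  have hq : (s ^+ q)%g y = y by move/mem_galP: sqK; apply.
  have clq : coprime l q by rewrite prime_coprime // dvdn_prime2 // eq_sym.
  (* As [m * q] is 1 modulo [l], an element fixed by both [s ^+ q] and [s ^+ l] is fixed by [s]. *)
  have [m Em] := inv_mod l_prime clq; rewrite [X in _ = X]modn_small ?prime_gt1 // in Em.
  rewrite -{2}(s_fix q hq m) (divn_eq (m * q) l) Em addn1 /=; congr (s _).
  by rewrite (s_fix l hl).
have dvd x c : x \in M -> x != 0 -> rho x = x -> v x = c * eL -> (q%:Z %| c)%Z.
  by move=> Mx x0 rx; apply: (fixed_val_dvd q_prime Irho rho_q) => //; exists y.
have [k El] : exists k, l = k.*2.+1.
  by exists l./2; rewrite -[in LHS](odd_double_half l) l_odd.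
have k0 : (0 < k)%N by case: (k) El (prime_gt1 l_prime) => // ->.
have [b1 v1] := half_first El k0.
have g0 := quot_neq0 b1; have gM := quot_mem k.+1; have gv := quot_val b1.
rewrite v1 mul1r in gv.
set w := quot_twist rho k.+1; have gw : rho (quot k.+1) = w * quot k.+1 by apply: quot_inert.
have [n0 n0' wn0] := quot_twist_unity b1 Irho; have [n [pn _]] := prim_order_exists n0' wn0.
have n_gt0 := prim_order_gt0 pn.
(* [rho] fixes [quot k.+1 ^+ n], of valuation [n * eL]. *)
have qn : (q %| n)%N.
  have : (q%:Z %| n%:Z)%Z; last by [].
  apply: (dvd (quot k.+1 ^+ n)).
  - exact: rpredX.
  - by rewrite expf_neq0.
  - by rewrite rmorphXn /= gw exprMn (prim_expr_order pn) mul1r.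
  - by rewrite (valX hv) // gv mulrC.
have [k1'|k1'] := ltnP 1 k; last first.
  have l3' : l = 3 by rewrite El; move: k0 k1'; case: (k) => [|[|]].
  (* For l = 3 this power of [w] is a primitive [q]-th root of unity in K(zeta), which [l3]
     excludes. *)
  have wC : w ^+ (n %/ q) \in C by apply: rpredX; apply: quot_twist_mem.
  by have := l3 l3' _ wC; rewrite (dvdn_prim_root pn).
have [s3 [s2 [E3 E2 E6]]] := quot_twist_exponents El k1' Irho.
have [_ b3 b2 b6] := half_bounds El k1'; have [_ v3 v2 v6] := half_values El k1'.
(* The quotient of [quot h] by [quot k.+1 ^+ j] is fixed by [rho] and has valuation
   [(c - j) * eL]. *)
have exps h j (c : int) : (0 < h < l)%N -> h%:Z - (l - h)%N%:Z = c -> quot_twist rho h = w ^+ j ->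
    (q%:Z %| c - j%:Z)%Z.
  move=> bh vh Eh; have gh0 := quot_neq0 bh; have gj0 : quot k.+1 ^+ j != 0 by rewrite expf_neq0.
  apply: (dvd (quot h / quot k.+1 ^+ j)).
  - by apply: rpred_div; [apply: quot_mem|apply: rpredX].
  - by rewrite mulf_neq0 ?invr_eq0.
  - have w0 : w ^+ j != 0.
      by rewrite expf_neq0 // (unity_neq0 n_gt0 (prim_expr_order pn)).
    rewrite fmorph_div [in X in _ / X]rmorphXn /= gw (quot_inert bh) Eh [(w * _) ^+ j]exprMn.
    by rewrite invfM mulrACA divff // mul1r.
  - by rewrite (val_div hv) // (valX hv) // gv (quot_val bh) vh mulrBl [eL * _]mulrC.
have := dvdz_exponents (exps _ _ _ b3 v3 E3) (exps _ _ _ b2 v2 E2) (exps _ _ _ b6 v6 E6).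
rewrite -[2]/(2%N%:Z) -PoszM dvdzE /= Euclid_dvdM // !dvdn_prime2 // (negPf ql) /= => /eqP q2.
by rewrite q2 in q_odd.
Qed.

Lemma commute_adjoin s x : s \in inertia P k1 -> x \in M -> s (g x) = g (s x).
Proof.
move=> Is Mx; rewrite -!galMx; apply: galM_adjoin Mx => [y Ly|].
  by rewrite !galMx; apply: inertia_commute.
by case/inertiaP: Is => _ Is; rewrite !galMx gz inert_zeta // gz.
Qed.

Lemma iter_mem_adjoin i x : x \in M -> iter i g x \in M.
Proof.
move=> Mx; elim: i => //= i; apply: gal_adjoin_mem => [y Ly|]; first exact: gL.
by rewrite gz.
Qed.

Lemma iter_product s m j x : s \in inertia P k1 -> x \in M ->
  iter j (g ^+ m * s)%g x = iter j s (iter (m * j) g x).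
Proof.
move=> Is; have com i u : u \in M -> iter m g (iter i s u) = iter i s (iter m g u).
  elim: i u => //= i IH u Mu; rewrite -IH //.
  have : iter i s u \in M by elim: (i) => //= i'; apply: inertia_adjoinL.
  move: (iter i s u) => y My; elim: (m) => //= m' ->.
  by rewrite commute_adjoin // iter_mem_adjoin.
move=> Mx; elim: j => [|j IH]; first by rewrite muln0.
rewrite iterS IH galMx galXx com; last exact: iter_mem_adjoin.
by rewrite -iterD mulnS.
Qed.

(* The case q = l. If s^l were trivial on L1(zeta), a product of s with a power of g
   would have order l and fix a quotient of resolvents; hence the root of unity by
   which s multiplies the latter has order divisible by l^2, and the congruences of
   the other case hold modulo l^2. *)
Lemma no_resolvent_generator_eq s : odd l ->
  s \in inertia P k1 -> (s ^+ l)%g \in 'Gal({:E} / K1)%g ->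
  (exists2 y, y \in K1 & s y != y) ->
  (l = 3 -> forall x, x \in C -> ~~ l.-primitive_root x) -> False.
Proof.
move=> l_odd Is slK [y Ky sy] l3; have [_ iP] := elimT (inertiaP _ _ _) Is.
have [k El] : exists k, l = k.*2.+1.
  by exists l./2; rewrite -[in LHS](odd_double_half l) l_odd.
have k0 : (0 < k)%N by case: (k) El (prime_gt1 l_prime) => // ->.
have [k1'|k1'] := ltnP 1 k; last first.
  have l3' : l = 3 by rewrite El; move: k0 k1'; case: (k) => [|[|]].
  (* Here q = l = 3, and zeta itself is the excluded root of unity. *)
  by have := l3 l3' _ zC; rewrite zeta_prim.
have [b1 v1] := half_first El k0.
have g0 := quot_neq0 b1; have gM := quot_mem k.+1; have gv := quot_val b1.
rewrite v1 mul1r in gv.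
set w := quot_twist s k.+1; have gw : s (quot k.+1) = w * quot k.+1 by apply: quot_inert.
have [n n_gt0 wn] := quot_twist_unity b1 Is; rewrite -/w in wn.
have w0 : w != 0 by apply: unity_neq0 wn.
(* Raising [w] to the part of [n] prime to [l] leaves a root of unity [W] of [l]-power order; this
   order is prime to [r], so the inert [s] fixes [W]. *)
pose n' := (n`_l^')%N; pose A := (n`_l)%N.
have EnA : n = (n' * A)%N by rewrite mulnC partnC.
have ln' : ~~ (l %| n')%N by rewrite -p'natE ?part_pnat // part_gt0.
pose W := w ^+ n'; have WA : W ^+ A = 1 by rewrite -exprM -EnA.
have copA : coprime r A by rewrite /A p_part coprimeXr.
have A0 : (0 < A)%N by apply: part_gt0.
have W0 : W != 0 by apply: unity_neq0 WA.
have sW : s W = W by apply: (inert_unity pP hv rp Pr copA A0 WA iP).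
pose Gm := quot k.+1 ^+ n'.
have Gm0 : Gm != 0 by rewrite expf_neq0.
have GmM : Gm \in M by apply: rpredX.
have vGm : v Gm = n'%:Z * eL by rewrite (valX hv) // gv mulrC.
have sGm : s Gm = W * Gm by rewrite rmorphXn /= gw [(w * _) ^+ _]exprMn.
have sjGm j : iter j s Gm = W ^+ j * Gm.
  elim: j => [|j IH]; first by rewrite mul1r.
  by rewrite iterS IH rmorphM rmorphXn /= sW sGm mulrA -exprSr.
have gGm j : iter j g Gm = zeta ^+ (n' * j) * Gm.
  have g1 : g Gm = zeta ^+ n' * Gm.
    rewrite rmorphXn /= (quot_g b1) exprMn; congr (_ * _).
    have -> : (k.+1 + k.+1 = l + 1)%N by rewrite El addn1 -addnn addnS addSn.
    by rewrite exprD zl mul1r.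
  elim: j => [|j IH]; first by rewrite muln0 mul1r.
  by rewrite iterS IH rmorphM rmorphXn /= gz g1 mulrA -exprD mulnS addnC.
have isl : inert P (s ^+ l)%g.
  by have [_] := elimT (inertiaP _ _ _) (inertia_exp l Is).
have [i hi] := g_gen slK.
have hiM x : x \in M -> iter l s x = iter i g x.
  move=> Mx; rewrite -!galXx; apply: galM_adjoin Mx => [u Lu|]; first by rewrite hi // galXx.
  rewrite inert_zeta // galXx; elim: (i) => //= j <-; by rewrite gz.
have Wl : W ^+ l = zeta ^+ (n' * i).
  by apply: (mulIf Gm0); rewrite -sjGm -gGm hiM.
have [/dvdnP[i' Ei]|li] := boolP (l %| i)%N.
  have Wl1 : W ^+ l = 1 by rewrite Wl Ei mulnA mulnC exprM zl expr1n.
  have [m Em] := prim_rootP zeta_prim Wl1.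
  have cln' : coprime l n' by rewrite prime_coprime.
  have [c Ec] := inv_mod l_prime cln'.
  (* Here [W = zeta ^+ m], and [g ^+ h] multiplies [Gm] by [zeta ^+ (n' * h)]. As [c] inverts [n']
     modulo [l], this is the inverse of [W], so [g ^+ h * s] fixes [Gm]. Its order on L1(zeta)
     divides [l], so [l] would divide [n']. *)
  pose h := (c * (l - m))%N; pose rho := (g ^+ h * s)%g.
  have Ik1g : g \in inertia P k1 by apply/inertiaP.
  have Irho : rho \in inertia P k1.
    by rewrite (@groupM _ (inertia_group pP k1)) //; apply: inertia_exp.
  have rhoGm : rho Gm = Gm.
    rewrite galMx galXx gGm rmorphM rmorphXn /= (inert_zeta iP) sGm Em mulrA -exprD.
    rewrite -[RHS]mul1r; congr (_ * _); apply/eqP; rewrite -(prim_order_dvd zeta_prim).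
    have := ltn_ord m => /ltnW ml; rewrite /dvdn /h mulnA [(n' * c)%N]mulnC -modnDml.
    by rewrite -modnMml Ec modnMml mul1n modnDml subnK // modnn.
  case/negP: ln'; suff : (l%:Z %| n'%:Z)%Z by [].
  apply: (fixed_val_dvd l_prime Irho _ _ GmM Gm0 rhoGm vGm).
    move=> x Mx; rewrite iter_product // hiM ?iter_mem_adjoin // -iterD.
    by rewrite Ei (mulnC i') (mulnC h) -mulnDr; apply: galXM_adjoin.
  exists y => //; rewrite galMx galXx.
  suff -> : iter h g y = y by [].
  by elim: (h) => //= j ->; move/mem_galP: Gg; apply.
(* [W ^+ l] is a power of zeta and differs from 1, because [l] divides neither [n'] nor [i]; so [W]
   has order exactly [l * l]. *)
have W_ord (e : int) : W ^ e = 1 -> ((l * l)%N%:Z %| e)%Z.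
  have [d pd dvd_d] := prim_order_exists A0 WA => We.
  suff -> : (l * l)%N = d by rewrite (prim_order_dvdz _ pd) We.
  have : (d %| l ^ 2)%N.
    by rewrite (prim_order_dvd pd) expnS expn1 exprM Wl exprAC zl expr1n.
  case/(dvdn_pfactor _ _ l_prime) => j j2 Ed; move: j2; rewrite leq_eqVlt => /orP[/eqP j2|].
    by rewrite Ed j2 expnS expn1.
  rewrite ltnS => j1; case/negP: li.
  have : (d %| l)%N by rewrite Ed -{2}[l]expn1 dvdn_exp2l.
  rewrite (prim_order_dvd pd) Wl -(prim_order_dvd zeta_prim) Euclid_dvdM //.
  by rewrite (negPf ln').
have [s3 [s2 [E3 E2 E6]]] := quot_twist_exponents El k1' Is.
have [_ b3 b2 b6] := half_bounds El k1'; have [_ v3 v2 v6] := half_values El k1'.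
(* Now [quot h / quot k.+1 ^ c] is a unit at P, so the inert [s] multiplies it by something that is
   1 modulo P. This is a power of [w] whose [n']-th power, of [l]-power order, must be 1. *)
have exps h j (c : int) : (0 < h < l)%N -> h%:Z - (l - h)%N%:Z = c -> quot_twist s h = w ^+ j ->
    ((l * l)%N%:Z %| c - j%:Z)%Z.
  move=> bh vh Eh; have gh0 := quot_neq0 bh; have gc0 : quot k.+1 ^ c != 0 by rewrite expfz_neq0.
  pose x := quot h / quot k.+1 ^ c.
  have x0 : x != 0 by rewrite mulf_neq0 ?invr_eq0.
  have vx : v x = 0.
    by rewrite (val_div hv) // (valXz hv) // gv (quot_val bh) vh [eL * _]mulrC subrr.
  have hx : vge 0 x by rewrite vge_val // vx.
  have : cong (s x / x) 1.
    by rewrite -(divff x0); apply: (cong_divr hv) => //; apply: (cong_inert pP hv).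
  have -> : s x / x = w ^ (j%:Z - c).
    rewrite /x fmorph_div /= fmorphXz /= gw (quot_inert bh) Eh expfzMl expfzDr // -exprnP.
    rewrite -invr_expz; have wc0 : w ^ c != 0 by rewrite expfz_neq0.
    by field; rewrite gh0 gc0 wc0.
  move=> /(cong_exp pP hv n' (vge01 hv)); rewrite expr1n exprnP exprz_exp mulrC -exprz_exp.
  rewrite -exprnP -/W => hW; rewrite dvdz_subC; apply: W_ord.
  apply: (unity_cong1 pP hv rp Pr copA) => //.
  by rewrite exprnP exprz_exp mulrC -exprz_exp -exprnP WA exp1rz.
have := dvdz_exponents (exps _ _ _ b3 v3 E3) (exps _ _ _ b2 v2 E2) (exps _ _ _ b6 v6 E6).
rewrite -[2]/(2%N%:Z) -PoszM dvdzE /= dvdn_pmul2l // dvdn_prime2 // => /eqP l2.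
by move: l_odd; rewrite l2.
Qed.

End Resolvents.

(** * Resolvents of a generator *)

Section RamifiedInertia.

Variables (E : splittingFieldType rat) (k1 K1 : {subfield E}).
Variables (P : set E) (v : E -> int) (r : nat).
Hypotheses (pP : is_prime_of {:E}%AS P) (hv : valuation P v).
Hypotheses (rp : prime r) (Pr : P r%:R).
Hypothesis normK : forall s x, s \in 'Gal({:E} / k1)%g -> x \in K1 -> s x \in K1.
Variables (eK : int) (piK : E) (e : nat).
Hypotheses (eK0 : 0 < eK) (KpiK : piK \in K1) (piK0 : piK != 0) (vpiK : v piK = eK).
Hypothesis genk : forall x, x \in k1 -> x != 0 -> exists m, v x = m * (e%:Z * eK).

(** J1 is the part of the inertia group J that is trivial on K1. The norm of [piK] over J / J1 has
    valuation [#|J : J1| * eK], which is also a valuation of an element of k1; so [e] divides the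
    index, and Cauchy's theorem applies to J / J1. *)
Lemma inertia_element (q : nat) : prime q -> (q %| e)%N ->
  exists s, [/\ s \in inertia P k1, (s ^+ q)%g \in 'Gal({:E} / K1)%g
    & exists2 y, y \in K1 & s y != y].
Proof.
move=> q_prime qe; pose J := inertia_group pP k1; pose J1 := (J :&: 'Gal({:E} / K1))%G.
have sJ1 : J1 \subset J by apply: subsetIl.
have J1K s x : s \in J1 -> x \in K1 -> s x = x.
  by case/setIP => _ /mem_galP; apply.
have nJ1 : J \subset 'N(J1)%g.
  apply/fintype.subsetP => s Js; rewrite inE; apply/fintype.subsetP => _ /imsetP[t J1t ->].
  apply/setIP; split; first by rewrite groupJ // (fintype.subsetP sJ1).
  apply/mem_galP => x Kx; have [Gs _] := elimT (inertiaP _ _ _) Js.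
  have Kx' : (s^-1)%g x \in K1 by apply: normK; rewrite ?groupV.
  by rewrite conjgE mulgA !galMx (J1K t) // galKV.
pose N := \prod_(C in rcosets J1 J) (repr C) piK.
have JN s : s \in J -> s N = N.
  move=> Js; apply: (big_rcosets_fixed (op := *%R) (act := fun s x => s x)) => //.
  - by move=> ? ? ?; rewrite galMx.
  - by move=> ? ? ?; rewrite rmorphM.
  - by move=> ?; rewrite rmorph1.
  - by move=> h J1h; apply: J1K.
have N0 : N != 0 by apply/prodf_neq0 => C _; rewrite fmorph_eq0.
have vN : v N = #|J : J1|%g%:Z * eK.
  rewrite (val_prod hv) => [|C _]; last by rewrite fmorph_eq0.
  under eq_bigr => C hC.
    have [/inertiaP[_ Is] _] := rcosets_repr_mem sJ1 hC.
    rewrite (val_inert pP hv) // vpiK; over.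
  by rewrite sumr_const -mulr_natl natz.
have [x [kx x0 vx]] := inertia_field_unramified pP hv rp Pr N0 JN.
have [m Em] := genk kx x0; move: vx; rewrite Em vN mulrA => /(mulIf (lt0r_neq0 eK0)) h.
have q_index : (q %| #|J : J1|%g)%N.
  apply: dvdn_trans qe _; have : (e%:Z %| #|J : J1|%g%:Z)%Z by apply/dvdzP; exists m.
  by [].
rewrite -card_quotient // in q_index.
have [c Jc oc] := Cauchy q_prime q_index.
have [s Ns Js Ec] := morphimP Jc.
exists s; split=> //.
  have : (s ^+ q)%g \in J1.
    rewrite coset_idr ?groupX //; rewrite morphX //= -Ec -oc; exact: expg_order.
  by case/setIP.
apply: contrapT => none; have : s \in J1.
  apply/setIP; split=> //; apply/mem_galP => y Ky.
  by apply/eqP; apply: contrapT => /negP h'; apply: none; exists y.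
move/coset_id => Es; move: oc; rewrite Ec /= Es order1 => q1.
by move: q_prime; rewrite -q1.
Qed.

End RamifiedInertia.

(** The hypothesis on [b] is quantified over [g] and [zeta], because the inert generator of the
    group and the root of unity through which it acts are found only in the proof. *)
Theorem no_resolvent_generator (E : splittingFieldType rat) (f : {rmorphism E -> algC})
    (k1 K1 L1 : {subfield E}) (P : set E) (v : E -> int) (l : nat) (z : E)
    (eL eK : int) (piL piK : E) (e e' : nat) :
  is_prime_of {:E}%AS P -> valuation P v ->
  prime l -> odd l -> l.-primitive_root z -> (k1 <= K1)%VS -> (K1 <= L1)%VS ->
  (forall s x, s \in 'Gal({:E} / k1)%g -> x \in K1 -> s x \in K1) ->
  (forall s x, s \in 'Gal({:E} / k1)%g -> x \in L1 -> s x \in L1) ->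
  (forall s x, s \in 'Gal({:E} / K1)%g -> x \in L1 -> iter l s x = x) ->
  (forall s t, s \in 'Gal({:E} / K1)%g -> t \in 'Gal({:E} / K1)%g ->
    (exists2 x, x \in L1 & s x != x) -> exists i, forall x, x \in L1 -> t x = iter i s x) ->
  (forall (s : gal_of {:E}) x, x \in K1 -> f (s x) \is Num.real) ->
  (forall m, coprime m l -> exists2 s, s \in 'Gal({:E} / L1)%g & s z = z ^+ m) ->
  0 < eL -> piL \in L1 -> P piL -> piL != 0 -> v piL = eL ->
  (forall x, x \in L1 -> x != 0 -> exists m, v x = m * eL) ->
  piK \in K1 -> piK != 0 -> v piK = eK ->
  (forall x, x \in K1 -> x != 0 -> exists m, v x = m * eK) ->
  eK = e'%:Z * eL -> (1 < e')%N -> (forall r, prime r -> P r%:R -> ~~ (r %| e')%N) ->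
  (forall x, x \in k1 -> x != 0 -> exists m, v x = m * (e%:Z * eK)) ->
  (exists q, [/\ prime q, odd q, (q %| e)%N &
    l = 3 -> forall x, x \in <<K1; z>>%VS -> ~~ q.-primitive_root x]) ->
  (exists b, b \in L1 /\ forall g, g \in 'Gal({:E} / K1)%g ->
     (exists2 x, x \in L1 & g x != x) -> forall zeta a, l.-primitive_root zeta -> a ^+ l = 1 ->
     (forall x, x \in L1 -> aint x -> exists c,
        [/\ c \in <<K1; zeta>>%VS, aint c & resolvent l g a x = c * resolvent l g a b]) /\
     exists n (c y : 'I_n -> E),
       [/\ forall i, c i \in <<K1; zeta>>%VS /\ aint (c i),
           forall i, y i \in L1 /\ aint (y i)
         & resolvent l g a b = \sum_i c i * resolvent l g a (y i)]) -> False.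
Proof.
move=> pP hv l_prime l_odd z_prim skK sKL normK normL galL_order galL_cyclic K_real cyc
  eL0 LpiL PpiL piL0 vpiL genL KpiK piK0 vpiK genK eKE e'1 tameL genk [q [q_prime q_odd qe l3]]
  [b [Lb bP]].
have [r rp Pr] := prime_nat pP.
have eK0 : 0 < eK by rewrite eKE mulr_gt0 // ltz_nat ltnW.
have galL_mem s x : s \in 'Gal({:E} / K1)%g -> x \in L1 -> s x \in L1.
  by move=> Gs; apply: normL; apply: (fintype.subsetP (galS _ skK)).
have [g Ig g_nontriv] := inert_nontrivial pP hv rp Pr eL0 LpiL piL0 vpiL genK eKE e'1.
have [Gg gP] := elimT (inertiaP _ _ _) Ig.
have cop := coprime_rl pP hv rp l_prime galL_mem galL_order galL_cyclic eL0 LpiL piL0 vpiL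
  genK eKE e'1 (tameL r rp Pr) Ig g_nontriv.
have [zeta [i [Ez zeta_prim g_char]]] := tame_character pP hv rp Pr l_prime z_prim galL_mem galL_order galL_cyclic eL0 LpiL
  piL0 vpiL genK eKE e'1 (tameL r rp Pr) Ig g_nontriv.
have cyc' m : coprime m l -> exists2 s, s \in 'Gal({:E} / L1)%g & s zeta = zeta ^+ m.
  move=> cml; have [s Gs sz] := cyc m cml; exists s => //.
  by rewrite Ez rmorphXn /= sz exprAC.
have sub x : x \in <<K1; zeta>>%VS -> x \in <<K1; z>>%VS.
  apply: subvP; apply/FadjoinP; split; first exact: subv_adjoin.
  by rewrite Ez rpredX // memv_adjoin.
have g_ord := galL_order g; have g_gen t (Gt : t \in 'Gal({:E} / K1)%g) := galL_cyclic g t Gg Gt g_nontriv.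
have b_gen a x (a1 : a ^+ l = 1) := (bP g Gg g_nontriv zeta a zeta_prim a1).1 x.
have b_span a (a1 : a ^+ l = 1) := (bP g Gg g_nontriv zeta a zeta_prim a1).2.
have [s [Is sqK ex_y]] := inertia_element pP hv rp Pr normK eK0 KpiK piK0 vpiK genk q_prime qe.
have l3x : l = 3 -> forall x, x \in <<K1; zeta>>%VS -> ~~ q.-primitive_root x.
  by move=> l_eq3 x /sub; apply: l3.
have [ql|ql] := eqVneq q l.
  rewrite ql in sqK l3x.
  have h := (no_resolvent_generator_eq pP hv rp Pr l_prime zeta_prim cop skK sKL normK normL
    Gg gP (fun x => g_ord x Gg) g_gen eL0 LpiL PpiL piL0 vpiL genL g_char Lb b_gen b_span K_real cyc'
    l_odd Is sqK ex_y).
  by apply: h; apply: l3x.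

apply: (no_resolvent_generator_neq pP hv rp Pr l_prime zeta_prim cop skK sKL normK normL
    Gg gP (fun x => g_ord x Gg) g_gen eL0 LpiL PpiL piL0 vpiL genL g_char Lb b_gen b_span K_real cyc'
    q_prime q_odd ql l_odd Is sqK ex_y l3x).
Qed.

(** * Weak normal integral bases *)

Section ResolventShift.

Variables (E : splittingFieldType rat) (l : nat) (g : gal_of {:E}) (a : E).
Hypotheses (l0 : (0 < l)%N) (al : a ^+ l = 1).

Lemma resolvent_sum (I : finType) (F : I -> E) :
  resolvent l g a (\sum_i F i) = \sum_i resolvent l g a (F i).
Proof.
rewrite exchange_big; apply: eq_bigr => j _; rewrite -mulr_sumr; congr (_ * _).
by elim: (j : nat) => //= n ->; rewrite rmorph_sum.
Qed.

Lemma resolvent_fixed c x : g c = c -> resolvent l g a (c * x) = c * resolvent l g a x.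
Proof.
move=> gc; rewrite mulr_sumr; apply: eq_bigr => j _; rewrite mulrCA; congr (_ * _).
by elim: (j : nat) => //= n ->; rewrite rmorphM /= gc.
Qed.

Lemma resolvent_shift x : iter l g x = x -> resolvent l g a x = a * resolvent l g a (g x).
Proof.
move=> gx; rewrite /resolvent -(prednK l0) big_ord_recl big_ord_recr /= mulrDr addrC.
congr (_ + _).
  rewrite mulr_sumr; apply: eq_bigr => j _; rewrite mulrA -exprS; congr (_ * _).
  by rewrite -iterS iterSr.
by rewrite mulrA -exprS -iterSr prednK // al gx.
Qed.

Lemma resolvent_iter i x : iter l g x = x ->
  resolvent l g a x = a ^+ i * resolvent l g a (iter i g x).
Proof.
move=> gx; elim: i => [|i IH]; first by rewrite mul1r.
rewrite IH exprSr -mulrA iterS -resolvent_shift //.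
by rewrite -iterD addnC iterD gx.
Qed.

End ResolventShift.

Section Orders.

Variables (gT : finGroupType) (F : fieldType) (O : set F) (M : set (galg gT F)).
Hypothesis Mord : is_order O M.

Lemma galg_scaleA (c d : F) (a : galg gT F) :
  galg_scale c (galg_scale d a) = galg_scale (c * d) a.
Proof. by apply/ffunP => g; rewrite !ffunE mulrA. Qed.

Lemma galg_scale_sum (I : finType) (c : F) (a : I -> galg gT F) :
  galg_scale c (\sum_i a i) = \sum_i galg_scale c (a i).
Proof.
apply/ffunP => g; rewrite !ffunE !sum_ffunE mulr_sumr.
by apply: eq_bigr => i _; rewrite ffunE.
Qed.

Lemma order0 : M 0.
Proof. by case: Mord => M1 MB _ _; rewrite -(subrr (galg_one gT F)); case: (MB _ _ M1 M1). Qed.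

Lemma orderD a b : M a -> M b -> M (a + b).
Proof.
case: Mord => _ MB _ _ Ma Mb; rewrite -[b]opprK; apply: (MB _ _ _ _).1 => //.
by rewrite -sub0r; apply: (MB _ _ order0 Mb).1.
Qed.

Lemma order_sum (I : Type) (r : seq I) (a : I -> galg gT F) :
  (forall i, M (a i)) -> M (\sum_(i <- r) a i).
Proof. by move=> Ma; elim/big_ind: _ => //; [apply: order0|apply: orderD]. Qed.

Lemma order_scale (mulO : forall x y, O x -> O y -> O (x * y)) c a :
  O c -> M a -> M (galg_scale c a).
Proof.
case: Mord => _ _ [n [e eP]] _ Oc /eP[d Od ->]; apply/eP.
exists (fun i => c * d i); first by move=> i; apply: mulO.
by rewrite galg_scale_sum; apply: eq_bigr => i _; rewrite galg_scaleA.
Qed.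

Lemma order_multiple (mulO : forall x y, O x -> O y -> O (x * y))
    (natO : forall n, O n%:R) :
  (forall x, exists2 d, (0 < d)%N & O (x * d%:R)) ->
  forall a, exists2 d, (0 < d)%N & M (galg_scale d%:R a).
Proof.
move=> denO a; have [_ _ _ /(_ a)[n [c [e [Me ->]]]]] := Mord.
have /choice[d dP] i : exists d, (0 < d)%N /\ O (c i * d%:R).
  by have [d d0 Od] := denO (c i); exists d.
exists (\prod_i d i)%N; first by rewrite prodn_gt0 // => i; case: (dP i).
rewrite galg_scale_sum; apply: order_sum => i; rewrite galg_scaleA.
apply: order_scale => //; rewrite (bigD1 i) //= natrM mulrC mulrA.
by apply: mulO => //; case: (dP i).
Qed.

End Orders.

Section WeakNIB.

Variables (F0 : fieldType) (L : splittingFieldType F0) (K : {subfield L}).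
Variables (E : splittingFieldType rat) (emb : {rmorphism L -> E}).

Notation O_K := (vsval @^-1` int_ring K)%classic.
Notation G := (subg_of 'Gal({:L} / K)).

Lemma int_scaled (x : L) : exists2 d, (0 < d)%N & aint (x * d%:R).
Proof.
have [d d0 Ed] := aint_scaled (emb x); exists d => //.
by apply/(aint_rmorph emb); rewrite rmorphM rmorph_nat.
Qed.

Lemma natL_eq0 n : (n%:R == 0 :> L) = (n == 0)%N.
Proof. by rewrite -(fmorph_eq0 emb) rmorph_nat extQ_natr_eq0. Qed.

Lemma O_K_mul (x y : subvs_of K) : O_K x -> O_K y -> O_K (x * y).
Proof.
by move=> [Kx ix] [Ky iy]; split; rewrite /= ?rpredM // ; apply: integral_mul.
Qed.

Lemma O_K_nat n : O_K (n%:R : subvs_of K).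
Proof. by split; [apply: subvsP|rewrite rmorph_nat pmulrn; apply: aint_int]. Qed.

Lemma O_K_den (x : subvs_of K) : exists2 d, (0 < d)%N & O_K (x * d%:R).
Proof.
have [d d0 hd] := int_scaled (vsval x); exists d => //; split; first exact: subvsP.
by rewrite rmorphM rmorph_nat.
Qed.

Lemma galg_act0 x : galg_act (0 : galgK K) x = 0.
Proof. by apply: big1 => g _; rewrite ffunE rmorph0 mul0r. Qed.

Lemma galg_act1 x : galg_act (galg_one _ _ : galgK K) x = x.
Proof.
rewrite /galg_act (bigD1 1%g) //= big1 => [|g g1]; last first.
  by rewrite ffunE (negPf g1) rmorph0 mul0r.
by rewrite ffunE eqxx rmorph1 mul1r addr0 gal_id.
Qed.

Lemma galg_act_const (c : subvs_of K) x :
  galg_act ([ffun=> c] : galgK K) x = vsval c * \sum_(g : G) sgval g x.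
Proof. by rewrite mulr_sumr; apply: eq_bigr => g _; rewrite ffunE. Qed.

Hypothesis galLK : galois K {:L}.

Lemma galg_trace x : exists T : subvs_of K, vsval T = \sum_(g : G) sgval g x.
Proof.
suff KT : \sum_(g : G) sgval g x \in K by exists (Subvs KT).
have -> : \sum_(g : G) sgval g x = galTrace K {:L} x.
  rewrite /galTrace [RHS](reindex_onto (fun g : G => sgval g) (fun g => subg _ g)) => [|g Gg]; last exact: subgK.
  by apply: eq_bigl => g; rewrite sgvalK eqxx subgP.
by apply: mem_galTrace => //; apply: memvf.
Qed.

Lemma galg_act_scale (c : subvs_of K) (a : galgK K) x :
  galg_act (galg_scale c a : galgK K) x = vsval c * galg_act a x.
Proof.
by rewrite mulr_sumr; apply: eq_bigr => g _; rewrite ffunE rmorphM mulrA.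
Qed.

(* If b_0 and b_1 are two elements of a basis, with traces T_0 and T_1, then
   (T_1 N) b_0 - (T_0 N) b_1 = 0 for the sum N of the elements of the group. *)
Lemma weak_NIB_generator : has_weak_NIB K ->
  exists (M : set (galgK K)) b, [/\ is_order O_K M, module_generated M (int_ring {:L}%AS) b
    & forall x, module_generated M (int_ring {:L}%AS) x -> exists2 a, M a & x = galg_act a b].
Proof.
case=> M [[Mord _] [n [b [Nb gen free]]]].
have [M1 MB _ _] := Mord.
have N1 : module_generated M (int_ring {:L}%AS) 1.
  exists 1, (fun=> galg_one _ _), (fun=> 1); split=> //.
    by move=> _; split; [apply: memvf|apply: (aint_int L 1)].
  by rewrite big_ord1 galg_act1.
have M0 := order0 Mord.
case: n b Nb gen free => [|[|n]] b Nb gen free.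
- have [a _ /eqP] := gen _ N1.
  by rewrite big_ord0 oner_eq0.
- exists M, (b ord0); split=> // x /gen[a Ma ->].
  by exists (a ord0) => //; rewrite big_ord1.
have [T0 ET0] := galg_trace (b ord0); have [T1 ET1] := galg_trace (b (lift ord0 ord0)).
pose single2 (c0 c1 : galgK K) (i : 'I_n.+2) : galgK K :=
  if i == ord0 then c0 else if i == lift ord0 ord0 then c1 else 0.
have free2 c0 c1 : M c0 -> M c1 ->
    galg_act c0 (b ord0) + galg_act c1 (b (lift ord0 ord0)) = 0 -> c0 = 0 /\ c1 = 0.
  move=> Mc0 Mc1 e0; have Ms i : M (single2 c0 c1 i) by rewrite /single2; do 2?case: ifP.
  suff e : \sum_i galg_act (single2 c0 c1 i) (b i) = 0.
    by have z := free _ Ms e; split; [apply: (z ord0)|apply: (z (lift ord0 ord0))].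
  rewrite !big_ord_recl /single2 /= big1 ?addr0 // => i _; exact: galg_act0.
have natK m : (0 < m)%N -> (m%:R : subvs_of K) != 0.
  by move=> m0; rewrite -(fmorph_eq0 (vsval : subvs_of K -> L)) rmorph_nat natL_eq0 -lt0n.
have scale_const m (c : subvs_of K) : (0 < m)%N ->
    galg_scale m%:R ([ffun=> c] : galgK K) = 0 -> c = 0.
  move=> m0 /ffunP/(_ 1%g); rewrite !ffunE => /eqP.
  by rewrite mulf_eq0 (negPf (natK m m0)) => /eqP.
have den := order_multiple Mord O_K_mul O_K_nat O_K_den.
(* Multiples of T_1 N and - T_0 N lie in M, which spans the group algebra; freeness gives T_0 =
   0. *)
have [d0 d0_gt0 Md0] := den [ffun=> T1]; have [d1 d1_gt0 Md1] := den [ffun=> - T0].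
have T0_eq0 : T0 = 0.
  have Ma := order_scale Mord O_K_mul (O_K_nat d1) Md0.
  have Mb := order_scale Mord O_K_mul (O_K_nat d0) Md1.
  rewrite !galg_scaleA -!natrM in Ma Mb; rewrite mulnC in Mb.
  have [|_ /scale_const] := free2 _ _ Ma Mb.
    by rewrite !galg_act_scale !galg_act_const -ET0 -ET1 rmorphN; ring.
  by rewrite muln_gt0 d0_gt0 d1_gt0 => /(_ isT) /eqP; rewrite oppr_eq0 => /eqP.
(* Now N itself kills b_0, against freeness. *)
have [d d_gt0 Md] := den [ffun=> 1].
have [|/scale_const] := free2 _ _ Md M0.
  by rewrite galg_act0 galg_act_scale galg_act_const -ET0 T0_eq0 rmorph0 !mulr0 addr0.
by move=> /(_ d_gt0)/eqP; rewrite oner_eq0.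
Qed.

Section Evaluation.

Variables (l : nat) (t0 : gal_of {:L}) (a : E).
Hypotheses (l_prime : prime l) (al : a ^+ l = 1).
Hypotheses (cardG : #|'Gal({:L} / K)%g| = l) (Gt0 : t0 \in 'Gal({:L} / K)%g) (t01 : t0 != 1%g).

Let l0 : (0 < l)%N. Proof. exact: prime_gt0. Qed.

Let cycle_t0 : <[t0]>%g = 'Gal({:L} / K)%g.
Proof.
have pG : prime #|'Gal({:L} / K)%g| by rewrite cardG.
by rewrite [in RHS](nt_gen_prime pG (x := t0)) // !inE t01.
Qed.

Lemma gal_index_exists (g : G) : exists i, sgval g = (t0 ^+ i)%g.
Proof.
have : sgval g \in <[t0]>%g.
  by rewrite cycle_t0 subgP.
by case/cyclePmin => i _ ->; exists i.
Qed.

Definition gal_index g : nat := projT1 (cid (gal_index_exists g)).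

Lemma gal_indexP g : sgval g = (t0 ^+ gal_index g)%g.
Proof. exact: projT2 (cid (gal_index_exists g)). Qed.

(** The inverse, because by [resolvent_iter] applying [g ^+ i] to [x] multiplies its resolvent by
    [a^-1 ^+ i]. *)
Definition gal_char g : E := a^-1 ^+ gal_index g.

Lemma gal_char_eq g i : sgval g = (t0 ^+ i)%g -> gal_char g = a^-1 ^+ i.
Proof.
rewrite gal_indexP => /eqP; rewrite eq_expg_mod_order => /eqP e.
have a1 : a^-1 ^+ l = 1 by rewrite exprVn al invr1.
have ord : #[t0]%g = l by rewrite /order cycle_t0.
by rewrite /gal_char -(expr_mod _ a1) -ord e ord (expr_mod _ a1).
Qed.

Lemma gal_charM g h : gal_char (g * h)%g = gal_char g * gal_char h.
Proof.
rewrite -exprD; apply: gal_char_eq.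
by rewrite expgD -!gal_indexP morphM ?inE.
Qed.

(** The character extended to a ring morphism on K[G]; by [resolvent_act], it is the factor by which
    [c] multiplies resolvents. *)
Definition galg_ev (c : galgK K) : E := \sum_(g : G) emb (vsval (c g)) * gal_char g.

Lemma galg_ev1 : galg_ev (galg_one _ _) = 1.
Proof.
rewrite /galg_ev (bigD1 1%g) //= big1 => [|g g1]; last first.
  by rewrite ffunE (negPf g1) !rmorph0 mul0r.
by rewrite ffunE eqxx !rmorph1 mul1r addr0 (@gal_char_eq _ 0) ?morph1.
Qed.

Lemma galg_evM (c d : galgK K) : galg_ev (galg_mul c d) = galg_ev c * galg_ev d.
Proof.
rewrite [RHS]mulr_suml {1}/galg_ev; under eq_bigr => g _ do rewrite ffunE !rmorph_sum mulr_suml.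
rewrite exchange_big; apply: eq_bigr => h _ /=.
rewrite mulr_sumr (reindex_inj (mulgI h)); apply: eq_bigr => g _ /=.
by rewrite mulKg gal_charM !rmorphM /= mulrACA.
Qed.

Lemma galg_ev_comb n (c : 'I_n -> subvs_of K) (e : 'I_n -> galgK K) :
  galg_ev (\sum_i galg_scale (c i) (e i)) = \sum_i emb (vsval (c i)) * galg_ev (e i).
Proof.
rewrite /galg_ev; under eq_bigr => g _ do rewrite sum_ffunE !rmorph_sum mulr_suml.
rewrite exchange_big; apply: eq_bigr => i _; rewrite mulr_sumr.
by apply: eq_bigr => g _; rewrite ffunE !rmorphM mulrA.
Qed.

(* The powers of an element of the order lie in a module that is finitely
   generated over O_K, so that their values have bounded denominators. *)
Lemma galg_ev_int M c : is_order O_K M -> M c -> aint (galg_ev c).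
Proof.
move=> Mord Mc; have [M1 MB [n [e eP]] _] := Mord.
have /choice[d dP] i : exists d, (0 < d)%N /\ aint (galg_ev (e i) * d%:R).
  by have [d d0 hd] := aint_scaled (galg_ev (e i)); exists d.
apply: (@aint_of_bounded_powers _ (\prod_i d i)%N) => [|m].
  by rewrite prodn_gt0 // => i; case: (dP i).
have [c' Mc' <-] : exists2 c', M c' & galg_ev c' = galg_ev c ^+ m.
  elim: m => [|m [c' Mc' E']]; first by exists (galg_one _ _); rewrite ?galg_ev1.
  by exists (galg_mul c c'); [case: (MB _ _ Mc Mc')|rewrite galg_evM E' exprS].
have [u Ou ->] := proj1 (eP c') Mc'.
rewrite galg_ev_comb mulr_suml; apply: aint_sum => i _.
rewrite (bigD1 i) //= natrM -mulrA [X in _ * X]mulrA; apply: integral_mul.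
  by apply/(aint_rmorph emb); case: (Ou i).
apply: integral_mul; first by case: (dP i).
by rewrite pmulrn; apply: aint_int.
Qed.

Variable g : gal_of {:E}.
Hypothesis gt : forall x, emb (t0 x) = g (emb x).

Lemma resolvent_act (c : galgK K) x :
  resolvent l g a (emb (galg_act c x)) = galg_ev c * resolvent l g a (emb x).
Proof.
have it i y : emb ((t0 ^+ i)%g y) = iter i g (emb y).
  elim: i y => [|i IH] y; first by rewrite gal_id.
  by rewrite expgSr galM ?memvf // gt IH.
have itl y : iter l g (emb y) = emb y.
  by rewrite -it -cardG expg_cardG ?gal_id.
rewrite rmorph_sum resolvent_sum mulr_suml; apply: eq_bigr => h _.
rewrite rmorphM /= resolvent_fixed; last first.
  by rewrite -gt (fixed_gal (subvf _) Gt0) // subvsP.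
rewrite -mulrA; congr (_ * _); rewrite gal_indexP it /gal_char.
rewrite [in RHS](@resolvent_iter _ _ _ _ l0 al (gal_index h)) // mulrA -exprMn.
have a0 := unity_neq0 l0 al.
by rewrite mulVf // expr1n mul1r.
Qed.

End Evaluation.

Variables (K1 L1 : {subfield E}) (l : nat).
Hypotheses (l_prime : prime l) (cardG : #|'Gal({:L} / K)%g| = l).
Hypothesis imL : forall y, y \in L1 <-> exists x, y = emb x.
Hypothesis imK : forall x, x \in K -> emb x \in K1.
Hypothesis res : forall g, g \in 'Gal({:E} / K1)%g ->
  exists2 t, t \in 'Gal({:L} / K)%g & forall x, emb (t x) = g (emb x).

(** Both properties result from evaluating M at the character attached to [a], with integral values
    in K(zeta): the first from M O_L being contained in M b, the second from b being in M O_L. *)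
Theorem weak_NIB_resolvents : has_weak_NIB K ->
  exists b, b \in L1 /\ forall g, g \in 'Gal({:E} / K1)%g ->
    (exists2 x, x \in L1 & g x != x) -> forall zeta a, l.-primitive_root zeta -> a ^+ l = 1 ->
    (forall x, x \in L1 -> aint x -> exists c,
       [/\ c \in <<K1; zeta>>%VS, aint c & resolvent l g a x = c * resolvent l g a b]) /\
    exists n (c y : 'I_n -> E),
      [/\ forall i, c i \in <<K1; zeta>>%VS /\ aint (c i),
          forall i, y i \in L1 /\ aint (y i)
        & resolvent l g a b = \sum_i c i * resolvent l g a (y i)].
Proof.
move=> /weak_NIB_generator[M [b [Mord Nb gen]]]; exists (emb b).
split=> [|g Gg [x Lx gx] zeta a zeta_prim al]; first by apply/imL; exists b.
have [t Gt gt] := res Gg.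
have t1 : t != 1%g.
  by apply: contraNneq gx => t1; have [y ->] := proj1 (imL x) Lx; rewrite -gt t1 gal_id.
pose ev := galg_ev a l_prime cardG Gt t1.
have ev_mem c : ev c \in <<K1; zeta>>%VS.
  have [i Ea] := prim_rootP zeta_prim al.
  apply: rpred_sum => h _; apply: rpredM; first by apply: subvP_adjoin; apply/imK/subvsP.
  by rewrite Ea rpredX // rpredV rpredX // memv_adjoin.
have [M1 _ _ _] := Mord.
split=> [_ /imL[y ->] /(aint_rmorph emb) iy|].
  have [|c Mc ->] := gen y.
    exists 1, (fun=> galg_one _ _), (fun=> y); split=> //.
      by move=> _; split=> //; apply: memvf.
    by rewrite big_ord1 galg_act1.
  exists (ev c); split; first exact: ev_mem.
    exact: galg_ev_int Mord Mc.
  exact: resolvent_act.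
have [n [c [y [Mc Oy ->]]]] := Nb.
exists n, (fun i => ev (c i)), (fun i => emb (y i)); split.
- by move=> i; split; [apply: ev_mem|apply: galg_ev_int Mord (Mc i)].
- by move=> i; case: (Oy i) => _ iy; split; [apply/imL; exists (y i)|apply/(aint_rmorph emb)].
- by rewrite rmorph_sum resolvent_sum; apply: eq_bigr => i _; apply: resolvent_act.
Qed.

End WeakNIB.

(** * Embedding in a Galois extension of the rationals *)

Lemma rat_minpolys_split (s : seq algC) : exists p : {poly rat}, exists r : seq algC,
  [/\ map_poly ratr p = \prod_(u <- r) ('X - u%:P) & {subset s <= r}].
Proof.
elim: s => [|u s [p [r [Ep sub]]]].
  by exists 1, [::]; split=> //; rewrite big_nil rmorph1.
have [q [Eq _] _] := minCpolyP u.
have [t Et] := closed_field_poly_normal (minCpoly u).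
rewrite (monicP (minCpoly_monic u)) scale1r in Et.
have ut : u \in t by rewrite -root_prod_XsubC -Et root_minCpoly.
exists (q * p), (t ++ r); split; first by rewrite rmorphM /= -Eq Ep big_cat Et.
by move=> w; rewrite inE mem_cat => /predU1P[->|/sub->]; rewrite ?ut ?orbT.
Qed.

Lemma splitting_num_field (s : seq algC) : exists (E : splittingFieldType rat)
  (f : {rmorphism E -> algC}), forall u, u \in s -> exists x, f x = u.
Proof.
have [p [r [Ep sub]]] := rat_minpolys_split s.
(* The field is generated by all the conjugates in [r], hence splits [p]. *)
have [Qs [QsC [r1 Er1 gen]]] := num_field_exists r.
have split_p : SplittingField.axiom Qs.
  exists (map_poly (in_alg Qs) p).
    by apply/polyOver1P; exists p.
  exists r1 => //; apply/eqpW/(map_poly_inj QsC).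
  rewrite rmorph_prod; under [RHS]eq_bigr => x _ do rewrite rmorphB /= map_polyX map_polyC.
  rewrite -(big_map QsC xpredT (fun u => 'X - u%:P)) Er1 -Ep -map_poly_comp.
  by apply: eq_map_poly => c /=; rewrite alg_num_field fmorph_rat.
pose QsMixin := FieldExt_isSplittingField.Build _ Qs split_p.
exists (HB.pack Qs QsMixin : splittingFieldType rat).
exists QsC => u /sub; rewrite -Er1 => /mapP[x _ ->]; by exists x.
Qed.

Lemma galois_embedding (L : fieldExtType rat) (iota : {rmorphism L -> algC}) (s : seq algC) :
  exists (E : splittingFieldType rat) (f : {rmorphism E -> algC}) (emb : {rmorphism L -> E}),
    (forall x, f (emb x) = iota x) /\ forall u, u \in s -> exists x, f x = u.
Proof.
have [E [f fP]] := splitting_num_field (map iota (vbasis {:L}) ++ s).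
have emb_ex x : exists y, f y = iota x.
  have /choice[y Ey] (i : 'I_(\dim {:L})) : exists y, f y = iota (vbasis {:L})`_i.
    by apply: fP; rewrite mem_cat map_f // mem_nth // size_tuple.
  exists (\sum_i coord (vbasis {:L}) i x *: y i).
  rewrite {2}(coord_vbasis (memvf x)) !rmorph_sum; apply: eq_bigr => i _ /=.
  by rewrite !rmorphZ_num Ey.
have [emb Eemb] := choice emb_ex.
have embB : zmod_morphism emb.
  by move=> x y; apply: (fmorph_inj f); rewrite rmorphB !Eemb rmorphB.
have embM : monoid_morphism emb.
  by split=> [|x y]; apply: (fmorph_inj f); rewrite ?(rmorphM, rmorph1) !Eemb ?(rmorphM, rmorph1).
pose embR : {rmorphism L -> E} := HB.pack emb
  (GRing.isZmodMorphism.Build _ _ _ embB) (GRing.isMonoidMorphism.Build _ _ _ embM).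
exists E, f, embR; split=> // u us; apply: fP.
by rewrite mem_cat us orbT.
Qed.

Lemma image_subfield (L E : fieldExtType rat) (emb : {rmorphism L -> E}) (F : {subfield L}) :
  exists F1 : {subfield E}, forall y, y \in F1 <-> exists2 x, x \in F & y = emb x.
Proof.
pose embS := GRing.isScalable.Build _ _ _ _ _ (fmorph_numZ emb).
pose embL : {linear L -> E} := HB.pack (GRing.RMorphism.sort emb) embS.
pose V := (linfun embL @: F)%VS.
have VP y : y \in V <-> exists2 x, x \in F & y = emb x.
  split=> [/memv_imgP[x Fx ->]|[x Fx ->]]; first by exists x; rewrite // lfunE.
  by apply/memv_imgP; exists x; rewrite // lfunE.
have V1 : (1 <= V)%VS.
  by rewrite -memvE; apply/VP; exists 1; rewrite ?rmorph1 ?rpred1.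
have VM : (V * V <= V)%VS.
  apply/prodvP => _ _ /VP[x Fx ->] /VP[y Fy ->]; apply/VP.
  by exists (x * y); rewrite ?rmorphM ?rpredM.
(* V is already closed under products; [agenv] only provides the structure of subfield. *)
exists (agenv V)%AS => y; rewrite -VP.
by split; apply: subvP; rewrite ?sub_agenv // agenv_sub_modl.
Qed.

Lemma galois_embedding_tower (k : fieldExtType rat) (L : fieldExtType k)
    (iota : {rmorphism L -> algC}) (s : seq algC) :
  exists (E : splittingFieldType rat) (f : {rmorphism E -> algC}) (emb : {rmorphism L -> E}),
    (forall x, f (emb x) = iota x) /\ forall u, u \in s -> exists x, f x = u.
Proof.
exact: (@galois_embedding (baseFieldType L) iota s).
Qed.

Lemma image_subfield_tower (k : fieldExtType rat) (L : fieldExtType k) (E : fieldExtType rat)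
    (emb : {rmorphism L -> E}) (F : {subfield L}) :
  exists F1 : {subfield E}, forall y, y \in F1 <-> exists2 x, x \in F & y = emb x.
Proof.
have [F1 F1P] := @image_subfield (baseFieldType L) E emb (baseAspace F).
exists F1 => y; rewrite F1P.
by split=> -[x Fx ->]; exists x => //; move: Fx; rewrite mem_baseVspace.
Qed.

Section Restriction.

Variables (F0 : fieldType) (L : splittingFieldType F0) (E : splittingFieldType rat).
Variables (emb : {rmorphism L -> E}) (B : {subfield L}) (B1 : {subfield E}).
Hypothesis imB : forall x, x \in B -> emb x \in B1.
Variable s : gal_of {:E}.
Hypothesis Gs : s \in 'Gal({:E} / B1)%g.

(** [s (emb x)] is a root of the image of the minimal polynomial of [x] over B, all of whose roots
    are images of elements of F. *)
Lemma galois_stable (F : {subfield L}) x : galois B F -> x \in F ->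
  exists2 y, y \in F & s (emb x) = emb y.
Proof.
move=> galF Fx; have sBF : (B <= F)%VS by case/and3P: galF.
have [r [_ _ Ep]] := elimT (galois_factors sBF) galF x Fx.
have : root (map_poly (s \o emb) (minPoly B x)) (s (emb x)).
  by rewrite (fmorph_root (s \o emb)) root_minPoly.
have -> : map_poly (s \o emb) (minPoly B x) = map_poly emb (minPoly B x).
  apply/polyP => i; rewrite !coef_map /=; apply: (elimT (mem_galP _ _) Gs).
  by apply/imB/(polyOverP (minPolyOver B x)).
rewrite Ep rmorph_prod big_map; under eq_bigr => b _ do rewrite rmorphB /= map_polyX map_polyC.
rewrite -(big_map (fun b : gal_of F => emb (b x)) xpredT (fun u => 'X - u%:P)) root_prod_XsubC.
by case/mapP => b _ ->; exists (b x) => //; apply: memv_gal.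
Qed.

Lemma gal_restrict : galois B {:L} ->
  exists2 t, t \in 'Gal({:L} / B)%g & forall x, emb (t x) = s (emb x).
Proof.
move=> galL.
have t_ex x : exists y, s (emb x) = emb y.
  by have [y _ ->] := galois_stable galL (memvf x); exists y.
have [t tE] := choice t_ex.
have tB x : x \in B -> t x = x.
  move=> Bx; apply: (fmorph_inj emb); rewrite -tE.
  by apply: (elimT (mem_galP _ _) Gs); apply: imB.
have tM x y : t (x * y) = t x * t y.
  by apply: (fmorph_inj emb); rewrite rmorphM -!tE !rmorphM.
have t_lin : linear t.
  move=> c x y; apply: (fmorph_inj emb); rewrite rmorphD -!tE !rmorphD /=; congr (_ + _).
  by rewrite tE -[c *: x]mulr_algl tM (tB c%:A) ?rpredZ ?rpred1 // mulr_algl.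
pose tL : {linear L -> L} := HB.pack t (GRing.isLinear.Build _ _ _ _ t t_lin).
have homt : kHom B {:L} (linfun tL).
  apply/kHomP; split=> [x y _ _|x Bx]; first by rewrite !lfunE; apply: tM.
  by rewrite lfunE; apply: tB.
have sBL : (B <= {:L} <= {:L})%VS by rewrite !subvf.
have nBL : normalField B {:L} by case/and3P: galL.
have [u Gu uE] := kHom_to_gal sBL nBL homt.
exists u => // x; rewrite tE; congr (emb _).
by rewrite -uE ?memvf // lfunE.
Qed.

End Restriction.

(** * Ramification indices as ratios of valuations *)

Lemma ideal_mul_mem (F0 : fieldType) (L : fieldExtType F0) (I J : set L) x y :
  I x -> J y -> ideal_mul I J (x * y).
Proof. by move=> Ix Jy; exists 1, (fun=> x), (fun=> y); split=> //; rewrite big_ord1. Qed.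

Section RamificationValuation.

Variables (F0 : fieldType) (L : fieldExtType F0) (E : splittingFieldType rat).
Variables (emb : {rmorphism L -> E}) (P : set E) (v : E -> int).
Hypotheses (pP : is_prime_of {:E}%AS P) (hv : valuation P v).

Lemma vge_prime_gen (F : {subfield L}) (Q : set L) (e : int) :
  (forall x, Q x -> x \in F /\ P (emb x)) -> 0 < e ->
  (forall x, x \in F -> x != 0 -> exists m, v (emb x) = m * e) ->
  forall x, Q x -> vge v e (emb x).
Proof.
move=> QP e0 gen x Qx; have [Fx Px] := QP x Qx.
have [->|x0] := eqVneq x 0; first by rewrite rmorph0 vge0.
have x0' : emb x != 0 by rewrite fmorph_eq0.
rewrite vge_val //; have [m Em] := gen x Fx x0; have := val_prime hv Px x0'.
by rewrite Em pmulr_lgt0 // => m0; apply: ler_peMl; [apply: ltW|rewrite -gtz0_ge1].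
Qed.

(** Both sides are the least valuation on the two factorizations of the same ideal: [e1] is attained
    at [pi1], and [n * e2] at [pi2 ^+ n * j] for [j] in J outside P2. *)
Lemma ram_index_val (F1 F2 : {subfield L}) (P1 P2 : set L) (n : nat) (e1 e2 : int)
    (pi1 pi2 : L) :
  (forall x, P1 x <-> x \in F1 /\ P (emb x)) -> (forall x, P2 x <-> x \in F2 /\ P (emb x)) ->
  pi1 \in F1 -> P (emb pi1) -> pi1 != 0 -> 0 < e1 -> v (emb pi1) = e1 ->
  (forall x, x \in F1 -> x != 0 -> exists m, v (emb x) = m * e1) ->
  pi2 \in F2 -> P (emb pi2) -> pi2 != 0 -> 0 < e2 -> v (emb pi2) = e2 ->
  (forall x, x \in F2 -> x != 0 -> exists m, v (emb x) = m * e2) ->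
  has_ram_index F2 P1 P2 n -> e1 = n%:Z * e2.
Proof.
move=> hP1 hP2 Fpi1 Ppi1 pi1_0 e1_gt0 vpi1 gen1 Fpi2 Ppi2 pi2_0 e2_gt0 vpi2 gen2
  [J [[JO _ _ _] JP EJ]].
have vO x : int_ring F2 x -> vge v 0 (emb x).
  by case=> _ ix; apply: (vge_aint hv); apply/(aint_rmorph emb).
have vP1 := vge_prime_gen (fun x => proj1 (hP1 x)) e1_gt0 gen1.
have vP2 := vge_prime_gen (fun x => proj1 (hP2 x)) e2_gt0 gen2.
have vexp m x : ideal_exp F2 P2 m x -> vge v (m%:Z * e2) (emb x).
  elim: m x => [|m IH] x; first by rewrite mul0r; apply: vO.
  case=> N [a [b [Pa Pb ->]]]; rewrite rmorph_sum; apply: (vge_sum pP hv) => i _.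
  rewrite rmorphM intS mulrDl mul1r; apply: (vgeM hv); first exact: vP2.
  exact/IH/Pb.
have exp_pi2 m : ideal_exp F2 P2 m (pi2 ^+ m).
  elim: m => [|m IH]; first by split; [apply: rpred1|apply: (aint_int L 1)].
  by rewrite exprS; apply: ideal_mul_mem => //; apply/hP2.
apply/le_anti/andP; split.
  have [j [Jj Qj]] : exists j, J j /\ ~ P2 j.
    apply: contrapT => none; apply: JP => j Jj; apply: contrapT => Qj; apply: none.
    by exists j.
  have [Fj ij] := JO _ Jj.
  have Pj : ~ P (emb j) by move=> Pj; apply: Qj; apply/hP2.
  have j0 : emb j != 0 by apply: contra_not_neq Pj => ->; apply: (prime0 pP).
  have : ideal_mul P1 (int_ring F2) (pi2 ^+ n * j).
    by rewrite EJ; apply: ideal_mul_mem.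
  case=> N [a [b [Pa Ob E']]].
  have : vge v e1 (emb (pi2 ^+ n * j)).
    rewrite E' rmorph_sum; apply: (vge_sum pP hv) => i _; rewrite rmorphM.
    by apply: (vge_mulr hv); [apply: vP1|apply: vO].
  have pi2_0' : emb pi2 != 0 by rewrite fmorph_eq0.
  rewrite rmorphM rmorphXn /= vge_val ?mulf_neq0 ?expf_neq0 //.
  rewrite (valM hv) ?expf_neq0 // (valX hv) // vpi2 (val_coprime hv _ Pj).
    by rewrite addr0 mulrC.
  exact/(aint_rmorph emb).
have : ideal_mul (ideal_exp F2 P2 n) J pi1.
  rewrite -EJ -[pi1]mulr1; apply: ideal_mul_mem; first by apply/hP1.
  by split; [apply: rpred1|apply: (aint_int L 1)].
case=> N [a [b [Pa Jb E']]].
have : vge v (n%:Z * e2) (emb pi1).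
  rewrite E' rmorph_sum; apply: (vge_sum pP hv) => i _; rewrite rmorphM.
  by apply: (vge_mulr hv); [apply: vexp|apply/vO/JO].
by rewrite vge_val ?fmorph_eq0 // vpi1.
Qed.

End RamificationValuation.

(** * Conjugates of roots of unity over a linearly disjoint field *)

Section CyclotomicConjugates.

Variables (E : splittingFieldType rat) (f : {rmorphism E -> algC}) (F : {subfield E}).
Variables (l m : nat) (z : E).
Hypotheses (z_prim : l.-primitive_root z) (cml : coprime m l).
Hypothesis disj : linearly_disjoint [set f x | x in [set x | x \in F]]%classic
  (adjoin rat_in_algC (f z)).

Lemma rat_root_unity (p : {poly rat}) : root (map_poly ratr p) (f z) ->
  root (map_poly ratr p) (f (z ^+ m)).
Proof.
have prim_fz : l.-primitive_root (f z) by rewrite fmorph_primitive_root.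
have prim_fzm : l.-primitive_root (f (z ^+ m)).
  by rewrite fmorph_primitive_root prim_root_exp_coprime.
have [q [Eq _] ->] := minCpolyP (f z); have [q' [Eq' _] ->] := minCpolyP (f (z ^+ m)).
suff -> : q = q' by [].
apply: (map_poly_inj (ratr : rat -> algC)).
rewrite -Eq -Eq' !(minCpoly_cyclotomic prim_fz, minCpoly_cyclotomic prim_fzm).
by rewrite -(Cintr_Cyclotomic prim_fz) (Cintr_Cyclotomic prim_fzm).
Qed.

(* Linear disjointness lets one compare the coordinates of p(z) in a basis of F
   over Q, so that the coordinates of p all vanish at z. *)
Lemma root_unity_conjugate p : p \is a polyOver F -> root p z -> root p (z ^+ m).
Proof.
move=> Fp /eqP pz; pose B := vbasis F; pose n := \dim F.
pose q (i : 'I_n) := \poly_(j < size p) coord B i p`_j.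
have Ep x : p.[x] = \sum_(i < n) B`_i * (map_poly (in_alg E) (q i)).[x].
  rewrite horner_coef; under [RHS]eq_bigr => i _.
    rewrite (@horner_coef_wide _ (size p)); last first.
      by rewrite size_map_poly size_poly.
    rewrite mulr_sumr; over.
  rewrite exchange_big; apply: eq_bigr => j _ /=.
  rewrite {1}(coord_vbasis (polyOverP Fp j)) mulr_suml; apply: eq_bigr => i _.
  by rewrite mulrA coef_map coef_poly ltn_ord /= mulr_algr.
have fq i x : f (map_poly (in_alg E) (q i)).[x] = (map_poly ratr (q i)).[f x].
  rewrite -horner_map -map_poly_comp; congr (_.[_]).
  by apply: eq_map_poly => a /=; rewrite alg_num_field fmorph_rat.
have BF (i : 'I_n) : B`_i \in F by apply: vbasis_mem; rewrite mem_nth ?size_tuple.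
have q0 i : (map_poly ratr (q i)).[f z] = 0.
  apply: (@disj n (fun j : 'I_n => f B`_j) _ _ (fun j => (map_poly ratr (q j)).[f z])).
  - by move=> j; exists B`_j => //; apply: BF.
  - move=> c Qc sum0 j; have /choice[a Ea] i' : exists a, c i' = ratr a.
      by have [a _ <-] := Qc i'; exists a.
    have : \sum_(i < n) a i *: B`_i = 0.
      apply: (fmorph_inj f); rewrite rmorph0 rmorph_sum -[RHS]sum0.
      by apply: eq_bigr => i' _; rewrite /= rmorphZ_num Ea.
    move/(elimT freeP (basis_free (vbasisP F))) => a0.
    by rewrite Ea a0 rmorph0.
  - move=> j; exists (map_poly ratr (q j)), 1; rewrite hornerC oner_eq0 divr1; split=> // u.
      by rewrite coef_map; exists (q j)`_u.
    by rewrite coef1; exists (u == 0%N)%:R; rewrite ?rmorph_nat.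
  - transitivity (f p.[z]); last by rewrite pz rmorph0.
    by rewrite Ep rmorph_sum; apply: eq_bigr => i' _; rewrite rmorphM /= fq mulrC.
rewrite /root Ep big1 // => j _; apply/eqP; rewrite mulf_eq0; apply/orP; right.
by rewrite -(fmorph_eq0 f) fq; apply: rat_root_unity; apply/eqP.
Qed.

Lemma root_unity_gal : exists2 s, s \in 'Gal({:E} / F)%g & s z = z ^+ m.
Proof.
have [r [sub _ Ep]] := elimT (galois_factors (subvf F)) (galois_full F) z (memvf z).
have := root_unity_conjugate (minPolyOver F z) (root_minPoly F z).
rewrite Ep root_prod_XsubC => /mapP[s rs ->]; exists s => //.
by move/fintype.subsetP: sub; apply.
Qed.

End CyclotomicConjugates.

Lemma prime_image (F0 : fieldType) (L : fieldExtType F0) (E : fieldExtType rat)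
    (emb : {rmorphism L -> E}) (F : {subfield L}) (F1 : {subfield E}) (Q : set L) :
  (forall y, y \in F1 <-> exists2 x, x \in F & y = emb x) ->
  is_prime_of F Q -> is_prime_of F1 (emb @` Q).
Proof.
move=> imF [[QO Q0 QD QM] [x Qx x0] Q1 Qp].
have OF1 y : int_ring F1 y <-> exists2 x, int_ring F x & y = emb x.
  split=> [[/imF[u Fu ->] /(aint_rmorph emb) iu]|[u [Fu iu] ->]]; first by exists u.
  by split; [apply/imF; exists u|apply/(aint_rmorph emb)].
split.
- split.
  + by move=> _ [u Qu <-]; apply/OF1; exists u => //; apply: QO.
  + by exists 0; rewrite ?rmorph0.
  + by move=> _ _ [u Qu <-] [w Qw <-]; exists (u + w); rewrite ?rmorphD //; apply: QD.
  + move=> _ _ /OF1[u Ou ->] [w Qw <-].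
    by exists (u * w); rewrite ?rmorphM //; apply: QM.
- by exists (emb x); [exists x|rewrite fmorph_eq0].
- by case=> u Qu /eqP; rewrite -(rmorph1 emb) (inj_eq (fmorph_inj emb)) => /eqP u1; apply: Q1; rewrite -u1.
- move=> _ _ /OF1[u Ou ->] /OF1[w Ow ->] [t Qt]; rewrite -rmorphM => /(fmorph_inj emb) Et.
  by rewrite Et in Qt; case: (Qp u w Ou Ow Qt) => h; [left; exists u|right; exists w].
Qed.

(* k is identified with the subfield 1%AS of L, and L is embedded by iota in an
   algebraic closure of the rational numbers that contains the roots of unity. *)
Theorem theorem4p7 (k : fieldExtType rat) (L : splittingFieldType k)
    (K : {subfield L}) (l : nat) (p : set L) (e : nat)
    (iota : {rmorphism L -> algC}) (zeta : nat -> algC)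
    (zeta_prim : forall n, (0 < n)%N -> n.-primitive_root (zeta n))
    (galLk : galois 1%AS {:L})
    (galKk : galois 1%AS K) (abKk : abelian 'Gal(K / 1%AS))
    (galLK : galois K {:L}) (abLK : abelian 'Gal({:L} / K))
    (Kreal : totally_real K)
    (l_prime : prime l) (l_odd : odd l) (degLK : \dim_K {:L} = l)
    (tameLK : tame K {:L}%AS)
    (p_prime : is_prime_of 1%AS p)
    (p_ram : ramifies_above 1%AS K {:L}%AS p)
    (p_e : galois_ram_index 1%AS K p e)
    (e_odd_factor : exists d, [/\ odd d, (1 < d)%N & (d %| e)%N])
    (disj : linearly_disjoint (iota @` [set x | x \in K])
                              (adjoin rat_in_algC (zeta l)))
    (cond3 : l = 3%N -> exists q, [/\ prime q, odd q, (q %| e)%N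
       & ~ (\bigcup_(n in [set: nat]) adjoin (range iota) (zeta (3 ^ n)%N))
             (zeta q)]) :
  ~ has_weak_NIB K.
Proof.
move=> nib.
have [E [f [emb [femb fz]]]] := galois_embedding_tower iota [:: zeta l].
have [z Ez] := fz (zeta l) (mem_head _ _).
have [k1 imk] := image_subfield_tower emb 1%AS.
have [K1 imK] := image_subfield_tower emb K.
have [L1 imL'] := image_subfield_tower emb {:L}%AS.
have imL y : y \in L1 <-> exists x, y = emb x.
  by rewrite imL'; split=> -[x]; [move=> _ ->|move=> ->]; exists x; rewrite ?memvf.
have embk x : x \in 1%AS -> emb x \in k1 by move=> kx; apply/imk; exists x.
have embK x : x \in K -> emb x \in K1 by move=> Kx; apply/imK; exists x.
have embL x : emb x \in L1 by apply/imL; exists x.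
have l_gt0 : (0 < l)%N := prime_gt0 l_prime.
have z_prim : l.-primitive_root z by rewrite -(fmorph_primitive_root f) Ez; apply: zeta_prim.
have cardG : #|'Gal({:L} / K)%g| = l by rewrite -(galois_dim galLK).
have skK : (k1 <= K1)%VS.
  by apply/subvP => _ /imk[x kx ->]; apply: embK; apply: (subvP (sub1v K)).
have sKL : (K1 <= L1)%VS by apply/subvP => _ /imK[x _ ->].
have normK s x : s \in 'Gal({:E} / k1)%g -> x \in K1 -> s x \in K1.
  move=> Gs /imK[y Ky ->].
  by have [w Kw ->] := galois_stable embk Gs galKk Ky; apply: embK.
have normL s x : s \in 'Gal({:E} / k1)%g -> x \in L1 -> s x \in L1.
  move=> Gs /imL[y ->].
  by have [w _ ->] := galois_stable embk Gs galLk (memvf y).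
have res s (Gs : s \in 'Gal({:E} / K1)%g) := gal_restrict embK Gs galLK.
have embX (s : gal_of {:E}) (t : gal_of {:L}) : (forall x, emb (t x) = s (emb x)) ->
    forall i x, emb ((t ^+ i)%g x) = iter i s (emb x).
  move=> st; elim=> [|i IH] x; first by rewrite gal_id.
  by rewrite expgSr galM ?memvf // st IH.
have galL_order s x : s \in 'Gal({:E} / K1)%g -> x \in L1 -> iter l s x = x.
  move=> Gs /imL[y ->]; have [t Gt st] := res s Gs.
  by rewrite -(embX s t st) -cardG expg_cardG // gal_id.
have galL_cyclic s t : s \in 'Gal({:E} / K1)%g -> t \in 'Gal({:E} / K1)%g ->
    (exists2 x, x \in L1 & s x != x) -> exists i, forall x, x \in L1 -> t x = iter i s x.
  move=> Gs Gt [x /imL[y ->] sy]; have [s' Gs' ss] := res s Gs; have [t' Gt' tt] := res t Gt.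
  have pG : prime #|'Gal({:L} / K)%g| by rewrite cardG.
  have s1 : s' != 1%g by apply: contraNneq sy => s1; rewrite -ss s1 gal_id.
  have : t' \in <[s']>%g by rewrite -(nt_gen_prime pG) // !inE s1.
  case/cyclePmin=> i _ Et; exists i => _ /imL[w ->].
  by rewrite -tt Et (embX s s' ss).
have K_real (s : gal_of {:E}) x : x \in K1 -> f (s x) \is Num.real.
  case/imK=> y Ky ->.
  exact: (Kreal (f \o s \o emb \o vsval : {rmorphism subvs_of K -> algC}) (Subvs Ky)).
have imK_set : iota @` [set x | x \in K] = f @` [set x | x \in K1].
  apply/seteqP; split=> [_ [x Kx <-]|_ [_ /imK[x Kx ->] <-]].
    by exists (emb x); [apply: embK|apply: femb].
  by exists x; rewrite ?femb.
rewrite imK_set -Ez in disj.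
have cyc m : coprime m l -> exists2 s, s \in 'Gal({:E} / L1)%g & s z = z ^+ m.
  move=> cml; have [s Gs sz] := root_unity_gal z_prim cml disj.
  (* Disjointness is known for K, not for L. The [l]-th power makes the automorphism trivial on L1
     and, by Fermat's little theorem, still sends [z] to [z ^+ m]. *)
  exists (s ^+ l)%g.
    by apply/mem_galP => x Lx; rewrite galXx galL_order.
  have -> : (s ^+ l)%g z = z ^+ (m ^ l).
    elim: (l) => [|i IH]; first by rewrite gal_id.
    by rewrite expgS galMx sz rmorphXn /= IH -exprM -expnSr.
  by apply/eqP; rewrite (eq_prim_root_expr z_prim) fermat_little.
have [P' [pP' abP' [Q [e' [pQ abQ ramQ e'1]]]]] := p_ram.
have [P [pP abP]] := prime_above (prime_image imL' pQ).
have QE x : Q x <-> P (emb x).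
  split=> [Qx|Px].
    by have : (emb @` Q) (emb x) by [exists x]; rewrite -abP => -[].
  have : (P `&` [set x | x \in L1]) (emb x) by split=> //; apply: embL.
  by rewrite abP => -[y Qy /(fmorph_inj emb) <-].
have hQ x : Q x <-> x \in {:L}%AS /\ P (emb x).
  by rewrite QE memvf; split=> [|[]].
have hP' x : P' x <-> x \in K /\ P (emb x).
  by rewrite -abQ -QE; split=> -[].
have hp x : p x <-> x \in 1%AS /\ P (emb x).
  rewrite -abP'; split=> [[/hP'[_ Px] kx]|[kx Px]] //; split=> //; apply/hP'.
  by split=> //; apply: (subvP (sub1v K)).
have [v hv] := valuation_exists pP.
have [eL [piL [eL0 LpiL PpiL piL0 [vpiL genL]]]] := val_generator L1 pP hv.
have [eK [piK [eK0 KpiK PpiK piK0 [vpiK genK]]]] := val_generator K1 pP hv.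
have [ek [pik [ek0 kpik Ppik pik0 [vpik genk]]]] := val_generator k1 pP hv.
have eKE : eK = e'%:Z * eL.
  have [xL _ ExL] := proj1 (imL' _) LpiL; have [xK KxK ExK] := proj1 (imK _) KpiK.
  subst piL piK; rewrite fmorph_eq0 in piL0; rewrite fmorph_eq0 in piK0.
  apply: (ram_index_val pP hv hP' hQ KxK PpiK piK0 eK0 vpiK _ (memvf _) PpiL piL0 eL0 vpiL _ ramQ).
    by move=> x Kx x0; apply: genK; rewrite ?fmorph_eq0 //; apply: embK.
  by move=> x _ x0; apply: genL; [apply: embL|rewrite fmorph_eq0].
have ekE : ek = e%:Z * eK.
  have [xk kxk Exk] := proj1 (imk _) kpik; have [xK KxK ExK] := proj1 (imK _) KpiK.
  subst pik piK; rewrite fmorph_eq0 in pik0; rewrite fmorph_eq0 in piK0.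
  have ramP : has_ram_index K p P' e.
    exact: p_e.
  apply: (ram_index_val pP hv hp hP' kxk Ppik pik0 ek0 vpik _ KxK PpiK piK0 eK0 vpiK _ ramP).
    by move=> x kx x0; apply: genk; rewrite ?fmorph_eq0 //; apply: embk.
  by move=> x Kx x0; apply: genK; rewrite ?fmorph_eq0 //; apply: embK.
have tameL r : prime r -> P r%:R -> ~~ (r %| e')%N.
  move=> rp Pr; have Qr : Q r%:R by apply/QE; rewrite rmorph_nat.
  exact: (tameLK _ _ _ _ pP' pQ abQ ramQ rp Qr).
have genk' x : x \in k1 -> x != 0 -> exists m, v x = m * (e%:Z * eK).
  by rewrite -ekE; apply: genk.
have l3 q : ~ (\bigcup_(n in [set: nat]) adjoin (range iota) (zeta (3 ^ n)%N)) (zeta q) ->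
    l = 3 -> prime q -> forall x, x \in <<K1; z>>%VS -> ~~ q.-primitive_root x.
  (* A primitive [q]-th root of unity in K(zeta_3) has [zeta q] among its powers, so the level
     [n = 1] of the tower already contains it. *)
  move=> hq l_eq3 q_prime x Kzx; apply/negP => x_prim; apply: hq; exists 1%N => //.
  have := zeta_prim q (prime_gt0 q_prime); rewrite -(fmorph_primitive_root f) in x_prim.
  move=> /prim_expr_order /(prim_rootP x_prim)[i Ei].
  have /Fadjoin_polyP[g Kg Eg] : x ^+ i \in <<K1; z>>%VS by rewrite rpredX.
  exists (map_poly f g), 1; rewrite hornerC oner_eq0 divr1; split=> //.
  - move=> j; rewrite coef_map; have /imK[y _ ->] := polyOverP Kg j.
    by rewrite /= femb; exists y.
  - by move=> j; rewrite coef1; exists (j == 0%N)%:R; rewrite ?rmorph_nat.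
  - by rewrite Ei -rmorphXn Eg -horner_map Ez l_eq3.
have ex_q : exists q, [/\ prime q, odd q, (q %| e)%N &
    l = 3 -> forall x, x \in <<K1; z>>%VS -> ~~ q.-primitive_root x].
  have [l_eq3|l_neq3] := eqVneq l 3%N.
    have [q [q_prime q_odd qe hq]] := cond3 l_eq3.
    by exists q; split=> // _; apply: l3.
  have [d [d_odd d1 de]] := e_odd_factor.
  exists (pdiv d); split; first exact: pdiv_prime.
  - exact: dvdn_odd (pdiv_dvd d) d_odd.
  - exact: dvdn_trans (pdiv_dvd d) de.
  - by move=> l_eq3; rewrite l_eq3 eqxx in l_neq3.
apply: (no_resolvent_generator pP hv l_prime l_odd z_prim skK sKL normK normL galL_order galL_cyclic K_real
  cyc eL0 LpiL PpiL piL0 vpiL genL KpiK piK0 vpiK genK eKE e'1 tameL genk' ex_q).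
exact: (weak_NIB_resolvents galLK l_prime cardG imL embK res nib).
Qed.
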